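(* Let $(\Omega,\mathcal L,\mu)$ be a measure space, $X$ a Banach space, and let $\widetilde{\Gamma}\colon\Omega\to\mathcal F(X)$ be a scalarly integrable fuzzy mapping. If for each $r\in(0,1]$ the operator $T_r\colon X^*\to L^1(\mu)$, $T_r(x^* )=s(x^*,\widetilde{\Gamma}_r)$, is weakly compact and every scalarly measurable selection of $\widetilde{\Gamma}_r$ is Pettis integrable, then $\widetilde{\Gamma}$ is a Pettis integrable fuzzy mapping.
   Context: $(\Omega,\mathcal L,\mu)$ is a measure space, $\mathcal L$ being the family of all $\mu$-measurable sets; $X$ is a (real) Banach space with dual $X^*$. $cwk(X)$ is the family of nonempty convex weakly compact subsets of $X$. For $A\in cwk(X)$ and $x^*\in X^*$, $s(x^*,A)=\sup\{\langle x^*,y\rangle: y\in A\}$. Fuzzy numbers: for $u\colon X\to[0,1]$ and $r\in(0,1]$ put $[u]^r=\{x\in X: u(x)\ge r\}$. $u$ is a generalized fuzzy number if $[u]^r\in cwk(X)$ for every $r\in(0,1]$; $\mathcal F(X)$ is the set of all generalized fuzzy numbers. A fuzzy mapping is a map $\widetilde{\Gamma}\colon\Omega\to\mathcal F(X)$; set $\widetilde{\Gamma}_r(\omega):=[\widetilde{\Gamma}(\omega)]^r$, and $s(x^*,\widetilde{\Gamma}_r)$ denotes the function $\omega\mapsto s(x^*,\widetilde{\Gamma}_r(\omega))$. A multifunction $\Gamma\colon\Omega\to cwk(X)$ is scalarly integrable if $s(x^*,\Gamma)$ is $\mu$-integrable for each $x^*\in X^*$; it is Pettis integrable if moreover for each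 $A\in\mathcal L$ there is $W_\Gamma(A)\in cwk(X)$ with $s(x^*,W_\Gamma(A))=\int_A s(x^*,\Gamma)\,d\mu$ for all $x^*\in X^*$. A selection of $\Gamma$ is a function $f\colon\Omega\to X$ with $f(\omega)\in\Gamma(\omega)$ for every $\omega\in\Omega$; $f$ is scalarly measurable if $x^*f$ is measurable for each $x^*\in X^*$, and Pettis integrable if $x^*f$ is integrable for each $x^*\in X^*$ and for each $A\in\mathcal L$ there is $F(A)\in X$ with $x^*(F(A))=\int_A x^*f\,d\mu$ for all $x^*\in X^*$. A fuzzy mapping $\widetilde{\Gamma}$ is scalarly integrable if $\widetilde{\Gamma}_r$ is scalarly integrable for all $r\in(0,1]$. It is Pettis integrable if every $\widetilde{\Gamma}_r$, $r\in(0,1]$, is a Pettis integrable multifunction and, for each $A\in\mathcal L$, there is $\widetilde{M_\Gamma}(A)\in\mathcal F(X)$ such that $s(x^*,[\widetilde{M_\Gamma}(A)]^r)=\int_A s(x^*,\widetilde{\Gamma}_r)\,d\mu$ for all $r\in(0,1]$ and $x^*\in X^*$. The (not necessarily linear) operator $T_r$ is weakly compact if it maps bounded subsets of $X^*$ to relatively weakly compact subsets of $L^1(\mu)$. *)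

(* Defs.v *)
From HB Require Import structures.
From mathcomp Require Import all_boot all_order all_algebra.
From mathcomp Require Import generic_quotient ring_quotient.
From mathcomp Require Import all_classical all_reals all_analysis.
From mathcomp Require Import measurable_realfun.

Set Implicit Arguments.
Unset Strict Implicit.
Unset Printing Implicit Defensive.

Import Order.TTheory GRing.Theory Num.Theory.
Import numFieldNormedType.Exports.

Local Open Scope classical_set_scope.
Local Open Scope ring_scope.

(** * Duality and weak topology *)

Record dual (R : realType) (V : normedModType R) := Dual {
  dual_fun :> {linear V -> R^o};
  dual_continuous : continuous dual_fun }.

Definition dual_norm (R : realType) (V : normedModType R) (f : dual V) : R :=
  sup [set `|f x| | x in [set x : V | `|x| <= 1]].

Definition dual_bounded (R : realType) (V : normedModType R)
    (B : set (dual V)) :=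
  exists M : R, forall f, B f -> dual_norm f <= M.

(** The coarsest topology on [V] for which every functional of the dual is
    continuous. *)
Definition weak (R : realType) (V : normedModType R) : topologicalType :=
  initial_topology (fun x : V => (fun f : dual V => f x) : {ptws dual V -> R^o}).

Definition weakly_compact (R : realType) (V : normedModType R) (A : set V) :=
  compact (A : set (weak V)).

Definition relatively_weakly_compact (R : realType) (V : normedModType R)
    (A : set V) :=
  precompact (A : set (weak V)).

(** * The Banach space [L^1(mu)] *)

Section L1.
Context d (T : measurableType d) (R : realType).
Variable mu : {measure set T -> \bar R}.

Let Lf := LfunType mu (lexx 1%E).

Definition null_Lfun : {pred Lf} :=
  fun f : Lf => `[< (f : T -> R) = cst 0 %[ae mu] >].

Lemma null_LfunP (f : Lf) :
  reflect ({ae mu, forall x, f x = 0}) (f \in null_Lfun).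
Proof.
rewrite unfold_in /null_Lfun; apply: (iffP (asboolP _)) => h.
- by apply: filterS h => x /(_ I).
- by apply: filterS h => x h _.
Qed.

Lemma null_Lfun_zmod_closed : zmod_closed null_Lfun.
Proof.
split; first by apply/null_LfunP/aeW.
move=> f g /null_LfunP f0 /null_LfunP g0; apply/null_LfunP.
apply: filterS2 f0 g0 => x /= fx gx.
by rewrite [LHS](_ : _ = f x - g x)// fx gx subrr.
Qed.

HB.instance Definition _ :=
  GRing.isZmodClosed.Build Lf null_Lfun null_Lfun_zmod_closed.

(** Integrable functions modulo almost everywhere equality. *)
Definition L1 : Type := Quotient.quot null_Lfun.
HB.instance Definition _ := GRing.Zmodule.on L1.
HB.instance Definition _ := EqQuotient.on L1.

Local Notation pi := (\pi_L1)%qT.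

Let L1_repr (f : Lf) : {ae mu, forall x, f x = (repr (pi f) : Lf) x}.
Proof.
have /eqP := esym (reprK (pi f)).
rewrite -Quotient.idealrBE => /null_LfunP.
by apply: filterS => x /eqP; rewrite subr_eq0 => /eqP.
Qed.

Let L1_ae_eq (f g : Lf) : {ae mu, forall x, f x = g x} -> pi f = pi g.
Proof.
move=> fg; apply/eqP; rewrite -Quotient.idealrBE; apply/null_LfunP.
by apply: filterS fg => x /= fgx; rewrite [LHS](_ : _ = f x - g x)// fgx subrr.
Qed.

Definition L1_scale (a : R) (F : L1) : L1 := pi (a *: (repr F : Lf)).

Let L1_scale_pi a (f : Lf) : L1_scale a (pi f) = pi (a *: f).
Proof.
apply: L1_ae_eq; apply: filterS (L1_repr f) => x fx.
exact: (congr1 ( *%R a) (esym fx)).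
Qed.

Let piD (f g : Lf) : pi (f + g) = pi f + pi g.
Proof. by rewrite !piE. Qed.

Let scaleA a b F : L1_scale a (L1_scale b F) = L1_scale (a * b) F.
Proof.
rewrite -[F]reprK; move: (repr F) => f.
by rewrite (L1_scale_pi b) (L1_scale_pi a) (L1_scale_pi (a * b)) scalerA.
Qed.

Let scale1 : left_id 1 L1_scale.
Proof. by move=> F; rewrite -[F]reprK L1_scale_pi scale1r. Qed.

Let scaleDr : right_distributive L1_scale +%R.
Proof.
move=> a F G; rewrite -[F]reprK -[G]reprK; move: (repr F) (repr G) => f g.
by rewrite -piD !L1_scale_pi scalerDr piD.
Qed.

Let scaleDl F : {morph L1_scale^~ F : a b / a + b}.
Proof.
move=> a b /=; rewrite -[F]reprK; move: (repr F) => f.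
by rewrite !L1_scale_pi scalerDl piD.
Qed.

HB.instance Definition _ :=
  GRing.Zmodule_isLmodule.Build R L1 scaleA scale1 scaleDr scaleDl.

Definition L1_norm (F : L1) : R := fine 'N[mu]_1[EFin \o (repr F : Lf)]%E.

Let measurable_Lfun_abse (f : Lf) :
  measurable_fun [set: T] (abse \o (EFin \o f)).
Proof.
have /Lfun1_integrable /integrableP[mf _] := LfunP f.
exact: (measurableT_comp (@abse_measurable R setT) mf).
Qed.

Let L1_norm_pi (f : Lf) : L1_norm (pi f) = fine 'N[mu]_1[EFin \o f]%E.
Proof.
rewrite /L1_norm !Lnorm1; congr fine.
apply: ae_eq_integral => //; try exact: measurable_Lfun_abse.
by apply: filterS (L1_repr f) => x /= <-.
Qed.

Let L1_normD F G : L1_norm (F + G) <= L1_norm F + L1_norm G.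
Proof.
rewrite -[F]reprK -[G]reprK; move: (repr F) (repr G) => f g.
by rewrite -piD !L1_norm_pi; exact: ler_LnormD.
Qed.

Let L1_normZ a F : L1_norm (a *: F) = `|a| * L1_norm F.
Proof.
rewrite -[F]reprK; move: (repr F) => f; rewrite [_ *: _]L1_scale_pi !L1_norm_pi.
apply: EFin_inj; rewrite EFinM !finite_norm_fine.
exact: LnormZ.
Qed.

Let L1_norm_eq0 F : L1_norm F = 0 -> F = 0.
Proof.
rewrite -[F]reprK; move: (repr F) => f; rewrite L1_norm_pi => /fine_Lnormr_eq0 f0.
rewrite -[0](_ : pi 0 = 0); last by rewrite !piE.
by apply: L1_ae_eq; apply: filterS f0 => x /(_ I).
Qed.

HB.instance Definition _ :=
  Lmodule_isNormed.Build R L1 L1_normD L1_normZ L1_norm_eq0.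

Definition toL1 (f : T -> R) (intf : mu.-integrable setT (EFin \o f)) : L1 :=
  pi (Lfun_Sub (lexx 1%E) ((Lfun1_integrable mu f).2 intf)).

End L1.

(** * Multifunctions and their integrals *)

Section multifunctions.
Context d (T : measurableType d) (R : realType) (X : completeNormedModType R).
Variable mu : {measure set T -> \bar R}.

Definition cwk (A : set X) :=
  [/\ A !=set0, convex_set (A : set (convex_lmodType X)) & weakly_compact A].

Definition supp (f : dual X) (A : set X) : R := sup [set f y | y in A].

(** Below, a multifunction [Gamma : T -> set X] is meant to take values in
    [cwk]. *)
Definition scalarly_integrable (Gamma : T -> set X) :=
  forall f : dual X, mu.-integrable setT (EFin \o (fun w => supp f (Gamma w))).

Definition mf_pettis_integrable (Gamma : T -> set X) :=
  scalarly_integrable Gamma /\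
  forall A : set T, measurable A -> exists2 W : set X, cwk W &
    forall f : dual X,
      ((supp f W)%:E = \int[mu]_(w in A) (supp f (Gamma w))%:E)%E.

Definition selection (Gamma : T -> set X) (g : T -> X) :=
  forall w, Gamma w (g w).

Definition scalarly_measurable (g : T -> X) :=
  forall f : dual X, measurable_fun [set: T] (fun w => f (g w) : R).

Definition pettis_integrable (g : T -> X) :=
  (forall f : dual X, mu.-integrable setT (EFin \o (fun w => f (g w) : R))) /\
  forall A : set T, measurable A -> exists I : X,
    forall f : dual X, ((f I)%:E = \int[mu]_(w in A) (f (g w))%:E)%E.

(** [s(., Gamma)] as an operator from the dual of [X] to [L^1(mu)]. *)
Definition supp_op (Gamma : T -> set X) (iG : scalarly_integrable Gamma)
  (f : dual X) : L1 mu := toL1 (iG f).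

End multifunctions.

(** [S] need not be linear. *)
Definition weakly_compact_op (R : realType) (X Y : normedModType R)
    (S : dual X -> Y) :=
  forall B : set (dual X), dual_bounded B ->
    relatively_weakly_compact (S @` B).

(** * Fuzzy numbers and fuzzy mappings *)

Definition fuzzy_level (R : realType) (X : Type) (u : X -> R) (r : R) : set X :=
  [set x | r <= u x].

Record fuzzy_number (R : realType) (X : completeNormedModType R) := FuzzyNumber {
  fuzzy_fun :> X -> R;
  fuzzy_fun01 : forall x, 0 <= fuzzy_fun x <= 1;
  fuzzy_level_cwk : forall r, 0 < r <= 1 -> cwk (fuzzy_level fuzzy_fun r) }.

Section fuzzy.
Context d (T : measurableType d) (R : realType) (X : completeNormedModType R).
Variables (mu : {measure set T -> \bar R}) (G : T -> fuzzy_number X).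

Definition mf_level (r : R) : T -> set X := fun w => fuzzy_level (G w) r.

Definition fuzzy_scalarly_integrable :=
  forall r : R, 0 < r <= 1 -> scalarly_integrable mu (mf_level r).

Definition fuzzy_pettis_integrable :=
  (forall r : R, 0 < r <= 1 -> mf_pettis_integrable mu (mf_level r)) /\
  forall A : set T, measurable A -> exists M : fuzzy_number X,
    forall r : R, 0 < r <= 1 -> forall f : dual X,
      ((supp f (fuzzy_level M r))%:E =
        \int[mu]_(w in A) (supp f (mf_level r w))%:E)%E.

End fuzzy.

(* Main.v *)
(** Fix a level multifunction [G] and a measurable set [A], and let [W] be the
    weak closure of the set of integrals over [A] of the scalarly measurable
    selections of [G].

    Selections exist: if a scalarly measurable multifunction could not be shrunk,
    on any set of positive measure, to one of scalar width at most [e] for every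
    functional of norm at most one, then splitting it again and again along the
    faces exposed by [z] and [- z] would produce, above a single point, a dyadic
    tree of subsets of a weakly compact set with siblings [e]-separated; its
    uncountably many branches would give [e]-separated points in a norm-separable
    space. Letting [e] tend to [0] gives a multifunction that is scalarly a
    singleton almost everywhere, any selection of which is scalarly measurable by
    completeness of the measure. Applied to the face of [G] exposed by [f], this
    shows that [supp f W] is the integral of [supp f G].

    [W] is weakly compact: a limit [xi] of functionals along an ultrafilter on
    [W] that is not an evaluation yields, by Helly's theorem, bounded functionals
    [f k] and integrals [x n] of selections [g n] with [f k (x n) = 0] for [n < k]
    and [f k (x n) >= 1/2] for [k <= n]. After passing to convex blocks in both
    indices the iterated limits of [f k (g n t)] exist for almost every [t] and
    agree because [G t] is weakly compact. Weak compactness of the operator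
    [f |-> supp f G] makes its values uniformly integrable (gliding hump), so the
    limits may be integrated, a contradiction.

    Finally the sets [W] decrease with the level, and monotone limits of support
    functions show that they are, up to left limits, the levels of a fuzzy
    number. *)

Require Import Defs.
From HB Require Import structures.
From mathcomp Require Import all_boot all_order all_algebra.
From mathcomp Require Import all_classical all_reals all_analysis.
From mathcomp Require Import measurable_realfun ring lra.

Set Implicit Arguments.
Unset Strict Implicit.
Unset Printing Implicit Defensive.

Import Order.TTheory GRing.Theory Num.Theory.
Import numFieldNormedType.Exports.

Local Open Scope classical_set_scope.
Local Open Scope ring_scope.

(** * Hahn-Banach and the dual space *)

Section hahn_banach.
Context (R : realType) (V : lmodType R).
Implicit Types (p q : V -> R) (x y : V).

(** Homogeneity is only an inequality, which is easier to check for infima; applying it to [t^-1] as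
    well recovers equality. *)
Definition sublinear p :=
  (forall x y, p (x + y) <= p x + p y) /\
  (forall t x, 0 < t -> p (t *: x) <= t * p x).

Lemma sublinearZ p t x : sublinear p -> 0 < t -> p (t *: x) = t * p x.
Proof.
move=> [_ pZ] t0; apply/eqP; rewrite eq_le pZ//=.
have := pZ t^-1 (t *: x); rewrite invr_gt0 => /(_ t0).
by rewrite scalerA mulVf ?gt_eqF// scale1r ler_pdivlMl.
Qed.

Lemma sublinear0 p : sublinear p -> p 0 = 0.
Proof.
by move=> sp; have := sublinearZ 0 sp (ltr0n R 2); rewrite scaler0; lra.
Qed.

Lemma sublinearN p x : sublinear p -> - p (- x) <= p x.
Proof.
by move=> sp; have := sp.1 x (- x); rewrite subrr sublinear0//; lra.
Qed.

(** Sums and dilations of members of [A] are dominated by members of [A], so the inequalities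
    survive the infimum; [m] keeps the infimum finite. Used for one-sided derivatives, infima of
    chains and the distance to a subspace. *)
Lemma sublinear_inf (A : set (V -> R)) (m : V -> R) :
    A !=set0 -> (forall a, A a -> forall x, m x <= a x) ->
    (forall a b x y, A a -> A b -> exists2 c, A c & c (x + y) <= a x + b y) ->
    (forall a t x, A a -> 0 < t -> exists2 c, A c & c (t *: x) <= t * a x) ->
  sublinear (fun x => inf [set a x | a in A]).
Proof.
move=> [a0 Aa0] mA AD AZ.
have lb x : has_lbound [set a x | a in A] by exists (m x) => _ [a Aa <-]; exact: mA.
have ne x : [set a x | a in A] !=set0 by exists (a0 x), a0.
split=> [x y|t x t0].
  rewrite -lerBlDl; apply: lb_le_inf => // _ [b Ab <-].
  rewrite lerBlDl -lerBlDr; apply: lb_le_inf => // _ [a Aa <-].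
  rewrite lerBlDr; have [c Ac] := AD _ _ x y Aa Ab.
  by apply: le_trans; apply: ge_inf => //; exists c.
rewrite -ler_pdivrMl//; apply: lb_le_inf => // _ [a Aa <-].
rewrite ler_pdivrMl//; have [c Ac] := AZ _ _ x Aa t0.
by apply: le_trans; apply: ge_inf => //; exists c.
Qed.

(* The one-sided directional derivative of [p] at [y] is the largest sublinear
   functional below [p] that is linear along [y]. *)
Lemma sublinear_tilt p y : sublinear p ->
  exists q, [/\ sublinear q, forall x, q x <= p x & q (- y) <= - p y].
Proof.
move=> sp.
pose A := [set a : V -> R |
  exists2 t, 0 <= t & a = fun x => p (x + t *: y) - t * p y].
have lb a : A a -> forall x, - p (- x) <= a x.
  move=> [t t0 ->] x; have := sp.1 (- x) (x + t *: y); rewrite addKr.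
  move: t0; rewrite le_eqVlt => /predU1P[<-|t0].
    by rewrite !scale0r sublinear0// addr0 mul0r; lra.
  by rewrite sublinearZ//; lra.
exists (fun x => inf [set a x | a in A]); split.
- apply: (sublinear_inf (m := fun x => - p (- x))) => //.
  + by exists (fun x => p (x + 0 *: y) - 0 * p y); exists 0.
  + move=> _ _ x x' [t t0 ->] [s s0 ->].
    exists (fun x => p (x + (t + s) *: y) - (t + s) * p y).
      by exists (t + s) => //; exact: addr_ge0.
    by have := sp.1 (x + t *: y) (x' + s *: y); rewrite addrACA -scalerDl; lra.
  + move=> _ t x [s s0 ->] t0.
    exists (fun x => p (x + (t * s) *: y) - (t * s) * p y).
      by exists (t * s) => //; rewrite mulr_ge0// ltW.
    by rewrite -scalerA -scalerDr sublinearZ//; lra.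
- move=> x; apply: ge_inf; first by exists (- p (- x)) => _ [a Aa <-]; exact: lb.
  exists (fun x => p (x + 0 *: y) - 0 * p y); first by exists 0.
  by rewrite scale0r addr0 mul0r subr0.
- apply: ge_inf; first by exists (- p (- - y)) => _ [a Aa <-]; exact: lb.
  exists (fun x => p (x + 1 *: y) - 1 * p y); first by exists 1.
  by rewrite scale1r addNr sublinear0// mul1r sub0r.
Qed.

(** Zorn's lemma for the reversed pointwise order: a nonempty chain is bounded by its pointwise
    infimum, which is finite because every member stays above [- p (- x)]. *)
Lemma minimal_sublinear p : sublinear p -> exists q, [/\ sublinear q,
  forall x, q x <= p x &
  forall r, sublinear r -> (forall x, r x <= q x) -> forall x, r x = q x].
Proof.
move=> sp; pose Q q := sublinear q /\ forall x, q x <= p x.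
pose S := {q : V -> R | Q q}.
pose le (q r : S) := `[< forall x, sval r x <= sval q x >].
have sp' : sublinear p /\ forall x, p x <= p x by [].
have [||A Atot|t tmax] := @ZL_preorder S (exist Q p sp') le.
- by move=> t; apply/asboolP.
- move=> r s t /asboolP rs /asboolP st; apply/asboolP => x.
  exact: le_trans (st x) (rs x).
- have [[a0 Aa0]|A0] := pselect (A !=set0); last first.
    by exists (exist Q p sp') => s As; exfalso; apply: A0; exists s.
  pose A' := [set sval a | a in A].
  have lb a : A' a -> forall x, - p (- x) <= a x.
    move=> [[q [sq qp]] Aq /= <-] x; apply: le_trans (sublinearN x sq).
    by rewrite lerN2; exact: qp.
  have sA : sublinear (fun x => inf [set a x | a in A']).
    apply: (sublinear_inf (m := fun x => - p (- x))) => //.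
    + by exists (sval a0), a0.
    + move=> _ _ x y [a Aa <-] [b Ab <-].
      have [/asboolP ab|/asboolP ba] := Atot _ _ Aa Ab.
      * exists (sval b); first by exists b.
        by apply: le_trans ((svalP b).1.1 x y) _; rewrite lerD2r.
      * exists (sval a); first by exists a.
        by apply: le_trans ((svalP a).1.1 x y) _; rewrite lerD2l.
    + move=> _ t x [a Aa <-] t0; exists (sval a); first by exists a.
      exact: (svalP a).1.2.
  have leA a x : A a -> inf [set a x | a in A'] <= sval a x.
    move=> Aa; apply: ge_inf; first by exists (- p (- x)) => _ [b Ab <-]; exact: lb.
    by exists (sval a) => //; exists a.
  have sA' : sublinear (fun x => inf [set a x | a in A']) /\
      forall x, inf [set a x | a in A'] <= p x.
    by split=> // x; apply: le_trans (leA _ _ Aa0) ((svalP a0).2 x).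
  by exists (exist Q _ sA') => s As; apply/asboolP => x /=; exact: leA.
exists (sval t); split; [exact: (svalP t).1|exact: (svalP t).2|].
move=> r sr rt x; have sr' : sublinear r /\ forall x, r x <= p x.
  by split=> // {}x; exact: le_trans (rt x) ((svalP t).2 x).
have /asboolP tr : le (exist Q r sr') t by apply: tmax; apply/asboolP.
by apply/eqP; rewrite eq_le rt tr.
Qed.

(** Tilting [p] at [x0] first forces the value there. A minimal functional below the tilt is
    unchanged by any further tilt, hence odd, hence linear. *)
Theorem hahn_banach p x0 : sublinear p ->
  exists f : V -> R, [/\ linear f, forall x, f x <= p x & f x0 = p x0].
Proof.
move=> sp; have [p0 [sp0 p0p p0N]] := sublinear_tilt x0 sp.
have [q [sq qp0 qmin]] := minimal_sublinear sp0.
have qN y : q (- y) = - q y.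
  have [r [sr rq rN]] := sublinear_tilt y sq.
  by have := qmin _ sr rq (- y); have := sublinearN (- y) sq; rewrite opprK; lra.
have qD x y : q (x + y) = q x + q y.
  by have := sq.1 x y; have := sq.1 (- x) (- y); rewrite -opprD !qN; lra.
have qZ t x : q (t *: x) = t * q x.
  have [t0|t0|->] := ltgtP t 0; last by rewrite scale0r sublinear0// mul0r.
  - by rewrite -[t in LHS]opprK scaleNr qN sublinearZ ?oppr_gt0// mulNr opprK.
  - exact: sublinearZ.
exists q; split=> [t x y|x|]; first by rewrite qD qZ.
  exact: le_trans (qp0 x) (p0p x).
by have := p0N; have := qp0 (- x0); have := qp0 x0; have := p0p x0; rewrite qN; lra.
Qed.

End hahn_banach.

(** * The dual as a normed vector space, and separation of points from subspaces *)

Section dual_space.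
Context (R : realType) (V : normedModType R).
Implicit Types (f g h : dual V) (x y : V).

Lemma dual_ext f g : f =1 g -> f = g.
Proof.
case: f g => [[f [[af] [sf]]] cf] [[g [[ag] [sg]]] cg] /= fg.
have E : f = g by exact: funext.
subst g; rewrite (Prop_irrelevance ag af) (Prop_irrelevance sg sf) in cg *.
by congr Dual; exact: Prop_irrelevance.
Qed.

Lemma dualD f x y : f (x + y) = f x + f y.
Proof. exact: linearD. Qed.

Lemma dualZ f (a : R) x : f (a *: x) = a * f x.
Proof. exact: linearZ. Qed.

Lemma dual0 f : f 0 = 0.
Proof. exact: linear0. Qed.

Lemma dualB f x y : f (x - y) = f x - f y.
Proof. exact: linearB. Qed.

Lemma dual_sum f (I : Type) (r : seq I) (P : pred I) (F : I -> V) :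
  f (\sum_(i <- r | P i) F i) = \sum_(i <- r | P i) f (F i).
Proof. exact: linear_sum. Qed.

Definition bounded_by (M : R) (f : V -> R) := forall x, `|f x| <= M * `|x|.

Lemma dual_bounded_by f : exists2 M, 0 <= M & bounded_by M f.
Proof.
have /linear_bounded_continuous/linear_boundedP := @dual_continuous _ _ f.
by move=> /pinfty_ex_gt0[M M0 fM]; exists M => //; exact: ltW.
Qed.

Lemma dual_of (f : V -> R) (M : R) :
  linear f -> bounded_by M f -> {g : dual V | g =1 f}.
Proof.
move=> lf fM; pose F : {linear V -> R^o} :=
  HB.pack (f : V -> R^o) (GRing.isLinear.Build R V R^o *:%R f lf).
have cF : continuous F.
  apply/linear_bounded_continuous/linear_boundedP; near=> r => x.
  by apply: le_trans (fM x) _; rewrite ler_wpM2r//; near: r; apply: nbhs_pinfty_ge; rewrite num_real.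
by exists (Dual cF).
Unshelve. all: by end_near. Qed.

Let dzero : {g : dual V | g =1 fun=> 0}.
Proof.
apply: (@dual_of _ 0) => [a x y|x]; first by rewrite scaler0 addr0.
by rewrite normr0 mul0r.
Qed.

Let dadd f g : {h : dual V | h =1 fun x => f x + g x}.
Proof.
apply: cid; have [M M0 fM] := dual_bounded_by f; have [N N0 gN] := dual_bounded_by g.
have lin : linear (fun x => f x + g x).
  by move=> a x y; rewrite !dualD !dualZ [a *: _]mulrDr addrACA.
have bd : bounded_by (M + N) (fun x => f x + g x).
  by move=> x; rewrite (le_trans (ler_normD _ _))// mulrDl lerD.
by have [h hE] := dual_of lin bd; exists h.
Qed.

Let dscale (a : R) f : {h : dual V | h =1 fun x => a * f x}.
Proof.
apply: cid; have [M M0 fM] := dual_bounded_by f.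
have lin : linear (fun x => a * f x).
  by move=> b x y; rewrite !dualD !dualZ [b *: _]mulrCA -mulrDr.
have bd : bounded_by (`|a| * M) (fun x => a * f x).
  by move=> x; rewrite normrM -mulrA ler_wpM2l.
by have [h hE] := dual_of lin bd; exists h.
Qed.

HB.instance Definition _ := gen_eqMixin (dual V).
HB.instance Definition _ := gen_choiceMixin (dual V).

Let addE f g x : sval (dadd f g) x = f x + g x.
Proof. exact: (svalP (dadd f g)). Qed.

Let scaleE a f x : sval (dscale a f) x = a * f x.
Proof. exact: (svalP (dscale a f)). Qed.

Let zeroE x : sval dzero x = 0.
Proof. exact: (svalP dzero). Qed.

Let addA : associative (fun f g => sval (dadd f g)).
Proof. by move=> f g h; apply: dual_ext => x; rewrite !addE addrA. Qed.

Let addC : commutative (fun f g => sval (dadd f g)).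
Proof. by move=> f g; apply: dual_ext => x; rewrite !addE addrC. Qed.

Let add0 : left_id (sval dzero) (fun f g => sval (dadd f g)).
Proof. by move=> f; apply: dual_ext => x; rewrite !addE zeroE add0r. Qed.

Let addN : left_inverse (sval dzero) (fun f => sval (dscale (-1) f))
  (fun f g => sval (dadd f g)).
Proof.
by move=> f; apply: dual_ext => x; rewrite !addE scaleE zeroE mulN1r addNr.
Qed.

HB.instance Definition _ := GRing.isZmodule.Build (dual V) addA addC add0 addN.

Let scaleA (a b : R) f :
  sval (dscale a (sval (dscale b f))) = sval (dscale (a * b) f).
Proof. by apply: dual_ext => x; rewrite !scaleE mulrA. Qed.

Let scale1 : left_id 1 (fun a f => sval (dscale a f)).
Proof. by move=> f; apply: dual_ext => x; rewrite scaleE mul1r. Qed.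

Let scaleDr : right_distributive (fun a f => sval (dscale a f)) +%R.
Proof.
by move=> a f g; apply: dual_ext => x; rewrite !(scaleE, addE) mulrDr.
Qed.

Let scaleDl f : {morph (fun a => sval (dscale a f)) : a b / a + b}.
Proof.
by move=> a b; apply: dual_ext => x; rewrite !(scaleE, addE) mulrDl.
Qed.

HB.instance Definition _ := GRing.Zmodule_isLmodule.Build R (dual V)
  scaleA scale1 scaleDr scaleDl.

Lemma dual_addE f g x : (f + g) x = f x + g x.
Proof. exact: addE. Qed.

Lemma dual_scaleE (a : R) f x : (a *: f) x = a * f x.
Proof. exact: scaleE. Qed.

Lemma dual_zeroE x : (0 : dual V) x = 0.
Proof. exact: zeroE. Qed.

Lemma dual_oppE f x : (- f) x = - f x.
Proof. by rewrite -scaleN1r dual_scaleE mulN1r. Qed.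

Lemma dual_sumE (I : Type) (r : seq I) (P : pred I) (F : I -> dual V) x :
  (\sum_(i <- r | P i) F i) x = \sum_(i <- r | P i) F i x.
Proof.
elim/big_ind2: _ => [|f a g b <- <-|//]; first exact: dual_zeroE.
by rewrite dual_addE.
Qed.

Definition dualE := (dual_addE, dual_scaleE, dual_oppE, dual_zeroE, dual_sumE).

Let dual_norm_has_sup f : has_sup [set `|f x| | x in [set x : V | `|x| <= 1]].
Proof.
have [M M0 fM] := dual_bounded_by f; split.
  by exists `|f 0|, 0; rewrite //= normr0 ler01.
by exists M => _ [x x1 <-]; rewrite (le_trans (fM x))// ler_piMr.
Qed.

Lemma bounded_by_dual_norm f : bounded_by (dual_norm f) f.
Proof.
move=> x; have [->|x0] := eqVneq x 0; first by rewrite dual0 !normr0 mulr0.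
rewrite -ler_pdivrMr ?normr_gt0//; apply: ub_le_sup; first exact: (dual_norm_has_sup f).2.
exists (`|x|^-1 *: x) => /=.
  by rewrite normrZ normfV normr_id mulVf// normr_eq0.
by rewrite dualZ normrM normfV normr_id mulrC.
Qed.

Lemma dual_norm_le f (M : R) : 0 <= M -> bounded_by M f -> dual_norm f <= M.
Proof.
move=> M0 fM; apply: ge_sup; first exact: (dual_norm_has_sup f).1.
by move=> _ [x x1 <-]; rewrite (le_trans (fM x))// ler_piMr.
Qed.

Lemma dual_norm_ge0 f : 0 <= dual_norm f.
Proof.
apply: ub_le_sup; first exact: (dual_norm_has_sup f).2.
by exists 0; rewrite /= ?dual0 ?normr0.
Qed.

Lemma bounded_byD (M N : R) f g :
  bounded_by M f -> bounded_by N g -> bounded_by (M + N) (f + g).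
Proof.
move=> fM gN x; rewrite dual_addE mulrDl.
by rewrite (le_trans (ler_normD _ _))// lerD.
Qed.

Lemma bounded_byZ (M a : R) f : bounded_by M f -> bounded_by (`|a| * M) (a *: f).
Proof. by move=> fM x; rewrite dual_scaleE normrM -mulrA ler_wpM2l. Qed.

Lemma bounded_byN (M : R) f : bounded_by M f -> bounded_by M (- f).
Proof. by move=> fM x; rewrite dual_oppE normrN. Qed.

Lemma bounded_byS (M N : R) f : M <= N -> bounded_by M f -> bounded_by N f.
Proof. by move=> MN fM x; rewrite (le_trans (fM x))// ler_wpM2r. Qed.

Lemma dual_normD f g : dual_norm (f + g) <= dual_norm f + dual_norm g.
Proof.
apply: dual_norm_le; first by rewrite addr_ge0// dual_norm_ge0.
by apply: bounded_byD; exact: bounded_by_dual_norm.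
Qed.

Lemma dual_normZ (a : R) f : dual_norm (a *: f) = `|a| * dual_norm f.
Proof.
have le b g : dual_norm (b *: g) <= `|b| * dual_norm g.
  apply: dual_norm_le; first by rewrite mulr_ge0// dual_norm_ge0.
  exact/bounded_byZ/bounded_by_dual_norm.
apply/eqP; rewrite eq_le le/=; have [->|a0] := eqVneq a 0.
  by rewrite normr0 mul0r dual_norm_ge0.
have := le a^-1 (a *: f); rewrite scalerA mulVf// scale1r normfV.
by rewrite ler_pdivlMl ?normr_gt0.
Qed.

(** The distance to [L] is sublinear, vanishes on [L] and is at most the norm; a Hahn-Banach
    functional below it that touches it at [x] has all three properties. *)
Lemma dual_separation (L : set V) (d : R) x : L 0 ->
    (forall u v, L u -> L v -> L (u + v)) -> (forall (a : R) u, L u -> L (a *: u)) ->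
    (forall u, L u -> d <= `|x - u|) ->
  exists f : dual V, [/\ bounded_by 1 f, forall u, L u -> f u = 0 & d <= f x].
Proof.
move=> L0 LD LZ dL.
pose A := [set a : V -> R | exists2 u, L u & a = fun y => `|y - u|].
have lb y a : A a -> 0 <= a y by move=> [u _ ->].
have hlb y : has_lbound [set a y | a in A] by exists 0 => _ [a Aa <-]; exact: lb.
pose p y := inf [set a y | a in A].
have pL u y : L u -> p y <= `|y - u|.
  by move=> Lu; apply: ge_inf => //; exists (fun y => `|y - u|) => //; exists u.
have sp : sublinear p.
  apply: (sublinear_inf (m := fun=> 0)) => //.
  - by exists (fun y => `|y - 0|), 0.
  - by move=> a Aa y; exact: lb.
  - move=> _ _ y z [u Lu ->] [v Lv ->]; exists (fun y => `|y - (u + v)|).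
      by exists (u + v) => //; exact: LD.
    by rewrite opprD addrACA ler_normD.
  - move=> _ t y [u Lu ->] t0; exists (fun y => `|y - t *: u|).
      by exists (t *: u) => //; exact: LZ.
    by rewrite -scalerBr normrZ gtr0_norm.
have [f [lf fp fx]] := hahn_banach x sp.
have f1 y : f y <= `|y| by rewrite (le_trans (fp y))// (le_trans (pL 0 _ _))// subr0.
have fN y : f (- y) = - f y.
  have f0 : f 0 = 0 by have := lf 1 0 0; rewrite !scale1r addr0; lra.
  by have := lf (-1) y 0; rewrite f0 !addr0 !scaleN1r.
have bf : bounded_by 1 f.
  by move=> y; rewrite mul1r ler_norml f1 andbT lerNl -fN -normrN f1.
have [g gf] := dual_of lf bf; exists g; split.
- by move=> y; rewrite gf.
- move=> u Lu; rewrite gf; apply/eqP; rewrite eq_le.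
  have := le_trans (fp u) (pL _ _ Lu); rewrite subrr normr0 => ->.
  have Lu' : L (- u) by rewrite -scaleN1r; exact: LZ.
  by have := le_trans (fp (- u)) (pL _ _ Lu'); rewrite subrr normr0 fN oppr_le0.
- rewrite gf fx; apply: lb_le_inf.
    by exists `|x - 0|, (fun y => `|y - 0|) => //; exists 0.
  by move=> _ [_ [u Lu ->] <-]; exact: dL.
Qed.

Lemma norming_dual x : exists2 f : dual V, bounded_by 1 f & f x = `|x|.
Proof.
have [||||f [f1 _ fx]] := @dual_separation [set 0] `|x| x => //.
- by move=> _ _ -> ->; rewrite addr0.
- by move=> a _ ->; rewrite scaler0.
- by move=> _ ->; rewrite subr0.
exists f => //; apply/eqP; rewrite eq_le fx andbT.
by have := f1 x; rewrite mul1r; apply: le_trans; exact: ler_norm.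
Qed.

End dual_space.

(** * Weakly compact sets and their support functions *)

Section ultrafilter_limits.

Lemma fmap_ultra (S T : Type) (u : S -> T) (U : set_system S) :
  UltraFilter U -> UltraFilter (u @ U).
Proof.
move=> UU; split; first exact: fmap_proper_filter.
move=> G GG uUG; apply/seteqP; split=> [A GA|]; last exact: uUG.
have [//|UnA] := in_ultra_setVsetC (u @^-1` A) UU.
have : G (A `&` ~` A) by apply: filterI => //; exact: uUG.
by rewrite setICr => /filter_not_empty.
Qed.

(** Compactness of a segment. Limits along a fixed ultrafilter replace the extraction of
    subsequences throughout. *)
Lemma ultra_bounded_cvg (R : realType) (T : Type) (u : T -> R)
    (U : set_system T) (M : R) : UltraFilter U ->
  U [set t | `|u t| <= M] -> exists l : R, u @ U --> l.
Proof.
move=> UU uM; have uUU := fmap_ultra u UU.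
have uUM : (u @ U) `[- M, M]%classic.
  suff: U (u @^-1` `[- M, M]%classic) by [].
  by apply: filterS uM => t; rewrite /= in_itv/= -ler_norml.
have := @segment_compact R (- M) M; rewrite compact_ultra => /(_ _ uUU uUM).
by move=> [l [_ ul]]; exists l.
Qed.

Lemma ultra_nat : exists2 U : set_system nat, UltraFilter U & \oo `<=` U.
Proof. by have [U [? ?]] := @ultraFilterLemma nat \oo _; exists U. Qed.

End ultrafilter_limits.

Lemma initial_cvgP (S : choiceType) (T : topologicalType) (f : S -> T)
    (F : set_system S) (s : S) : Filter F ->
  F --> (s : initial_topology f) <-> f @ F --> f s.
Proof.
move=> FF; split=> [Fs A /initial_continuous fA|fFs A].
  exact: (Fs (f @^-1` A)).
move=> [B [[C oC CB] Bs BA]]; apply: (filterS BA); rewrite -CB.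
apply: fFs; apply: open_nbhs_nbhs; split => //.
by have : (f @^-1` C) s by rewrite CB.
Qed.

(** * Weak convergence and weak compactness in terms of functionals *)

Section weak_topology.
Context (R : realType) (V : normedModType R).
Implicit Types (f g : dual V) (x y : V) (A : set V).

Lemma weak_cvgP (F : set_system V) x : Filter F ->
  (F --> (x : weak V)) <-> forall f, f y @[y --> F] --> f x.
Proof.
move=> FF; pose phi (y : V) : {ptws dual V -> R^o} := fun f => f y.
rewrite (@initial_cvgP _ _ phi); split=> [phiF f|fF].
  have := @proj_continuous (dual V) (fun=> R^o) f (phi x).
  exact: (cvg_trans (cvg_app _ phiF)).
apply/cvg_sup => f.
exact: (@initial_cvgP {ptws dual V -> R^o} R^o (fun h => h f) (phi @ F)
  (phi x) (fmap_filter _ _)).2 (fF f).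
Qed.

Lemma weakly_compactP A : weakly_compact A <-> forall U : set_system V,
  UltraFilter U -> U A -> exists2 x, A x & forall f, f y @[y --> U] --> f x.
Proof.
rewrite /weakly_compact compact_ultra; split=> Ac U UU UA.
  by have [x [Ax /weak_cvgP Ux]] := Ac U UU UA; exists x.
by have [x Ax Ux] := Ac U UU UA; exists x; split => //; exact/weak_cvgP.
Qed.

Lemma weakly_compact_seq A (U : set_system nat) (u : nat -> V) :
    UltraFilter U -> weakly_compact A -> U [set n | A (u n)] ->
  exists2 x, A x & forall f, f (u n) @[n --> U] --> f x.
Proof.
by move=> UU /weakly_compactP Ac UA; exact: (Ac (u @ U) (fmap_ultra u UU) UA).
Qed.

Lemma weak_eqP x y : (forall f, f x = f y) -> x = y.
Proof.
move=> fxy; apply/eqP; rewrite -subr_eq0 -normr_eq0.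
have [f _ <-] := norming_dual (x - y). by rewrite dualB fxy subrr.
Qed.

Lemma convex_setE A : convex_set (A : set (convex_lmodType V)) <->
  forall x y (t : R), A x -> A y -> 0 <= t <= 1 -> A (t *: x + (1 - t) *: y).
Proof.
split=> cA x y t.
  move=> Ax Ay /andP[t0 t1].
  have := cA x y (Itv01 t0 t1); rewrite !inE => /(_ Ax Ay).
  exact.
rewrite !inE => Ax Ay; apply: (cA x y t%:num Ax Ay).
by rewrite ge0/= le1.
Qed.

End weak_topology.

(** * Support functions, faces and decreasing intersections *)

Section support_functions.
Context (R : realType) (X : completeNormedModType R).
Implicit Types (f g : dual X) (x y : X) (A B : set X).

Lemma supp_attained f A : cwk A ->
  exists2 x, A x & f x = supp f A /\ forall y, A y -> f y <= f x.
Proof.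
move=> [A0 _ wA].
have cf : continuous (f : weak X -> R^o).
  by move=> x; have /weak_cvgP := @cvg_id _ (nbhs (x : weak X)); exact.
have [x xA fx] := @compact_EVT_max (weak X) R f A A0 wA (continuous_subspaceT cf).
rewrite inE in xA; exists x => //; split=> [|y Ay]; last by apply: fx; rewrite inE.
apply/eqP; rewrite eq_le; apply/andP; split.
  apply: ub_le_sup; last by exists x.
  by exists (f x) => _ [y Ay <-]; apply: fx; rewrite inE.
apply: ge_sup; first by exists (f x), x.
by move=> _ [y Ay <-]; apply: fx; rewrite inE.
Qed.

Lemma le_supp f A x : cwk A -> A x -> f x <= supp f A.
Proof. by move=> cA Ax; have [y _ [<- fy]] := supp_attained f cA; exact: fy. Qed.

Lemma supp_le f A c : cwk A -> (forall x, A x -> f x <= c) -> supp f A <= c.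
Proof. by move=> cA Ac; have [y Ay [<- fy]] := supp_attained f cA; exact: Ac. Qed.

Lemma supp_sub f A B : cwk A -> cwk B -> A `<=` B -> supp f A <= supp f B.
Proof. by move=> cA cB AB; apply: supp_le => // x /AB; exact: le_supp. Qed.

Lemma suppN_le f A x : cwk A -> A x -> - supp (- f) A <= f x.
Proof. by move=> cA Ax; rewrite lerNl -dual_oppE le_supp. Qed.

Lemma norm_dual_le_supp f A x : cwk A -> A x ->
  `|f x| <= `|supp f A| + `|supp (- f) A|.
Proof.
move=> cA Ax; have := le_supp f cA Ax; have := suppN_le f cA Ax.
have := ler_norm (supp f A); have := ler_norm (supp (- f) A).
have := normr_ge0 (supp f A); have := normr_ge0 (supp (- f) A).
by rewrite ler_norml => *; apply/andP; split; lra.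
Qed.

(** This is the oscillation of [f] on [A], as [- supp (- f) A] is the minimum of [f]. *)
Definition width f A := supp f A + supp (- f) A.

Lemma le_width f A x y : cwk A -> A x -> A y -> f x - f y <= width f A.
Proof.
move=> cA Ax Ay; apply: lerD; first exact: le_supp.
by rewrite lerNl; exact: suppN_le.
Qed.

Lemma width_ge0 f A : cwk A -> 0 <= width f A.
Proof.
by move=> cA; have [[x Ax] _ _] := cA; have := le_width f cA Ax Ax; rewrite subrr.
Qed.

Lemma width_sub f A B : cwk A -> cwk B -> A `<=` B -> width f A <= width f B.
Proof. by move=> cA cB AB; apply: lerD; exact: supp_sub. Qed.

Definition face f A := [set x | A x /\ f x = supp f A].

Lemma face_sub f A : face f A `<=` A.
Proof. by move=> x []. Qed.

Lemma face_cwk f A : cwk A -> cwk (face f A).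
Proof.
move=> cA; have [A0 cvA wA] := cA; split.
- by have [x Ax [fx _]] := supp_attained f cA; exists x.
- apply/convex_setE => x y t [Ax fx] [Ay fy] t01.
  split; first by move/convex_setE: cvA; exact.
  by rewrite dualD !dualZ fx fy; lra.
- apply/weakly_compactP => U UU Uf.
  have [x Ax Ux] := (weakly_compactP A).1 wA U UU (filterS (@face_sub f A) Uf).
  exists x => //; split => //.
  apply: (cvg_unique (F := f y @[y --> U]) (@Rhausdorff R) (Ux f)).
  apply: cvg_near_cst; apply: (filterS _ Uf) => y [_ ->] //.
Qed.

(* Directional differentiability of the support function: the support function
   of the face exposed by [f] is the derivative of [supp ^~ A] at [f]. *)
Lemma supp_face f g A : cwk A ->
  (fun n => supp (n%:R *: f + g) A - n%:R * supp f A) @ \oo --> supp g (face f A).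
Proof.
move=> cA; set u := fun n => _.
have cF := face_cwk f cA.
have uF n : supp g (face f A) <= u n.
  apply: supp_le => // x [Ax fx]; rewrite lerBrDr addrC -fx.
  by apply: le_trans (le_supp _ cA Ax); rewrite dual_addE dual_scaleE.
have nu : nonincreasing_seq u.
  apply/nonincreasing_seqP => n; rewrite /u lerBlDr.
  apply: supp_le => // x Ax; have := le_supp (n%:R *: f + g) cA Ax.
  have := le_supp f cA Ax; rewrite !dual_addE !dual_scaleE -natr1 !mulrDl !mul1r.
  by move=> ? ?; lra.
have lu : has_lbound (range u).
  by exists (supp g (face f A)) => _ [n _ <-]; exact: uF.
have := nonincreasing_cvgn nu lu; set c := inf _ => uc.
suff -> : supp g (face f A) = c by [].
apply/eqP; rewrite eq_le; apply/andP; split.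
  by apply: lb_le_inf; [exists (u 0%N), 0%N | move=> _ [n _ <-]; exact: uF].
have cu n : c <= u n by apply: ge_inf => //; exists n.
have /choice[x xP] : forall n, exists x, A x /\ n%:R * f x + g x = supp (n%:R *: f + g) A.
  move=> n; have [x Ax [xE _]] := supp_attained (n%:R *: f + g) cA.
  by exists x; rewrite -xE dual_addE dual_scaleE.
(* A weak limit [z] of maximisers of [n f + g] is shown to lie on the face and to satisfy
   [c <= g z]. *)
have [U UU ooU] := ultra_nat.
have [_ _ wA] := cA.
have [z Az zP] := weakly_compact_seq (u := x) UU wA (filterS (fun n _ => (xP n).1) filterT).
have gz : c <= g z.
  apply: (cvgr_to_ge (zP g)); apply: ooU; exists 0%N => // n _ /=.
  have := cu n; rewrite /u -(xP n).2.
  by have := ler_wpM2l (ler0n R n) (le_supp f cA (xP n).1); lra.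
(* From [c <= u n] the gap [supp f A - f (x n)] is at most [(supp g A - c) / n], so it vanishes in
   the limit. *)
have fz : f z = supp f A.
  apply/eqP; rewrite eq_le le_supp//=; apply/ler_addgt0Pr => e e0.
  rewrite -lerBlDr; apply: (cvgr_to_ge (zP f)); apply: ooU.
  exists (Num.trunc (`|supp g A - c| / e)).+1 => // n /= nN.
  have ne : supp g A - c <= n%:R * e.
    apply: le_trans (ler_norm _) _; rewrite -ler_pdivrMr//.
    apply: le_trans (ltW (truncnS_gt _)) _; by rewrite ler_nat.
  have n0 : 0 < n%:R :> R by rewrite ltr0n; exact: leq_trans nN.
  rewrite -(ler_pM2l n0); have := cu n; rewrite /u -(xP n).2.
  by have := le_supp g cA (xP n).1; rewrite mulrBr; lra.
by apply: le_trans gz _; apply: le_supp.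
Qed.

(** Points [x n] of [F n] have a weak ultrafilter limit, which lies in every [F m] by uniqueness of
    weak limits. For maximisers of [g] this limit attains the limit of the support functions. *)
Lemma cwk_bigcap (F : nat -> set X) : (forall n, cwk (F n)) ->
    (forall n, F n.+1 `<=` F n) ->
  cwk (\bigcap_n F n) /\ forall g, supp g (F n) @[n --> \oo] --> supp g (\bigcap_n F n).
Proof.
move=> cF dF.
have monF m n : (m <= n)%N -> F n `<=` F m.
  move=> /subnK <-; elim: (n - m)%N => // k IH x; rewrite addSn => /dF; exact: IH.
have [U UU ooU] := ultra_nat.
have key (x : nat -> X) : (forall n, F n (x n)) ->
    exists2 z, (\bigcap_n F n) z & forall f, f (x n) @[n --> U] --> f z.
  move=> Fx; have FU m : U [set n | F m (x n)].
    by apply: ooU; exists m => // n /= mn; apply: monF (Fx n).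
  have [_ _ w0] := cF 0%N.
  have [z _ zP] := weakly_compact_seq UU w0 (FU 0%N).
  exists z => // m _; have [_ _ wm] := cF m.
  have [y Fy yP] := weakly_compact_seq UU wm (FU m).
  suff -> : z = y by [].
  by apply: weak_eqP => f; apply: (cvg_unique _ (zP f) (yP f)).
have cI : cwk (\bigcap_n F n).
  split.
  - have /choice[x Fx] : forall n, exists x, F n x by move=> n; case: (cF n).
    by have [z Fz _] := key x Fx; exists z.
  - apply/convex_setE => x y t Fx Fy t01 n _; have [_ /convex_setE cvF _] := cF n.
    by apply: cvF => //; [exact: Fx|exact: Fy].
  - apply/weakly_compactP => V VV VF.
    have Vn n : V (F n) by apply: (filterS _ VF) => x; exact.
    have [_ _ /weakly_compactP w0] := cF 0%N; have [z F0z zP] := w0 V VV (Vn 0%N).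
    exists z => // n _; have [_ _ /weakly_compactP wn] := cF n.
    have [y Fy yP] := wn V VV (Vn n).
    suff -> : z = y by [].
    by apply: weak_eqP => f; apply: (cvg_unique _ (zP f) (yP f)).
split=> // g; set u := fun n => _.
have Iu n : supp g (\bigcap_n F n) <= u n.
  by apply: supp_sub => // x; exact.
have nu : nonincreasing_seq u.
  by apply/nonincreasing_seqP => n; exact: supp_sub.
have lu : has_lbound (range u).
  by exists (supp g (\bigcap_n F n)) => _ [n _ <-]; exact: Iu.
have := nonincreasing_cvgn nu lu; set c := inf _ => uc.
suff -> : supp g (\bigcap_n F n) = c by [].
apply/eqP; rewrite eq_le; apply/andP; split.
  by apply: lb_le_inf; [exists (u 0%N), 0%N | move=> _ [n _ <-]; exact: Iu].
have /choice[x xP] : forall n, exists x, F n x /\ g x = u n.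
  by move=> n; have [x Fx [xE _]] := supp_attained g (cF n); exists x.
have [z Fz zP] := key x (fun n => (xP n).1).
apply: le_trans (le_supp g cI Fz); apply: (cvgr_to_ge (zP g)).
apply: ooU; exists 0%N => // n _ /=; rewrite (xP n).2.
by apply: ge_inf => //; exists n.
Qed.

End support_functions.

(** * Trees in weakly compact sets *)

Section dyadic_trees.

(** Diagonal argument: [g] recovers a sequence from the code of its image, and [t] differs from
    [g n] at place [n]. *)
Lemma cantor_no_injection (I : countType) (i : (nat -> bool) -> I) : ~ injective i.
Proof.
move=> i_inj; pose g n := xget (fun=> true) [set t | pickle (i t) = n].
pose t n := ~~ g n n.
have gt : g (pickle (i t)) = t.
  apply: i_inj; apply: (pcan_inj (@pickleK I)).
  by apply: (@xgetPex _ _ [set u | pickle (i u) = pickle (i t)]); exists t.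
have tE n : t n = ~~ g n n by [].
by have := tE (pickle (i t)); rewrite gt; case: (t _).
Qed.

Context (R : realType) (V : normedModType R).

(** Rational coefficients make the index [l] range over a countable type. *)
Definition rat_comb (I : countType) (x : I -> V) (l : seq (rat * I)) : V :=
  \sum_(p <- l) ratr p.1 *: x p.2.

Definition closed_span (I : countType) (x : I -> V) :=
  [set v | forall e : R, 0 < e -> exists l, `|v - rat_comb x l| < e].

(** Limits of rational combinations form a real subspace; were [v] at positive distance from it, a
    functional would vanish on all [x i] but not at [v]. *)
Lemma closed_spanP (I : countType) (x : I -> V) v :
  (forall f : dual V, (forall i, f (x i) = 0) -> f v = 0) -> closed_span x v.
Proof.
move=> xv; apply: contrapT => /existsNP[e /not_implyP[e0 /forallNP le]].
have L0 : closed_span x 0.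
  by move=> a a0; exists [::]; rewrite /rat_comb big_nil subrr normr0.
have Lx i : closed_span x (x i).
  by move=> a a0; exists [:: (1, i)]; rewrite /rat_comb big_seq1 rmorph1 scale1r subrr normr0.
have LD u w : closed_span x u -> closed_span x w -> closed_span x (u + w).
  move=> Lu Lw a a0; have [l1 ul] := Lu _ (divr_gt0 a0 (ltr0n R 2)).
  have [l2 wl] := Lw _ (divr_gt0 a0 (ltr0n R 2)); exists (l1 ++ l2).
  rewrite /rat_comb big_cat/= opprD addrACA (le_lt_trans (ler_normD _ _))//.
  by rewrite [ltRHS]splitr ltrD.
have LZ (t : R) u : closed_span x u -> closed_span x (t *: u).
  move=> Lu a a0; have a2 : 0 < a / 2 by rewrite divr_gt0.
  (* Half of the error goes to the approximation of [u], half to replacing [t] by a rational [q]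
     slightly below it; the summands [1] avoid division by zero. *)
  have [|l ul] := Lu (a / 2 / (1 + `|t|)); first by rewrite divr_gt0// ltr_pwDl.
  have c0 : 0 < a / 2 / (1 + `|rat_comb x l|) by rewrite divr_gt0// ltr_pwDl.
  have [|q] := @rat_in_itvoo R (t - a / 2 / (1 + `|rat_comb x l|)) t.
    by rewrite ltrBlDr ltrDl.
  rewrite in_itv/= => /andP[q1 q2].
  exists [seq (q * p.1, p.2) | p <- l].
  have -> : rat_comb x [seq (q * p.1, p.2) | p <- l] = ratr q *: rat_comb x l.
    rewrite /rat_comb big_map scaler_sumr; apply: eq_bigr => p _ /=.
    by rewrite rmorphM scalerA.
  have -> : t *: u - ratr q *: rat_comb x l =
      t *: (u - rat_comb x l) + (t - ratr q) *: rat_comb x l.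
    by rewrite scalerBr scalerBl addrA subrK.
  rewrite (le_lt_trans (ler_normD _ _))// [ltRHS]splitr; apply: ltr_leD.
    rewrite normrZ (@le_lt_trans _ _ ((1 + `|t|) * `|u - rat_comb x l|))//.
      by rewrite ler_wpM2r// lerDr.
    by rewrite -ltr_pdivlMl ?ltr_pwDl// mulrC.
  rewrite normrZ (@le_trans _ _ (`|t - ratr q| * (1 + `|rat_comb x l|)))//.
    by rewrite ler_wpM2l// lerDr.
  rewrite -ler_pdivlMr ?ltr_pwDl// ger0_norm; last by rewrite subr_ge0 ltW.
  by move: q1; lra.
have dL u : closed_span x u -> e <= `|v - u|.
  move=> Lu; apply/ler_addgt0Pr => a a0; have [l ul] := Lu _ a0.
  have /negP := le l; rewrite -leNgt => /le_trans; apply.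
  have -> : v - rat_comb x l = (v - u) + (u - rat_comb x l) by rewrite addrA subrK.
  by rewrite (le_trans (ler_normD _ _))// lerD2l ltW.
have [f [_ fL fv]] := dual_separation L0 LD LZ dL.
by move: fv; rewrite xv => [|i]; [rewrite leNgt e0 | rewrite fL].
Qed.

(* The branches of the tree give uncountably many [d]-separated points in the
   norm-closed span of countably many points. *)
Lemma no_separated_tree (K : seq bool -> set V) (d : R) : 0 < d ->
    weakly_compact (K [::]) -> (forall s, K s !=set0) ->
    (forall b s, K (b :: s) `<=` K s) ->
    (forall s, exists z : dual V, exists2 c : R, bounded_by 1 z &
      (forall x, K (true :: s) x -> c + d <= z x) /\
      (forall x, K (false :: s) x -> z x <= c)) ->
  False.
Proof.
move=> d0 wK /choice[x Kx] nest sep.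
(* [p t n] is the node at depth [n] on the branch [t], with the latest choice at the head as in
   [b :: s]. *)
pose p (t : nat -> bool) := fix p n := if n is m.+1 then t m :: p m else [::].
have pK t m n : (m <= n)%N -> K (p t n) `<=` K (p t m).
  by move=> /subnK <-; elim: (n - m)%N => // k IH y; rewrite addSn /= => /nest; exact: IH.
have [U UU ooU] := ultra_nat.
have /choice[y yP] : forall t, exists y, forall f : dual V, f (x (p t n)) @[n --> U] --> f y.
  move=> t; have [|y _ yP] := @weakly_compact_seq _ _ _ U (fun n => x (p t n)) UU wK.
    by apply: (filterS _ filterT) => n _; apply: (pK t 0%N n) (Kx _).
  by exists y.
(* A functional killing all nodes kills the branch limit [y t], so [y t] lies in their closed span.
   The code of a [d / 2]-approximation then determines the branch, once distinct branches are
   [d]-separated. *)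
have /choice[i iP] : forall t, exists l, `|y t - rat_comb x l| < d / 2.
  move=> t; apply: closed_spanP; last exact: divr_gt0.
  move=> f fx; apply: (cvg_unique _ (yP t f)) => //.
  by apply: cvg_near_cst; apply: (filterS _ filterT) => n _; rewrite fx.
apply: (@cantor_no_injection _ i) => t u itu; apply: contrapT => tu.
(* The first place where the branches part: up to there they pass through the same node, whose
   functional separates them. *)
have [n [ntu ptu]] : exists n, t n <> u n /\ p t n = p u n.
  have /existsNP[n /eqP ntu] : ~ forall n, t n = u n by move=> /funext.
  have ex : exists n, t n != u n by exists n.
  exists (ex_minn ex); case: ex_minnP => m /eqP tum minm; split => //.
  have : forall k, (k <= m)%N -> p t k = p u k.
    elim=> // k IH km /=; rewrite IH 1?ltnW//; congr (_ :: _).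
    by apply/eqP; apply: contraLR km => /minm; rewrite -leqNgt.
  exact.
have cls t' u' : t' n = true -> u' n = false -> p t' n = p u' n -> d <= `|y t' - y u'|.
  move=> tn un ptu'; have [z [c z1 [cz1 cz2]]] := sep (p t' n).
  have zt : c + d <= z (y t').
    apply: (cvgr_to_ge (yP t' z)); apply: ooU; exists n.+1 => // k /= nk.
    by apply: cz1; have := pK t' _ _ nk _ (Kx _); rewrite /= tn.
  have zu : z (y u') <= c.
    apply: (cvgr_to_le (yP u' z)); apply: ooU; exists n.+1 => // k /= nk.
    by apply: cz2; have := pK u' _ _ nk _ (Kx _); rewrite /= un ptu'.
  have := z1 (y t' - y u'); rewrite mul1r dualB; apply: le_trans.
  by apply: le_trans (ler_norm _); lra.
have : `|y t - y u| < d.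
  have -> : y t - y u = (y t - rat_comb x (i t)) - (y u - rat_comb x (i u)).
    by rewrite itu opprB addrA subrK.
  by rewrite (le_lt_trans (ler_normB _ _))// [ltRHS]splitr ltrD.
rewrite ltNge => /negP; apply.
case tn: (t n) ntu; case un: (u n) => // _; first exact: cls.
by rewrite distrC; exact: cls.
Qed.

End dyadic_trees.

(** * Integration of real-valued functions *)

Section real_integrals.
Context d (T : measurableType d) (R : realType) (mu : {measure set T -> \bar R}).
Implicit Types (f g h : T -> R) (A B : set T).

Local Notation intg f := (mu.-integrable [set: T] (EFin \o f)).

Lemma intg_measurable f : intg f -> measurable_fun [set: T] f.
Proof. by move=> /integrableP[/measurable_EFinP]. Qed.

Lemma intgS A f : measurable A -> intg f -> mu.-integrable A (EFin \o f).
Proof. by move=> mA; apply: integrableS. Qed.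

Lemma intg_le f g : measurable_fun [set: T] f -> (forall x, `|f x| <= `|g x|) ->
  intg g -> intg f.
Proof.
move=> mf fg; apply: le_integrable => //; first exact/measurable_EFinP.
by move=> x _; rewrite lee_fin.
Qed.

Lemma intgD f g : intg f -> intg g -> intg (fun x => f x + g x).
Proof. by move=> If Ig; have := integrableD measurableT If Ig; exact. Qed.

Lemma intgZ (r : R) f : intg f -> intg (fun x => r * f x).
Proof. by move=> If; have := integrableZl measurableT r If; exact. Qed.

Lemma intgN f : intg f -> intg (fun x => - f x).
Proof. by move=> If; have := integrableN If; exact. Qed.

Lemma intgB f g : intg f -> intg g -> intg (fun x => f x - g x).
Proof. by move=> If Ig; apply: intgD => //; exact: intgN. Qed.

Lemma intg_norm f : intg f -> intg (fun x => `|f x|).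
Proof. exact: integrable_norm. Qed.

Lemma intg_sum (I : Type) (s : seq I) (F : I -> T -> R) :
  (forall i, intg (F i)) -> intg (fun x => \sum_(i <- s) F i x).
Proof.
move=> IF; elim: s => [|i s IH].
  under eq_fun do rewrite /comp big_nil; exact: integrable0.
by under eq_fun do rewrite /comp big_cons; exact: intgD.
Qed.

Lemma Rint_le A f g : measurable A -> intg f -> intg g ->
  (forall x, A x -> f x <= g x) ->
  \int[mu]_(x in A) f x <= \int[mu]_(x in A) g x.
Proof.
move=> mA If Ig fg; have IfA := intgS mA If; have IgA := intgS mA Ig.
apply: fine_le; [exact: integrable_fin_num|exact: integrable_fin_num|].
by apply: le_integral => // x; rewrite inE lee_fin => /fg.
Qed.

Lemma Rint_norm_le A f g : measurable A -> intg f -> intg g ->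
  (forall x, A x -> `|f x| <= g x) ->
  `|\int[mu]_(x in A) f x| <= \int[mu]_(x in A) g x.
Proof.
move=> mA If Ig fg; apply: le_trans (le_normr_Rintegral mA (intgS mA If)) _.
by apply: Rint_le => //; exact: intg_norm.
Qed.

Lemma Rint_EFin A f : measurable A -> intg f ->
  (\int[mu]_(x in A) (f x)%:E)%E = (\int[mu]_(x in A) f x)%:E.
Proof.
by move=> mA If; rewrite fineK//; apply: integrable_fin_num => //; exact: intgS.
Qed.

Lemma RintD A f g : measurable A -> intg f -> intg g ->
  \int[mu]_(x in A) (f x + g x) = \int[mu]_(x in A) f x + \int[mu]_(x in A) g x.
Proof. by move=> mA If Ig; apply: RintegralD => //; exact: intgS. Qed.

Lemma RintZ A r f : measurable A -> intg f ->
  \int[mu]_(x in A) (r * f x) = r * \int[mu]_(x in A) f x.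
Proof. by move=> mA If; apply: RintegralZl => //; exact: intgS. Qed.

Lemma Rint0 A : \int[mu]_(x in A) (0 : R) = 0.
Proof. by rewrite /Rintegral integral0. Qed.

Lemma Rint_sum A (I : Type) (s : seq I) (F : I -> T -> R) : measurable A ->
  (forall i, intg (F i)) ->
  \int[mu]_(x in A) (\sum_(i <- s) F i x) = \sum_(i <- s) \int[mu]_(x in A) F i x.
Proof.
move=> mA IF; elim: s => [|i s IH].
  by rewrite big_nil; under eq_Rintegral do rewrite big_nil; exact: Rint0.
rewrite big_cons -IH -RintD//; last exact: intg_sum.
by apply: eq_Rintegral => x _; rewrite big_cons.
Qed.

Lemma Rint_setD A B f : measurable A -> measurable B -> B `<=` A -> intg f ->
  \int[mu]_(x in A) f x = \int[mu]_(x in B) f x + \int[mu]_(x in A `\` B) f x.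
Proof.
move=> mA mB BA If; rewrite -{1}(setDUK BA) Rintegral_setU//.
- exact: measurableD.
- by apply: intgS => //; apply: measurableU => //; exact: measurableD.
- by apply/disj_setPS => x [? []].
Qed.

Lemma Rint_subset A B f : measurable A -> measurable B -> A `<=` B -> intg f ->
  (forall x, 0 <= f x) -> \int[mu]_(x in A) f x <= \int[mu]_(x in B) f x.
Proof.
move=> mA mB AB If f0; rewrite (Rint_setD mB mA AB If) lerDl.
exact: Rintegral_ge0.
Qed.

Lemma Rint_ae_eq A f g : measurable A -> intg f -> intg g ->
  {ae mu, forall x, A x -> f x = g x} ->
  \int[mu]_(x in A) f x = \int[mu]_(x in A) g x.
Proof.
move=> mA If Ig fg; congr fine; apply: ae_eq_integral => //.
- exact: measurable_int (intgS mA If).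
- exact: measurable_int (intgS mA Ig).
- by apply: filterS fg => x fg Ax; rewrite /= fg.
Qed.

Lemma Rint_eq0_ae A f : measurable A -> intg f -> (forall x, 0 <= f x) ->
  \int[mu]_(x in A) f x = 0 -> {ae mu, forall x, A x -> f x = 0}.
Proof.
move=> mA If f0 I0; have mf := measurable_int _ (intgS mA If).
have : (\int[mu]_(x in A) `|(EFin \o f) x| = 0)%E.
  rewrite -[RHS](congr1 EFin I0) -Rint_EFin//; apply: eq_integral => x _ /=.
  by rewrite ger0_norm.
by move=> /(ae_eq_integral_abs mu mA mf); apply: filterS => x fx /fx [].
Qed.

Lemma Rint_dominated A (F : nat -> T -> R) f g : measurable A ->
    (forall n, intg (F n)) -> measurable_fun [set: T] f -> intg g ->
    (forall n x, A x -> `|F n x| <= g x) ->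
    {ae mu, forall x, A x -> F n x @[n --> \oo] --> f x} ->
  \int[mu]_(x in A) F n x @[n --> \oo] --> \int[mu]_(x in A) f x.
Proof.
move=> mA IF mf Ig Fg Ff.
have [|||||If _ cF] := @dominated_convergence _ T R mu A mA (fun n x => (F n x)%:E)
  (EFin \o f) (EFin \o g).
- by move=> n; exact: measurable_int (intgS mA (IF n)).
- by apply/measurable_EFinP; exact: measurable_funTS.
- by apply: filterS Ff => x Fx Ax; apply: cvg_EFin => //; [exact: nearW|exact: Fx].
- exact: intgS.
- by apply: aeW => x n Ax; rewrite lee_fin Fg.
have : fine (\int[mu]_(x in A) (F n x)%:E) @[n --> \oo] --> \int[mu]_(x in A) f x.
  apply: fine_cvg; rewrite fineK//.
  by apply: integrable_fin_num.
exact.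
Qed.

(** Dominated convergence for [f] cut off to [E n], which is eventually zero at almost every
    point. *)
Lemma Rint_decreasing (E : nat -> set T) f : (forall n, measurable (E n)) -> intg f ->
    {ae mu, forall x, \forall n \near \oo, ~ E n x} ->
  \int[mu]_(x in E n) f x @[n --> \oo] --> 0.
Proof.
move=> mE If E0.
have -> : (fun n => \int[mu]_(x in E n) f x) =
    (fun n => \int[mu]_(x in setT) (f \_ (E n)) x).
  by apply: funext => n; rewrite Rintegral_mkcond.
rewrite -[X in _ --> X](Rint0 setT).
have rE n x : `|(f \_ (E n)) x| <= `|f x|.
  by rewrite patchE; case: ifP => // _; rewrite normr0.
have mF n : measurable_fun [set: T] (f \_ (E n)).
  by apply/(measurable_restrictT _ _).1 => //; apply: measurable_funTS; exact: intg_measurable.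
apply: (Rint_dominated (g := fun x => `|f x|)) => //.
- by move=> n; apply: (intg_le _ _ If) => //.
- exact: intg_norm.
- apply: filterS E0 => x Ex _; apply: cvg_near_cst; apply: filterS Ex => n nE.
  by rewrite patchE memNset.
Qed.

Lemma intg_mul (th g : T -> R) : measurable_fun [set: T] th ->
  (forall x, `|th x| <= 1) -> intg g -> intg (fun x => th x * g x).
Proof.
move=> mth th1 Ig; apply: intg_le (Ig).
  by apply: measurable_funM => //; exact: intg_measurable.
by move=> x; rewrite normrM ler_piMl.
Qed.

Lemma Rint_mul_le A (th g : T -> R) : measurable A -> measurable_fun [set: T] th ->
  (forall x, `|th x| <= \1_A x) -> intg g ->
  `|\int[mu]_x (th x * g x)| <= \int[mu]_(x in A) `|g x|.
Proof.
move=> mA mth thA Ig.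
have th1 x : `|th x| <= 1 by rewrite (le_trans (thA x))// indicE; case: (_ \in _).
have th0 x : ~ A x -> th x = 0.
  by move=> Ax; apply/eqP; rewrite -normr_le0 (le_trans (thA x))// indicE memNset.
have -> : \int[mu]_x (th x * g x) = \int[mu]_(x in A) (th x * g x).
  rewrite [RHS]Rintegral_mkcond; apply: eq_Rintegral => x _.
  rewrite patchE; case: ifPn => // /negP Ax.
  by rewrite th0 ?mul0r// => /mem_set.
apply: Rint_norm_le => //; [exact: intg_mul|exact: intg_norm|].
by move=> x _; rewrite normrM ler_piMl.
Qed.

(** Otherwise [f] would vanish almost everywhere on [A]. This turns statements that hold almost
    everywhere into one concrete point. *)
Lemma ae_nonempty A (P : T -> Prop) f : measurable A -> intg f -> (forall x, 0 <= f x) ->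
    0 < \int[mu]_(x in A) f x -> {ae mu, forall x, P x} ->
  exists x, [/\ A x, 0 < f x & P x].
Proof.
move=> mA If f0 If0 aeP; apply: contrapT => noP.
have : \int[mu]_(x in A) f x = \int[mu]_(x in A) 0.
  apply: Rint_ae_eq => //; first exact: integrable0.
  apply: filterS aeP => x Px Ax; apply/eqP; rewrite eq_le f0 andbT leNgt.
  by apply/negP => fx; apply: noP; exists x.
by rewrite Rint0 => I0; rewrite I0 ltxx in If0.
Qed.

End real_integrals.

(** * Scalarly measurable selections *)

Section exhaustion.
Context d (T : measurableType d) (R : realType).

(* Greedy choice: each piece is at least half as large as possible. *)
Lemma exhaustion (N : set T -> R) (P : set T -> Prop) (E : set T) :
    (forall A, measurable A -> 0 <= N A) ->
    (forall A B, measurable A -> measurable B -> B `<=` A ->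
       N A = N B + N (A `\` B)) ->
    measurable E ->
    (forall A, measurable A -> A `<=` E -> 0 < N A -> exists B,
       [/\ measurable B, B `<=` A, P B & 0 < N B]) ->
  exists idx : T -> nat, [/\ forall i, measurable [set x | idx x = i],
    forall i, (0 < i)%N -> P [set x | idx x = i] \/ [set x | idx x = i] = set0 &
    N (E `&` [set x | idx x = 0%N]) = 0].
Proof.
move=> N0 ND mE EP.
have Nle A B : measurable A -> measurable B -> B `<=` A -> N B <= N A.
  by move=> mA mB BA; rewrite (ND A B)// lerDl N0//; exact: measurableD.
have Nset0 : N set0 = 0.
  have := ND set0 set0 measurable0 measurable0 (@subset_refl _ _).
  by rewrite setD0 => h; lra.
(* The hypotheses on [A] are put inside [Q] so that the choice function is defined on all sets. *)
pose Q A B := measurable A -> A `<=` E -> [/\ measurable B, B `<=` A,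
  P B \/ B = set0 & forall C, measurable C -> C `<=` A -> P C -> N C <= 2 * N B].
have /choice[nx nxP] : forall A, exists B, Q A B.
  move=> A; have [mA|nmA] := pselect (measurable A); last by exists set0.
  have [AE|nAE] := pselect (A `<=` E); last by exists set0.
  pose S := [set N C | C in [set C | [/\ measurable C, C `<=` A & P C]]].
  have [S1|] := pselect (exists2 s, S s & 0 < s); last first.
    move=> S0; exists set0; split => //; first by right.
    move=> C mC CA PC; rewrite Nset0 mulr0 leNgt; apply/negP => NC.
    by apply: S0; exists (N C) => //; exists C.
  have hS : has_sup S.
    split; first by case: S1 => s ? _; exists s.
    by exists (N A) => _ [C [mC CA _] <-]; exact: Nle.
  have supS0 : 0 < sup S.
    by case: S1 => s Ss s0; apply: lt_le_trans s0 _; apply: ub_le_sup => //; exact: hS.2.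
  have [_ [B [mB BA PB] <-] supB] := sup_adherent (divr_gt0 supS0 (ltr0n R 2)) hS.
  exists B; split => //; first by left.
  move=> C mC CA PC; have : N C <= sup S by apply: ub_le_sup; [exact: hS.2|exists C].
  by move: supB; lra.
pose A := fix A n := if n is m.+1 then A m `\` nx (A m) else E.
have AP n : measurable (A n) /\ A n `<=` E.
  elim: n => [|n [mA AE]] /=; first by split.
  have [mB BA _ _] := nxP (A n) mA AE.
  by split; [exact: measurableD|move=> x [/AE]].
have BP n : [/\ measurable (nx (A n)), nx (A n) `<=` A n,
    P (nx (A n)) \/ nx (A n) = set0 &
    forall C, measurable C -> C `<=` A n -> P C -> N C <= 2 * N (nx (A n))].
  by apply: nxP; case: (AP n).
have Adec m n : (m <= n)%N -> A n `<=` A m.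
  by move=> /subnK <-; elim: (n - m)%N => // k IH x [/IH].
have Bdis m n x : nx (A m) x -> nx (A n) x -> m = n.
  wlog mn : m n / (m <= n)%N.
    by move=> H mx nx'; have /orP[/H|/H] := leq_total m n; [exact|move=> ->].
  move=> mx nx'; apply/eqP; rewrite eqn_leq mn leqNgt/=; apply/negP => /Adec mA.
  by have [_ nA _ _] := BP n; have [] := mA _ (nA _ nx').
(* Index [0] marks the points never covered; [i.+1] marks the piece chosen at stage [i]. *)
pose idx x := if pselect (exists n, nx (A n) x) is left e then (sval (cid e)).+1 else 0%N.
have idxS i : [set x | idx x = i.+1] = nx (A i).
  apply/seteqP; split => x /=; rewrite /idx; case: pselect => // e.
    by case: cid => n /= nx' [<-].
    by move=> nx'; congr S; case: cid => n /= nx''; apply: Bdis nx'' nx'.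
  by move=> nx'; exfalso; apply: e; exists i.
have mS i : measurable [set x | idx x = i.+1] by rewrite idxS; case: (BP i).
have idx0 : [set x | idx x = 0%N] = ~` \bigcup_i [set x | idx x = i.+1].
  apply/seteqP; split => x /=; first by move=> ix [i _] /=; rewrite ix.
  by case ix : (idx x) => [//|i] nix; exfalso; apply: nix; exists i.
have m0 : measurable [set x | idx x = 0%N].
  by rewrite idx0; apply: measurableC; exact: bigcupT_measurable.
exists idx; split => //; [by case|by case=> // i _; rewrite idxS; case: (BP i)|].
set Z := E `&` _; have mZ : measurable Z by exact: measurableI.
apply/eqP; rewrite eq_le N0// andbT leNgt; apply/negP => NZ.
have [C [mC CZ PC NC]] := EP Z mZ (@subIsetl _ _ _) NZ.
have CA n : C `<=` A n.
  move=> x /CZ[Ex ix]; elim: n => // n IH; split => // nx'.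
  have /= := ix; suff -> : idx x = n.+1 by [].
  by move: nx'; rewrite -idxS.
(* [C] stays available at every stage, so each chosen piece has at least half its value; these
   values would add up beyond [N E]. *)
have step n : n%:R * (N C / 2) <= N E - N (A n).
  elim: n => [|n IH]; first by rewrite mul0r subrr.
  have [mB BA _ BC] := BP n; have := ND (A n) (nx (A n)) (AP n).1 mB BA.
  have := BC C mC (CA n) PC; rewrite -[n.+1%:R]natr1 mulrDl mul1r /= => ? ?.
  by move: IH; lra.
have NC2 : 0 < N C / 2 by rewrite divr_gt0.
have := step (Num.trunc (N E / (N C / 2))).+1.
apply/negP; rewrite -ltNge; apply: (@le_lt_trans _ _ (N E)).
  by rewrite gerBl; apply: N0; exact: (AP _).1.
by rewrite -ltr_pdivrMr//; exact: truncnS_gt.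
Qed.

End exhaustion.

(** * Scalarly measurable multifunctions and their stability *)

Section measurable_multifunctions.
Context d (T : measurableType d) (R : realType) (X : completeNormedModType R).
Implicit Types (F G : T -> set X) (f g : dual X).

Definition scalarly_measurable_mf F :=
  (forall w, cwk (F w)) /\
  forall f, measurable_fun [set: T] (fun w => supp f (F w)).

Lemma measurable_width F f : scalarly_measurable_mf F ->
  measurable_fun [set: T] (fun w => width f (F w)).
Proof. by move=> [_ mF]; apply: measurable_funD. Qed.

(** By [supp_face] the support functions of the face are pointwise limits of measurable
    functions. *)
Lemma scalarly_measurable_face F f : scalarly_measurable_mf F ->
  scalarly_measurable_mf (fun w => face f (F w)).
Proof.
move=> [cF mF]; split=> [w|g]; first exact: face_cwk.
apply: (measurable_fun_cvg (h := fun n w =>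
  supp (n%:R *: f + g) (F w) - n%:R * supp f (F w))).
- move=> n; apply: measurable_funB => //.
  by apply: measurable_funM.
- by move=> w _; exact: supp_face.
Qed.

Lemma scalarly_measurable_bigcap (F : nat -> T -> set X) :
    (forall n, scalarly_measurable_mf (F n)) ->
    (forall n w, F n.+1 w `<=` F n w) ->
  scalarly_measurable_mf (fun w => \bigcap_n F n w).
Proof.
move=> sF dF.
have cI w := @cwk_bigcap _ _ (F^~ w) (fun n => (sF n).1 w) (fun n => dF n w).
split=> [w|f]; first exact: (cI w).1.
apply: (measurable_fun_cvg (h := fun n w => supp f (F n w))).
- by move=> n; exact: (sF n).2.
- by move=> w _; exact: (cI w).2.
Qed.

Lemma scalarly_measurable_glue (F : nat -> T -> set X) (idx : T -> nat) :
    (forall n, scalarly_measurable_mf (F n)) ->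
    (forall i, measurable [set w | idx w = i]) ->
  scalarly_measurable_mf (fun w => F (idx w) w).
Proof.
move=> sF mi; split=> [w|f _ B mB]; first exact: (sF _).1.
rewrite setTI.
have -> : (fun w => supp f (F (idx w) w)) @^-1` B =
    \bigcup_i ([set w | idx w = i] `&` (fun w => supp f (F i w)) @^-1` B).
  apply/seteqP; split=> [w Bw|w [i _ [<-]]//].
  by exists (idx w).
apply: bigcupT_measurable => i; apply: measurableI => //.
by have := (sF i).2 f measurableT _ mB; rewrite setTI.
Qed.

End measurable_multifunctions.

(** * Existence of scalarly measurable selections *)

Section selections.
Context d (T : measurableType d) (R : realType) (X : completeNormedModType R).
Variables (mu : {measure set T -> \bar R}) (w0 : T -> R).
Hypothesis int_w0 : mu.-integrable [set: T] (EFin \o w0).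
Hypothesis w0_ge0 : forall x, 0 <= w0 x.
Implicit Types (F G : T -> set X) (f g z : dual X) (A B E : set T).

(** The finite measure with density [w0], which allows exhaustion arguments although [mu] may be
    infinite; on the set where [w0] is positive it has the same null sets as [mu]. *)
Let N A := \int[mu]_(x in A) w0 x.

Let N_ge0 A : measurable A -> 0 <= N A.
Proof. by move=> _; exact: Rintegral_ge0. Qed.

Let N_setD A B : measurable A -> measurable B -> B `<=` A ->
  N A = N B + N (A `\` B).
Proof. by move=> mA mB BA; exact: Rint_setD. Qed.

Let N_pos_nonnull A : measurable A -> (forall x, A x -> 0 < w0 x) ->
  ~ {ae mu, forall x, ~ A x} -> 0 < N A.
Proof.
move=> mA A0 nA; rewrite lt_neqAle N_ge0// andbT eq_sym; apply/eqP => NA.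
apply: nA; apply: filterS (Rint_eq0_ae mA int_w0 w0_ge0 NA) => x w0x Ax.
by have := A0 x Ax; rewrite w0x// ltxx.
Qed.

Let measurable_w0_pos : measurable [set x | 0 < w0 x].
Proof.
have := measurable_fun_ltr (measurable_cst (0 : R)) (intg_measurable int_w0).
by move=> /(_ measurableT [set true]); rewrite setTI; apply.
Qed.

Let measurable_width_gt F z (e : R) : scalarly_measurable_mf F ->
  measurable [set x | e < width z (F x)].
Proof.
move=> sF; have := measurable_fun_ltr (measurable_cst e) (measurable_width z sF).
by move=> /(_ measurableT [set true]); rewrite setTI; apply.
Qed.

Definition submf F G := scalarly_measurable_mf F /\ forall x, F x `<=` G x.

Let submf_refl F : scalarly_measurable_mf F -> submf F F.
Proof. by move=> sF; split=> // x; exact: subset_refl. Qed.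

(** The exceptional null set may depend on [z]. *)
Definition small_on (e : R) F E := forall z, bounded_by 1 z ->
  {ae mu, forall x, E x -> 0 < w0 x -> width z (F x) <= e}.

(** [E] is exhausted by countably many pieces, on each of which a single functional has width
    greater than [e]; [F1] and [F2] are the faces exposed there by that functional and its
    opposite. *)
Let split_wide F E (e : R) : scalarly_measurable_mf F -> measurable E ->
    (forall A, measurable A -> A `<=` E -> 0 < N A -> ~ small_on e F A) ->
  exists F1 F2, [/\ submf F1 F, submf F2 F &
    {ae mu, forall x, E x -> 0 < w0 x -> exists2 z : dual X, bounded_by 1 z &
      exists c, (forall y, F1 x y -> c + e <= z y) /\
                (forall y, F2 x y -> z y <= c)}].
Proof.
move=> sF mE nsmall.
pose P A := exists2 z : dual X, bounded_by 1 z & forall x, A x -> e < width z (F x).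
have [A mA AE NA|idx [midx idxP idx0]] := exhaustion (P := P) N_ge0 N_setD mE.
  have /existsNP[z /not_implyP[z1 nz]] := nsmall A mA AE NA.
  pose B := A `&` [set x | 0 < w0 x] `&` [set x | e < width z (F x)].
  have mB : measurable B.
    by apply: measurableI; [exact: measurableI|exact: measurable_width_gt].
  exists B; split => //; first by move=> x [[]].
    by exists z => // x [].
  apply: N_pos_nonnull => // [x [[]]//|aeB]; apply: nz.
  apply: filterS aeB => x nB Ax w0x; rewrite leNgt; apply/negP => ex.
  exact: nB.
have /choice[z zP] : forall i, exists z : dual X, bounded_by 1 z /\
    ((0 < i)%N -> forall x, idx x = i -> e < width z (F x)).
  move=> [|i].
    by exists 0; split => // x; rewrite dual_zeroE normr0 mul1r.
  have [//|[z z1 zP]|i0] := idxP i.+1; first by exists z.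
  exists 0; split => [x|_ x xi]; first by rewrite dual_zeroE normr0 mul1r.
  by have : [set x | idx x = i.+1] x by []; rewrite i0.
(* The sign [s] selects the face. The remainder of [E], with index [0], carries no weight, so [F] is
   kept on it. *)
pose F_ (s : R) i x := if i is 0%N then F x else face (s *: z i) (F x).
have sF_ s i : scalarly_measurable_mf (F_ s i).
  by case: i => [//|i]; exact: scalarly_measurable_face.
have FF s x : F_ s (idx x) x `<=` F x by case: (idx x) => [//|i]; exact: face_sub.
exists (fun x => F_ 1 (idx x) x), (fun x => F_ (-1) (idx x) x); split.
- by split; [exact: scalarly_measurable_glue|move=> x; exact: FF].
- by split; [exact: scalarly_measurable_glue|move=> x; exact: FF].
- have mE0 : measurable (E `&` [set x | idx x = 0%N]) by exact: measurableI.
  apply: filterS (Rint_eq0_ae mE0 int_w0 w0_ge0 idx0) => x Ex0 Ex w0x.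
  case ix : (idx x) => [|i]; first by move: w0x; rewrite Ex0// ltxx.
  exists (z i.+1); first exact: (zP _).1.
  have := (zP i.+1).2 isT x ix; rewrite /width => ew.
  (* The minimum of the functional on [F x]: it is attained all along the second face, and the first
     face lies more than [e] above it. *)
  exists (- supp (- z i.+1) (F x)); split=> y [_].
    by rewrite scale1r => ->; lra.
  by rewrite scaleN1r dual_oppE => <-; rewrite opprK.
Qed.

(** Otherwise [split_wide] applies on [E] to every measurable submultifunction of [F], and iterating
    it builds a separated dyadic tree over a single point, against [no_separated_tree]. *)
Let small_piece F E (e : R) : 0 < e -> scalarly_measurable_mf F -> measurable E ->
    0 < N E ->
  exists A G, [/\ measurable A, A `<=` E, 0 < N A, submf G F & small_on e G A].
Proof.
move=> e0 sF mE NE; apply: contrapT => nsmall.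
pose S := {G | submf G F}.
have /choice[spl splP] : forall G : S, exists H : S * S,
    (forall x, sval H.1 x `<=` sval G x) /\ (forall x, sval H.2 x `<=` sval G x) /\
    {ae mu, forall x, E x -> 0 < w0 x -> exists2 z : dual X, bounded_by 1 z &
      exists c, (forall y, sval H.1 x y -> c + e <= z y) /\
                (forall y, sval H.2 x y -> z y <= c)}.
  move=> [G [sG GF]].
  have [A mA AE NA sm|F1 [F2 [[s1 F1G] [s2 F2G] aeF]]] := split_wide (e := e) sG mE.
    by apply: nsmall; exists A, G.
  have S1 : submf F1 F by split => // x; exact: subset_trans (F1G x) (GF x).
  have S2 : submf F2 F by split => // x; exact: subset_trans (F2G x) (GF x).
  by exists (exist (fun G => submf G F) F1 S1, exist (fun G => submf G F) F2 S2).
have SF := submf_refl sF.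
pose tree := fix tree (s : seq bool) : S := if s is b :: s' then
  (if b then (spl (tree s')).1 else (spl (tree s')).2) else exist (fun G => submf G F) F SF.
pose Q s x := exists2 z : dual X, bounded_by 1 z &
      exists c, (forall y, sval (tree (true :: s)) x y -> c + e <= z y) /\
                (forall y, sval (tree (false :: s)) x y -> z y <= c).
(* There are countably many nodes, so one null set serves for the whole tree. *)
have aeQ : {ae mu, forall x, E x -> 0 < w0 x -> forall s, Q s x}.
  have : {ae mu, forall x, forall n, E x -> 0 < w0 x ->
      forall s : seq bool, unpickle n = Some s -> Q s x}.
    apply: ae_foralln => n; case: (unpickle n) => [s|]; last exact: aeW.
    have [_ [_ H]] := splP (tree s).
    by apply: filterS H => x H Ex w0x _ [<-]; exact: H.
  apply: filterS => x Qx Ex w0x s; exact: (Qx (pickle s) Ex w0x s (pickleK s)).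
have [x [Ex w0x Qx]] := ae_nonempty mE int_w0 w0_ge0 NE aeQ.
have [_ _ wF] := sF.1 x.
apply: (@no_separated_tree _ _ (fun s => sval (tree s) x) e) => //.
- by move=> s; have [[/(_ x)[]]] := svalP (tree s).
- by move=> [] s /=; have [H1 [H2 _]] := splP (tree s).
- move=> s; have [z z1 [c [c1 c2]]] := Qx Ex w0x s.
  by exists z, c.
Qed.

(** The pieces given by [small_piece] exhaust the space up to a set of weight zero, and the
    refinements on them are glued. *)
Let small_refinement F (e : R) : 0 < e -> scalarly_measurable_mf F ->
  exists G, submf G F /\ small_on e G setT.
Proof.
move=> e0 sF.
pose P A := exists G, submf G F /\ small_on e G A.
have [A mA _ NA|idx [midx idxP idx0]] := exhaustion (P := P) N_ge0 N_setD measurableT.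
  have [B [G [mB BA NB GF sB]]] := small_piece e0 sF mA NA.
  by exists B; split => //; exists G.
have /choice[G GP] : forall i, exists G, submf G F /\
    ((0 < i)%N -> small_on e G [set x | idx x = i]).
  move=> [|i]; first by exists F; split => //; exact: submf_refl.
  have [//|[G [GF sG]]|i0] := idxP i.+1; first by exists G.
  exists F; split => [|_ z _]; first by split => // x; exact: subset_refl.
  apply: aeW => x xi.
  by exfalso; have : [set x | idx x = i.+1] x by []; rewrite i0.
exists (fun x => G (idx x) x); split.
  split; last by move=> x; exact: (GP _).1.2.
  by apply: scalarly_measurable_glue => // i; exact: (GP i).1.1.
move=> z z1; have m0 : measurable (setT `&` [set x | idx x = 0%N]).
  exact: measurableI.
have ae0 := Rint_eq0_ae m0 int_w0 w0_ge0 idx0.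
have aeG : {ae mu, forall x, forall i, (0 < i)%N -> idx x = i -> 0 < w0 x ->
    width z (G i x) <= e}.
  apply: ae_foralln => i; case: i => [|i]; first exact: aeW.
  by apply: filterS ((GP i.+1).2 isT z z1) => x H _; exact: H.
apply: filterS2 ae0 aeG => x x0 xG _ w0x; case ix : (idx x) => [|i].
  by move: w0x; rewrite x0// ltxx.
exact: xG.
Qed.

(** Successive refinements to width [n.+1%:R^-1] are intersected. Where the weight vanishes, the
    assumption on [F] already gives width zero. *)
Lemma scalarly_singleton F : scalarly_measurable_mf F ->
    (forall f, {ae mu, forall x, w0 x = 0 -> width f (F x) = 0}) ->
  exists2 G, submf G F & forall f, {ae mu, forall x y y', G x y -> G x y' -> f y = f y'}.
Proof.
move=> sF F0; pose S := {G : T -> set X | scalarly_measurable_mf G}.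
have /choice[nx nxP] : forall p : S * nat, exists G : S, submf (sval G) (sval p.1) /\
    small_on p.2.+1%:R^-1 (sval G) setT.
  move=> [[G sG] n] /=; have [|H [[sH HG] small]] := @small_refinement G n.+1%:R^-1 _ sG.
    by rewrite invr_gt0 ltr0n.
  by exists (exist (fun G : T -> set X => scalarly_measurable_mf G) H sH).
pose F_ := fix F_ n : S := if n is m.+1 then nx (F_ m, m) else exist (fun G : T -> set X => scalarly_measurable_mf G) F sF.
have sF_ n : scalarly_measurable_mf (sval (F_ n)) by exact: (svalP (F_ n)).
have dF n x : sval (F_ n.+1) x `<=` sval (F_ n) x.
  by have [[_ H] _] := nxP (F_ n, n); exact: H.
exists (fun x => \bigcap_n sval (F_ n) x).
  split; first exact: (scalarly_measurable_bigcap sF_ dF).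
  by move=> x y /(_ 0%N I).
move=> f; have [M M0 fM] := dual_bounded_by f.
(* [f] is scaled into the unit ball, the only place where smallness is known; [M + 1] is positive
   even if [M] is zero. *)
pose z := (M + 1)^-1 *: f.
have M1 : 0 < M + 1 by rewrite ltr_wpDl.
have z1 : bounded_by 1 z.
  move=> y; rewrite dual_scaleE normrM gtr0_norm ?invr_gt0// ler_pdivrMl// mul1r.
  by apply: le_trans (fM y) _; rewrite ler_wpM2r// lerDl.
have aez : {ae mu, forall x n, 0 < w0 x -> width z (sval (F_ n.+1) x) <= n.+1%:R^-1}.
  apply: ae_foralln => n; have [_ H] := nxP (F_ n, n).
  by apply: filterS (H z z1) => x H'; exact: H'.
apply: filterS2 (F0 f) aez => x F0x zx.
have fle y y' : (\bigcap_n sval (F_ n) x) y -> (\bigcap_n sval (F_ n) x) y' -> f y <= f y'.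
  move=> Gy Gy'; have := w0_ge0 x; rewrite le_eqVlt => /predU1P[/esym/F0x w00|w0x].
    rewrite -subr_le0 -w00; apply: le_width; first exact: sF.1.
      exact: (Gy 0%N).
    exact: (Gy' 0%N).
  suff : z y - z y' <= 0.
    by rewrite !dual_scaleE -mulrBr pmulr_rle0 ?invr_gt0// subr_le0.
  apply/ler_addgt0Pr => e e0; rewrite add0r.
  have n_e : (Num.trunc e^-1).+1%:R^-1 < e.
    by rewrite invf_plt ?posrE// truncnS_gt.
  apply: le_trans (ltW n_e); apply: le_trans (zx _ w0x).
  by apply: le_width; [exact: (sF_ _).1|exact: Gy|exact: Gy'].
by move=> y y' Gy Gy'; apply/eqP; rewrite eq_le !fle.
Qed.

(** Any selection [g] of the scalarly singleton refinement [G] works: [f (g x)] agrees almost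
    everywhere with the measurable [supp f (G x)], and completeness of [mu] transfers
    measurability. *)
Theorem scalarly_measurable_selection F : measure_is_complete mu ->
    scalarly_measurable_mf F ->
    (forall f, {ae mu, forall x, w0 x = 0 -> width f (F x) = 0}) ->
  exists2 g : T -> X, selection F g & scalarly_measurable g.
Proof.
move=> cmu sF F0; have [G [sG GF] Gf] := scalarly_singleton sF F0.
have /choice[g gG] : forall x, exists y, G x y by move=> x; case: (sG.1 x).
exists g; first by move=> x; exact: GF.
move=> f; apply/measurable_EFinP.
apply: (@ae_measurable_fun _ _ _ mu cmu _ (EFin \o (fun x => supp f (G x)))).
  apply: filterS (Gf f) => x fx _ /=; congr EFin.
  have [y Gy [<- _]] := supp_attained f (sG.1 x); exact: fx.
by apply/measurable_EFinP; exact: sG.2.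
Qed.

End selections.

(** * Weak compactness in [L^1] *)

Section L1_weak_compactness.
Context d (T : measurableType d) (R : realType) (mu : {measure set T -> \bar R}).
Implicit Types (F G : L1 mu).

Local Notation intg f := (mu.-integrable [set: T] (EFin \o f)).
Local Notation Lf := (LfunType mu (lexx 1%E)).

Definition L1fun F : T -> R := (repr F : Lf).

Lemma L1fun_intg F : intg (L1fun F).
Proof. by have := LfunP (repr F : Lf) => /Lfun1_integrable. Qed.

Lemma L1fun_pi (f : Lf) : {ae mu, forall x, L1fun (\pi_(L1 mu) f)%qT x = f x}.
Proof.
have /eqP := esym (reprK (\pi_(L1 mu) f)%qT).
rewrite -Quotient.idealrBE => /null_LfunP.
by apply: filterS => x /eqP; rewrite subr_eq0 => /eqP.
Qed.

Lemma L1fun_toL1 (f : T -> R) (If : intg f) :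
  {ae mu, forall x, L1fun (toL1 If) x = f x}.
Proof. exact: L1fun_pi. Qed.

Lemma L1fun_linear (a : R) F G :
  {ae mu, forall x, L1fun (a *: F + G) x = a * L1fun F x + L1fun G x}.
Proof.
have -> : a *: F + G = \pi_(L1 mu)%qT (a *: (repr F : Lf) + (repr G : Lf)).
  rewrite -[G in LHS]reprK [a *: F](_ : _ = \pi_(L1 mu)%qT (a *: (repr F : Lf)))//.
  by rewrite !piE.
exact: L1fun_pi.
Qed.

Lemma L1fun_norm F : \int[mu]_x `|L1fun F x| = `|F|.
Proof. by rewrite [RHS]/Num.norm/= /L1_norm Lnorm1. Qed.

(** Bounded measurable multipliers act on classes as functionals of norm at most one; they serve to
    test weak limits. *)
Lemma L1_functional (th : T -> R) : measurable_fun [set: T] th ->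
    (forall x, `|th x| <= 1) ->
  exists L : dual (L1 mu), forall F, L F = \int[mu]_x (th x * L1fun F x).
Proof.
move=> mth th1.
have Ith F : intg (fun x => th x * L1fun F x).
  exact: intg_mul (L1fun_intg F).
have lin : linear (fun F => \int[mu]_x (th x * L1fun F x)).
  move=> a F G /=.
  rewrite -[RHS]/(a * \int[mu]_x (th x * L1fun F x) + _) -RintZ// -RintD//; last exact: intgZ.
  apply: Rint_ae_eq => //; first by apply: intgD => //; exact: intgZ.
  by apply: filterS (L1fun_linear a F G) => x -> _; rewrite mulrDr mulrCA.
have bd : bounded_by 1 (fun F => \int[mu]_x (th x * L1fun F x)).
  move=> F; rewrite mul1r -L1fun_norm; apply: Rint_norm_le => //.
    exact/intg_norm/L1fun_intg.
  by move=> x _; rewrite normrM ler_piMl.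
by have [L LE] := dual_of lin bd; exists L.
Qed.

(* Gliding hump: relatively weakly compact sequences carry no mass on disjoint
   sets. *)
Lemma gliding_hump (K : set (L1 mu)) (F : nat -> L1 mu) (B : nat -> set T) (e : R) :
    relatively_weakly_compact K -> (forall k, K (F k)) ->
    (forall k, measurable (B k)) -> (forall i j x, B i x -> B j x -> i = j) ->
    0 < e -> (forall k, e <= \int[mu]_(x in B k) `|L1fun (F k) x|) ->
  False.
Proof.
move=> rK KF mB dB e0 eB.
have wK : weakly_compact (closure (K : set (weak (L1 mu)))).
  by move: rK; rewrite /relatively_weakly_compact precompactE.
have KF' k : closure (K : set (weak (L1 mu))) (F k) by exact: subset_closure.
have [U UU ooU] := ultra_nat.
pose a k := L1fun (F k); have Ia k : intg (a k) := L1fun_intg (F k).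
(* This multiplier turns the mass of [F k] on [B k] into the value [Lth k (F k)], at least [e]. *)
pose th k x := Num.sg (a k x) * \1_(B k) x.
have msg : measurable_fun [set: R] (@Num.sg R).
  apply: nondecreasing_measurable => // x y xy.
  by case: (sgrP x); case: (sgrP y) => *; lra.
have mth k : measurable_fun [set: T] (th k).
  apply: measurable_funM; last exact: measurable_indic.
  by apply: measurableT_comp (intg_measurable (Ia k)); exact: msg.
have th_in k x : B k x -> th k x = Num.sg (a k x).
  by move=> Bx; rewrite /th indicE mem_set// mulr1.
have th_out k x : ~ B k x -> th k x = 0.
  by move=> Bx; rewrite /th indicE memNset// mulr0.
have sg1 (r : R) : `|Num.sg r| <= 1 by rewrite normr_sg; case: (_ != _).
have th1 k x : `|th k x| <= 1.
  by have [Bx|nBx] := pselect (B k x); [rewrite th_in|rewrite th_out// normr0].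
have Ith k G : intg (fun x => th k x * L1fun G x).
  exact: intg_mul (L1fun_intg G).
have /choice[Lth LthE] := fun k => L1_functional (mth k) (th1 k).
pose tail n := \bigcup_(m in [set m | (n <= m)%N]) B m.
have mtail n : measurable (tail n) by apply: bigcup_measurable => m _; exact: mB.
have tail_cvg f : intg f -> \int[mu]_(x in tail n) `|f x| @[n --> \oo] --> 0.
  move=> If; apply: Rint_decreasing => //; first exact: intg_norm.
  apply: aeW => x; have [[m Bm]|nB] := pselect (exists m, B m x).
    exists m.+1 => // n /= mn [k /= nk Bk].
    by move: mn; rewrite -(dB _ _ _ Bk Bm) ltnNge nk.
  by apply: nearW => n [m _ Bm]; apply: nB; exists m.
have tail_lt f (r : R) : intg f -> 0 < r ->
    \forall n \near \oo, \int[mu]_(x in tail n) `|f x| < r.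
  by move=> If r0; apply: cvgr_lt (tail_cvg f If) _ r0.
(* The final clash is [e - 3 * r <= L G' <= r], which is impossible for this [r]. *)
pose r := e / 5; have r0 : 0 < r by rewrite divr_gt0.
have [G _ GP] := weakly_compact_seq (u := F) UU wK (filterS (fun n _ => KF' n) filterT).
(* The next index is so far out that the earlier multipliers are nearly at their limit values on
   [F k'], while [F k] has little mass on the sets from [k'] on. *)
have /choice[nx nxP] : forall k, exists k', [/\ (k < k')%N,
    forall i, (i <= k)%N -> `|Lth i (F k') - Lth i G| <= r / k.+1%:R &
    \int[mu]_(x in tail k') `|a k x| < r].
  move=> k; have rk : 0 < r / k.+1%:R by rewrite divr_gt0.
  have U1 : U [set k' | (k < k')%N] by apply: ooU; exists k.+1.
  have U2 : U [set k' | forall i, (i <= k)%N -> `|Lth i (F k') - Lth i G| <= r / k.+1%:R].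
    suff H n : U [set k' | forall i, (i < n)%N -> `|Lth i (F k') - Lth i G| <= r / k.+1%:R].
      exact: H k.+1.
    elim: n => [|n IH]; first by apply: (filterS _ filterT).
    have := GP (Lth n) => /cvgrPdist_le /(_ _ rk) Un.
    apply: filterS2 IH Un => k' H Hn i; rewrite ltnS leq_eqVlt => /predU1P[->|]; last exact: H.
    by rewrite distrC.
  have U3 : U [set k' | \int[mu]_(x in tail k') `|a k x| < r] by apply: ooU; exact: tail_lt.
  by have [k' [[? ?] ?]] := filter_ex (filterI (filterI U1 U2) U3); exists k'.
pose kk := fix kk j := if j is i.+1 then nx (kk i) else 0%N.
have kklt j : (kk j < kk j.+1)%N by case: (nxP (kk j)).
have kkmono i j : (i <= j)%N -> (kk i <= kk j)%N.
  move=> /subnK <-; elim: (j - i)%N => // n IH; apply: (leq_trans IH).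
  by rewrite addSn ltnW.
have kkltm i j : (i < j)%N -> (kk i < kk j)%N.
  by move=> /kkmono; apply: leq_trans; exact: kklt.
have kkinj i j : kk i = kk j -> i = j.
  by move=> ij; case: (ltngtP i j) => // /kkltm; rewrite ij ltnn.
have kkge j : (j <= kk j)%N by elim: j => // j IH; exact: leq_ltn_trans IH (kklt j).
(* The subsequence need not share the limit [G], so it gets its own limit [G']; [J] is then taken so
   late that both limits have little mass on the tail. *)
have [G' _ GP'] := weakly_compact_seq (u := F \o kk) UU wK (filterS (fun n _ => KF' (kk n)) filterT).
have [J [JG JG']] : exists J, \int[mu]_(x in tail (kk J)) `|L1fun G x| < r /\
    \int[mu]_(x in tail (kk J)) `|L1fun G' x| < r.
  have [J1 _ J1P] := tail_lt _ _ (L1fun_intg G) r0.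
  have [J2 _ J2P] := tail_lt _ _ (L1fun_intg G') r0.
  exists (maxn J1 J2); split.
    by apply: J1P => /=; apply: leq_trans (kkge _); exact: leq_maxl.
  by apply: J2P => /=; apply: leq_trans (kkge _); exact: leq_maxr.
pose P n x := \sum_(J <= i < n) th (kk i) x.
(* The pointwise sum of all multipliers from [J] on; by disjointness at most one of them is nonzero
   at [x]. *)
pose t x := if pselect (exists i, (J <= i)%N /\ B (kk i) x) is left ex
  then Num.sg (a (kk (sval (cid ex))) x) else 0.
have PtE x i0 : B (kk i0) x -> forall n,
    P n x = (if (J <= i0 < n)%N then Num.sg (a (kk i0) x) else 0) /\
    t x = (if (J <= i0)%N then Num.sg (a (kk i0) x) else 0).
  move=> Bi0 n; split.
    rewrite /P; case: ifPn => [/andP[Ji0 i0n]|ni0].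
      rewrite (big_cat_nat Ji0 (ltnW i0n))/= (big_ltn i0n) big1_seq ?add0r.
        rewrite big1_seq ?addr0; first exact: th_in.
        move=> i /andP[_]; rewrite mem_index_iota => /andP[i0i _].
        by apply: th_out => Bi; move: i0i; rewrite (kkinj _ _ (dB _ _ _ Bi0 Bi)) ltnn.
      move=> i /andP[_]; rewrite mem_index_iota => /andP[_ ii0].
      by apply: th_out => Bi; move: ii0; rewrite (kkinj _ _ (dB _ _ _ Bi0 Bi)) ltnn.
    rewrite big1_seq// => i /andP[_]; rewrite mem_index_iota => iJn.
    by apply: th_out => Bi; move: ni0; rewrite (kkinj _ _ (dB _ _ _ Bi0 Bi)) iJn.
  rewrite /t; case: pselect => [ex|nex].
    case: cid => i /= [Ji Bi]; rewrite (kkinj _ _ (dB _ _ _ Bi0 Bi)) Ji//.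
  by case: ifPn => // Ji0; exfalso; apply: nex; exists i0.
have Pt0 x : ~ (exists i, B (kk i) x) -> forall n, P n x = 0 /\ t x = 0.
  move=> nB n; split.
    by rewrite /P big1// => i _; apply: th_out => Bi; apply: nB; exists i.
  rewrite /t; case: pselect => // ex; exfalso.
  by apply: nB; have [i [_ Bi]] := ex; exists i.
have Pt1 n x : `|P n x| <= \1_(tail (kk J)) x /\ `|t x| <= \1_(tail (kk J)) x /\
    `|t x - P n.+1 x| <= \1_(tail (kk n.+1)) x.
  have [[i Bi]|nB] := pselect (exists i, B (kk i) x); last first.
    by rewrite !(Pt0 x nB _).1 (Pt0 x nB n).2 subrr normr0.
  rewrite (PtE x i Bi n).1 (PtE x i Bi n.+1).1 (PtE x i Bi n).2.
  have it k : (k <= i)%N -> \1_(tail (kk k)) x = 1 :> R.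
    by move=> ki; rewrite indicE mem_set//; exists (kk i) => //=; exact: kkmono.
  have [Ji|Ji] /= := leqP J i; last by rewrite subrr normr0.
  rewrite (it J Ji) sg1; split; first by case: ifP; rewrite ?normr0.
  split => //; have [ni|ni] := ltnP i n.+1; first by rewrite subrr normr0.
  by rewrite (it _ ni) subr0.
have t1 x : `|t x| <= 1.
  by apply: le_trans (Pt1 0%N x).2.1 _; rewrite indicE; case: (_ \in _).
have mP n : measurable_fun [set: T] (P n).
  by apply: measurable_sum => i; exact: mth.
have mt : measurable_fun [set: T] t.
  apply: (measurable_fun_cvg (h := P)) => // x _.
  have [[i Bi]|nB] := pselect (exists i, B (kk i) x); last first.
    by rewrite (Pt0 x nB 0%N).2; apply: cvg_near_cst; apply: nearW => n; rewrite (Pt0 x nB n).1.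
  rewrite (PtE x i Bi 0%N).2; apply: cvg_near_cst; exists i.+1 => // n /= ni.
  by rewrite (PtE x i Bi n).1 ni andbT.
have [L LE] := L1_functional mt t1.
have Lup : L G' <= r.
  apply: le_trans (ltW JG'); rewrite LE (le_trans (ler_norm _))//.
  by apply: Rint_mul_le (L1fun_intg G') => // x; exact: (Pt1 0%N x).2.1.
have IthP n H : \int[mu]_x (P n x * L1fun H x) = \sum_(J <= i < n) Lth (kk i) H.
  under eq_bigr do rewrite LthE.
  rewrite -Rint_sum//; apply: eq_Rintegral => x _.
  by rewrite /P mulr_suml.
have P1 n x : `|P n x| <= 1.
  by apply: le_trans (Pt1 n x).1 _; rewrite indicE; case: (_ \in _).
(* On [F k] the hump contributes at least [e] and the later part at least [- r]. The earlier part is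
   within [r] of its value on [G], itself at least [- r] by the choice of [J]. *)
have Llow : e - 3 * r <= L G'.
  apply: (cvgr_to_ge (GP' L)); apply: ooU; exists J.+1 => // -[//|j] /= Jj.
  rewrite LE -/(a (kk j.+1)); set k := kk j.+1.
  have -> : \int[mu]_x (t x * a k x) =
      \int[mu]_x (P j.+2 x * a k x) + \int[mu]_x ((t x - P j.+2 x) * a k x).
    rewrite -RintD//; first by apply: eq_Rintegral => x _; rewrite -mulrDl addrC subrK.
      exact: intg_mul (Ia k).
    have := intgB (intg_mul mt t1 (Ia k)) (intg_mul (mP j.+2) (P1 j.+2) (Ia k)).
    by apply: eq_integrable => // x _ /=; rewrite mulrBl.
  have : `|\int[mu]_x ((t x - P j.+2 x) * a k x)| <= r.
    have [_ _ /ltW] := nxP (kk j.+1); apply: le_trans.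
    apply: (Rint_mul_le _ _ _ (Ia k)) => //; first exact: measurable_funB.
    by move=> x; exact: (Pt1 j.+1 x).2.2.
  rewrite ler_norml => /andP[tail_ge _].
  have : \int[mu]_x (P j.+2 x * a k x) =
      \sum_(J <= i < j.+1) Lth (kk i) (F k) + Lth k (F k).
    by rewrite (IthP j.+2 (F k)) big_nat_recr//; exact: ltnW.
  have : e <= Lth k (F k).
    rewrite LthE; apply: le_trans (eB k) _; rewrite Rintegral_mkcond.
    rewrite le_eqVlt; apply/orP; left; apply/eqP; apply: eq_Rintegral => x _.
    rewrite patchE; case: ifPn => [/set_mem Bx|/negP Bx].
      by rewrite th_in// -normrEsg.
    by rewrite th_out ?mul0r// => /mem_set.
  have : \sum_(J <= i < j.+1) Lth (kk i) G - r <= \sum_(J <= i < j.+1) Lth (kk i) (F k).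
    rewrite lerBlDr -lerBlDl -sumrB.
    (* At most [j.+1] errors are added, and [j <= kk j]. *)
    apply: (@le_trans _ _ (\sum_(J <= i < j.+1) r / (kk j).+1%:R)).
      apply: ler_sum_nat => i /andP[_ ij]; have [_ H _] := nxP (kk j).
      apply: le_trans (ler_norm _) _; rewrite distrC; apply: H.
      exact: kkmono.
    rewrite sumr_const_nat -mulrnAr -[leRHS]mulr1 ler_wpM2l ?(ltW r0)//.
    rewrite -mulr_natl ler_pdivrMr// mul1r ler_nat.
    by apply: leq_trans (leq_subr _ _) _; rewrite ltnS.
  have : - r <= \sum_(J <= i < j.+1) Lth (kk i) G.
    rewrite -IthP lerNl (le_trans (ler_norm _))// normrN.
    apply: le_trans (ltW JG); apply: Rint_mul_le (L1fun_intg G) => // x.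
    exact: (Pt1 j.+1 x).1.
  by lra.
by move: Llow Lup; rewrite /r; lra.
Qed.

End L1_weak_compactness.

(** * Integrable weights for countable families *)

Section weights.
Context d (T : measurableType d) (R : realType) (mu : {measure set T -> \bar R}).

Local Notation intg f := (mu.-integrable [set: T] (EFin \o f)).

(** [w] is the finite part of the series, whose integral is at most [C] by monotone convergence; the
    sum is therefore finite almost everywhere. *)
Lemma beppo_levi (u : nat -> T -> R) (C : R) : (forall k, intg (u k)) ->
    (forall k x, 0 <= u k x) -> (forall n, \sum_(k < n) \int[mu]_x u k x <= C) ->
  exists w : T -> R, [/\ intg w, forall x, 0 <= w x &
    {ae mu, forall x n, \sum_(k < n) u k x <= w x}].
Proof.
move=> Iu u0 uC.
pose W x := (\sum_(k <oo) (u k x)%:E)%E.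
have mu_ k : measurable_fun [set: T] (fun x => (u k x)%:E).
  exact/measurable_EFinP/intg_measurable/Iu.
have W0 x : (0 <= W x)%E by apply: nneseries_ge0 => k _ _; rewrite lee_fin.
have IW : mu.-integrable [set: T] W.
  apply/integrableP; split.
    by apply: ge0_emeasurable_sum => // k x _ _; rewrite lee_fin.
  under eq_integral do rewrite gee0_abs//.
  rewrite integral_nneseries//; last by move=> k x _; rewrite lee_fin.
  apply: (@le_lt_trans _ _ C%:E); last exact: ltry.
  apply: lime_le.
    by apply: is_cvg_nneseries => k _ _; apply: integral_ge0 => x _; rewrite lee_fin.
  apply: nearW => n; rewrite big_mkord.
  under eq_bigr do rewrite Rint_EFin//.
  by rewrite sumEFin lee_fin.
have aeW := integrable_ae measurableT IW.
have Ifine : intg (fun x => fine (W x)).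
  apply: le_integrable (IW) => //.
    apply/measurable_EFinP; apply: measurableT_comp => //.
    exact: (measurable_int _ IW).
  by move=> x _ /=; case: (W x) (W0 x) => [r _|_|]//=; rewrite leey.
exists (fun x => fine (W x)); split => //; first by move=> x; exact: fine_ge0.
apply: filterS aeW => x /(_ I) Wx n.
rewrite -lee_fin fineK// -sumEFin -(big_mkord xpredT (fun k => (u k x)%:E)).
by apply: nneseries_lim_ge => k _ _; rewrite lee_fin.
Qed.

Lemma integrable_weight (a : nat -> T -> R) : (forall k, intg (a k)) ->
  exists w : T -> R, [/\ intg w, forall x, 0 <= w x &
    {ae mu, forall x n, w x = 0 -> a n x = 0}].
Proof.
(* These positive factors make the integrals of [c k * |a k|] summable with total at most [1]; their
   sum is the weight. *)
move=> Ia; pose c k := 2^-1 ^+ k.+1 / (1 + \int[mu]_x `|a k x|).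
have I0 k : 0 <= \int[mu]_x `|a k x| by exact: Rintegral_ge0.
have c0 k : 0 < c k.
  by rewrite divr_gt0 ?exprn_gt0 ?invr_gt0 ?ltr0n// ltr_pwDl.
have [|||w [Iw w0 wP]] := @beppo_levi (fun k x => c k * `|a k x|) 1.
- by move=> k; apply: intgZ; exact: intg_norm.
- by move=> k x; rewrite mulr_ge0// ltW.
- move=> n; apply: (@le_trans _ _ (\sum_(k < n) 2^-1 ^+ k.+1)).
    apply: ler_sum => k _; rewrite RintZ//; last exact: intg_norm.
    rewrite -mulrA ler_piMr ?exprn_ge0 ?invr_ge0// ler_pdivrMl ?ltr_pwDl//.
    by rewrite mulr1 lerDr.
  suff -> : \sum_(k < n) 2^-1 ^+ k.+1 = 1 - 2^-1 ^+ n :> R.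
    by rewrite gerBl exprn_ge0// invr_ge0.
  elim: n => [|n IH]; first by rewrite big_ord0 expr0 subrr.
  by rewrite big_ord_recr/= IH exprS; lra.
exists w; split => //; apply: filterS wP => x wx n w0x.
have := wx n.+1; rewrite w0x big_ord_recr/= => le0.
have s0 : 0 <= \sum_(k < n) c k * `|a k x|.
  by apply: sumr_ge0 => k _; rewrite mulr_ge0// ltW.
have : c n * `|a n x| <= 0 by lra.
by rewrite pmulr_rle0// normr_le0 => /eqP.
Qed.

End weights.

(** * Uniform integrability of the support functions *)

Section scalar_weak_compactness.
Context d (T : measurableType d) (R : realType) (X : completeNormedModType R).
Variables (mu : {measure set T -> \bar R}) (G : T -> set X).
Hypothesis cwkG : forall x, cwk (G x).
Hypothesis iG : scalarly_integrable mu G.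
Hypothesis wcG : weakly_compact_op (supp_op iG).
Implicit Types (y z : dual X).

Local Notation intg f := (mu.-integrable [set: T] (EFin \o f)).

Lemma supp_gliding_hump (y : nat -> dual X) (M e : R) (B : nat -> set T) :
    (forall k, bounded_by M (y k)) -> (forall k, measurable (B k)) ->
    (forall i j x, B i x -> B j x -> i = j) -> 0 < e ->
    (forall k, e <= \int[mu]_(x in B k) `|supp (y k) (G x)|) ->
  False.
Proof.
move=> yM mB dB e0 eB.
pose K := [set f : dual X | dual_norm f <= Num.max M 0].
apply: (@gliding_hump _ _ _ mu (supp_op iG @` K) (fun k => supp_op iG (y k)) B e) => //.
- by apply: wcG; exists (Num.max M 0).
- move=> k; exists (y k) => //; apply: dual_norm_le; first by rewrite le_max lexx orbT.
  by apply: bounded_byS (yM k); rewrite le_max lexx.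
- move=> k; apply: le_trans (eB k) _; rewrite le_eqVlt; apply/orP; left; apply/eqP.
  apply: Rint_ae_eq => //; first exact: intg_norm (iG (y k)).
    exact/intg_norm/L1fun_intg.
  by apply: filterS (L1fun_toL1 (iG (y k))) => x -> _.
Qed.

Let b y x := `|supp y (G x)| + `|supp (- y) (G x)|.

Let Ib y : intg (b y).
Proof. by apply: intgD; exact: intg_norm. Qed.

(** A Vitali convergence theorem. Integrals that stay large would put mass of the bound on sets
    [E k] that eventually leave almost every point, and differences of these sets form a forbidden
    gliding hump. *)
Lemma integral_vanishing (A : set T) (y : nat -> dual X) (M : R) (v : nat -> T -> R) :
    measurable A -> (forall k, bounded_by M (y k)) -> (forall k, intg (v k)) ->
    (forall k x, `|v k x| <= `|supp (y k) (G x)| + `|supp (- y k) (G x)|) ->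
    {ae mu, forall x, A x -> v k x @[k --> \oo] --> 0} ->
  \int[mu]_(x in A) v k x @[k --> \oo] --> 0.
Proof.
move=> mA yM Iv vb v0.
have [w [Iw w0 wP]] := integrable_weight Iv.
apply/cvgrPdist_le => e e0.
pose C := \int[mu]_x w x; have C0 : 0 <= C by exact: Rintegral_ge0.
(* Chosen so that [h * w] has integral at most [e / 2]; off [E k] the function [|v k|] is below
   [h * w] on [A]. *)
pose h := e / 2 / (1 + C); have h0 : 0 < h by rewrite !divr_gt0 ?ltr_pwDl.
pose E n := A `&` \bigcup_(j in [set j | (n <= j)%N]) [set x | h * w x < `|v j x|].
have mE n : measurable (E n).
  apply: measurableI => //; apply: bigcup_measurable => j _.
  have := measurable_fun_ltr (measurable_funM (measurable_cst h) (intg_measurable Iw))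
    (intg_measurable (intg_norm (Iv j))).
  by move=> /(_ measurableT [set true]); rewrite setTI; apply.
have Edec m n : (m <= n)%N -> E n `<=` E m.
  by move=> mn x [Ax [j /= nj hj]]; split => //; exists j => //=; exact: leq_trans nj.
have E0 : {ae mu, forall x, \forall n \near \oo, ~ E n x}.
  apply: filterS2 v0 wP => x vx wx.
  have [Ax|nAx] := pselect (A x); last by apply: nearW => n [].
  have [wx0|wx0] := eqVneq (w x) 0.
    by apply: nearW => n [_ [j _]] /=; rewrite wx0 wx// normr0 mulr0 ltxx.
  have hw : 0 < h * w x by rewrite mulr_gt0// lt_neqAle eq_sym wx0 w0.
  have /cvgr0Pnorm_le/(_ _ hw)[n _ nP] := vx Ax.
  exists n => // m /= nm [_ [j /= mj]].
  by rewrite ltNge nP//=; exact: leq_trans mj.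
have bad k : e < `|\int[mu]_(x in A) v k x| -> e / 2 <= \int[mu]_(x in E k) b (y k) x.
  move=> ek; have EA : E k `<=` A by move=> x [].
  have mAE : measurable (A `\` E k) by exact: measurableD.
  have : \int[mu]_(x in A) `|v k x| =
      \int[mu]_(x in E k) `|v k x| + \int[mu]_(x in A `\` E k) `|v k x|.
    by apply: Rint_setD => //; exact: intg_norm.
  have : `|\int[mu]_(x in A) v k x| <= \int[mu]_(x in A) `|v k x|.
    by apply: Rint_norm_le => //; exact: intg_norm.
  have : \int[mu]_(x in E k) `|v k x| <= \int[mu]_(x in E k) b (y k) x.
    apply: Rint_le => //; exact: intg_norm.
  have : \int[mu]_(x in A `\` E k) `|v k x| <= e / 2.
    apply: (@le_trans _ _ (\int[mu]_(x in A `\` E k) (h * w x))).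
      apply: Rint_le => //; [exact: intg_norm|exact: intgZ|].
      move=> x [Ax nE]; rewrite leNgt; apply/negP => hv; apply: nE; split => //.
      by exists k => //=.
    apply: (@le_trans _ _ (h * C)).
      rewrite RintZ// ler_pM2l//; exact: Rint_subset.
    by rewrite /h -mulrA ler_piMr ?divr_ge0 ?(ltW e0)// ler_pdivrMl ?ltr_pwDl// mulr1 lerDr.
  by move: ek; lra.
apply: contrapT => nev.
have ex n : exists k, (n < k)%N /\ e < `|\int[mu]_(x in A) v k x|.
  apply: contrapT => nk; apply: nev; exists n.+1 => // k /= nlek.
  rewrite sub0r normrN leNgt; apply/negP => ek; apply: nk.
  by exists k.
have Ecvg k : \int[mu]_(x in E n) b (y k) x @[n --> \oo] --> 0.
  exact: Rint_decreasing.
have /choice[nx nxP] : forall k, exists k', [/\ (k < k')%N,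
    e < `|\int[mu]_(x in A) v k' x| & \int[mu]_(x in E k') b (y k) x <= e / 4].
  move=> k; have /cvgr_le Ek := Ecvg k.
  have [|n _ nP] := Ek (e / 4); first by rewrite divr_gt0.
  have [k' [kk' ek']] := ex (maxn k n); exists k'; split => //.
    by apply: leq_ltn_trans kk'; exact: leq_maxl.
  by apply: nP => /=; apply: ltnW; apply: leq_ltn_trans kk'; exact: leq_maxr.
(* The start is [nx 0] rather than [0], because only values of [nx] are known to have a large
   integral. *)
pose kk := fix kk j := if j is i.+1 then nx (kk i) else nx 0%N.
have kk_bad j : e < `|\int[mu]_(x in A) v (kk j) x| by case: j => [|j]; [case: (nxP 0%N)|case: (nxP (kk j))].
have kkmono i j : (i <= j)%N -> (kk i <= kk j)%N.
  move=> /subnK <-; elim: (j - i)%N => // n IH; apply: (leq_trans IH).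
  by rewrite addSn /=; apply: ltnW; case: (nxP (kk (n + i)%N)).
pose B j := E (kk j) `\` E (kk j.+1).
have mB j : measurable (B j) by exact: measurableD.
have bB j : e / 4 <= \int[mu]_(x in B j) b (y (kk j)) x.
  have := Rint_setD (mE (kk j)) (mE (kk j.+1)) (Edec _ _ (kkmono _ _ (leqnSn j))) (Ib (y (kk j))).
  have := bad _ (kk_bad j); have [_ _] := nxP (kk j); rewrite -/(kk j.+1) /B.
  by lra.
(* The bound is a sum over [y] and [- y], so one of the two carries half of [e / 4]. *)
have /choice[z zP] : forall j, exists z, bounded_by M z /\
    e / 8 <= \int[mu]_(x in B j) `|supp z (G x)|.
  move=> j; have := bB j; rewrite RintD//; [|exact: intg_norm|exact: intg_norm].
  have [le1|lt1] := leP (e / 8) (\int[mu]_(x in B j) `|supp (y (kk j)) (G x)|).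
    by exists (y (kk j)).
  move=> le2; exists (- y (kk j)); split; first exact: bounded_byN.
  by move: le2 lt1; lra.
apply: (@supp_gliding_hump z M (e / 8) B) => //.
- by move=> k; exact: (zP k).1.
- have dis i j x : (i < j)%N -> B i x -> B j x -> False.
    by move=> ij [_ nE] [Ej _]; apply: nE; exact: Edec (kkmono _ _ ij) _ Ej.
  by move=> i j x Bi Bj; case: (ltngtP i j) => // ij; exfalso; [exact: dis ij Bi Bj|exact: dis ij Bj Bi].
- by rewrite divr_gt0.
- by move=> k; exact: (zP k).2.
Qed.

Let S (l : seq (dual X)) := \big[setU/set0]_(f <- l) [set x | supp f (G x) != 0].

Let mS l : measurable (S l).
Proof.
apply: bigsetU_measurable => f _.
have -> : [set x | supp f (G x) != 0] = ~` ((fun x => supp f (G x)) @^-1` [set 0]).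
  by apply/seteqP; split=> x /= /eqP.
apply: measurableC; rewrite -[X in measurable X]setTI.
exact: (intg_measurable (iG f)).
Qed.

(** Otherwise functionals are added one at a time, each with mass above [e] where all the earlier
    support functions vanish; these disjoint increments contradict [supp_gliding_hump]. *)
Let small_outside (e : R) : 0 < e -> exists l, forall z, bounded_by 1 z ->
  \int[mu]_(x in ~` S l) `|supp z (G x)| <= e.
Proof.
move=> e0; apply: contrapT => nl.
have /choice[nx nxP] : forall l, exists z : dual X, bounded_by 1 z /\
    e < \int[mu]_(x in ~` S l) `|supp z (G x)|.
  move=> l; apply: contrapT => nz; apply: nl; exists l => z z1.
  by rewrite leNgt; apply/negP => ez; apply: nz; exists z.
pose l := fix l n := if n is m.+1 then nx (l m) :: l m else [::].
have lS n : S (l n.+1) = [set x | supp (nx (l n)) (G x) != 0] `|` S (l n).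
  by rewrite /S /= big_cons.
have lmono m n : (m <= n)%N -> S (l m) `<=` S (l n).
  move=> /subnK <-; elim: (n - m)%N => // k IH x /IH.
  by rewrite addSn lS; right.
pose D n := S (l n.+1) `\` S (l n).
apply: (@supp_gliding_hump (fun n => nx (l n)) 1 e D) => //.
- by move=> n; exact: (nxP (l n)).1.
- by move=> n; exact: measurableD.
- have dis i j x : (i < j)%N -> D i x -> D j x -> False.
    by move=> ij [Si _] [_ nS]; apply: nS; exact: lmono ij _ Si.
  by move=> i j x Bi Bj; case: (ltngtP i j) => // ij; exfalso; [exact: dis ij Bi Bj|exact: dis ij Bj Bi].
- move=> n; apply: ltW; apply: lt_le_trans (nxP (l n)).2 _.
  rewrite le_eqVlt; apply/orP; left; apply/eqP.
  rewrite Rintegral_mkcond [RHS]Rintegral_mkcond; apply: eq_Rintegral => x _.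
  rewrite !patchE; case: ifPn => [/set_mem Sx|/negP Sx]; last first.
    by rewrite memNset// => -[_ nS]; apply: Sx; exact: mem_set.
  case: ifPn => // /negP Dx; apply/normr0P/eqP; apply: contrapT => sx; apply: Dx.
  by apply: mem_set; split => //; rewrite lS; left => /=; exact/eqP.
Qed.

Lemma widthZ (t : R) y A : cwk A -> 0 < t -> width (t *: y) A = t * width y A.
Proof.
move=> cA t0.
have le s z : 0 < s -> supp (s *: z) A <= s * supp z A.
  move=> s0; apply: supp_le => // x Ax; rewrite dual_scaleE ler_pM2l//.
  exact: le_supp.
have E z : supp (t *: z) A = t * supp z A.
  apply/eqP; rewrite eq_le le//=; have := le t^-1 (t *: z).
  by rewrite scalerA mulVf ?gt_eqF// scale1r invr_gt0 ler_pdivlMl//; exact.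
by rewrite /width -scalerN !E mulrDr.
Qed.

(** By [small_outside] countably many functionals suffice: where all their support functions vanish,
    every other one vanishes almost everywhere. The weight is built from these functionals. *)
Lemma supp_weight : exists w : T -> R, [/\ intg w, forall x, 0 <= w x &
  forall y, {ae mu, forall x, w x = 0 -> width y (G x) = 0}].
Proof.
have /choice[l lP] : forall n, exists l, forall z, bounded_by 1 z ->
    \int[mu]_(x in ~` S l) `|supp z (G x)| <= n.+1%:R^-1.
  by move=> n; apply: small_outside; rewrite invr_gt0 ltr0n.
have [|w [Iw w0 wP]] := @integrable_weight _ _ _ mu
    (fun n x => \sum_(f <- l n) `|supp f (G x)|).
  by move=> n; apply: intg_sum => f; exact: intg_norm (iG f).
exists w; split => // y.
pose Z := \bigcap_n ~` S (l n).
have mZ : measurable Z by apply: bigcapT_measurable => n; exact: measurableC.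
have aeZ z : bounded_by 1 z -> {ae mu, forall x, Z x -> `|supp z (G x)| = 0}.
  move=> z1; apply: Rint_eq0_ae => //; first exact: intg_norm (iG z).
  apply/eqP; rewrite eq_le Rintegral_ge0// andbT; apply/ler_addgt0Pr => e e0; rewrite add0r.
  have n_e : (Num.trunc e^-1).+1%:R^-1 < e by rewrite invf_plt ?posrE// truncnS_gt.
  apply: le_trans (ltW n_e); apply: le_trans (lP _ z z1).
  apply: Rint_subset => //; [exact: measurableC|by move=> x; exact|exact: intg_norm (iG z)].
have [M M0 yM] := dual_bounded_by y.
pose z := (M + 1)^-1 *: y.
have M1 : 0 < M + 1 by rewrite ltr_wpDl.
have z1 : bounded_by 1 z.
  move=> x; rewrite dual_scaleE normrM gtr0_norm ?invr_gt0// ler_pdivrMl// mul1r.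
  by apply: le_trans (yM x) _; rewrite ler_wpM2r// lerDl.
apply: filterS3 wP (aeZ z z1) (aeZ (- z) (bounded_byN z1)) => x wx zx nzx w0x.
have Zx : Z x.
  move=> n _ Sx; have := wx n w0x; apply/eqP; rewrite gt_eqF//.
  have [f fl fx] : exists2 f, f \in l n & supp f (G x) != 0.
    by move: Sx; rewrite /S -bigcup_seq => -[f /= fl fx]; exists f.
  rewrite (big_rem f fl)/= ltr_pwDl ?normr_gt0//.
  by apply: sumr_ge0.
have yE : y = (M + 1) *: z by rewrite /z scalerA mulfV ?gt_eqF// scale1r.
rewrite yE widthZ// /width.
by have /eqP := zx Zx; have /eqP := nzx Zx; rewrite !normr_eq0 => /eqP -> /eqP ->; rewrite addr0 mulr0.
Qed.

End scalar_weak_compactness.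

(** * Almost everywhere convergent convex blocks *)

Section convex_blocks.
Context (R : realType).
Implicit Types (p q : {poly R}).

(* A polynomial encodes a finitely supported family of coefficients. *)
Definition pcomb (W : lmodType R) (z : nat -> W) p : W :=
  \sum_(i < size p) p`_i *: z i.

Lemma pcombE (W : lmodType R) (z : nat -> W) p n : (size p <= n)%N ->
  pcomb z p = \sum_(i < n) p`_i *: z i.
Proof.
move=> pn; rewrite /pcomb -!(big_mkord xpredT (fun i => p`_i *: z i)).
rewrite [RHS](big_cat_nat _ pn)//= [X in _ = _ + X]big1_seq ?addr0// => i /andP[_].
by rewrite mem_index_iota => /andP[pi _]; rewrite nth_default// scale0r.
Qed.

Lemma pcombD (W : lmodType R) (z : nat -> W) p q :
  pcomb z (p + q) = pcomb z p + pcomb z q.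
Proof.
pose n := maxn (size p) (size q).
rewrite !(@pcombE _ _ _ n) ?leq_maxl ?leq_maxr//; last exact: size_polyD.
by rewrite -big_split/=; apply: eq_bigr => i _; rewrite coefD scalerDl.
Qed.

Lemma pcombZ (W : lmodType R) (z : nat -> W) (a : R) p :
  pcomb z (a *: p) = a *: pcomb z p.
Proof.
rewrite (pcombE _ (size_scale_leq a p)) /pcomb scaler_sumr.
by apply: eq_bigr => i _; rewrite coefZ scalerA.
Qed.

Lemma pcombB (W : lmodType R) (z : nat -> W) p q :
  pcomb z (p - q) = pcomb z p - pcomb z q.
Proof. by rewrite pcombD -[- q]scaleN1r pcombZ scaleN1r. Qed.

Lemma pcombXn (W : lmodType R) (z : nat -> W) n : pcomb z 'X^n = z n.
Proof.
rewrite /pcomb size_polyXn big_ord_recr/= coefXn eqxx scale1r big1 ?add0r// => i _.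
by rewrite coefXn ltn_eqF// scale0r.
Qed.

Lemma pcomb_dual (V : normedModType R) (f : nat -> dual V) p x :
  pcomb f p x = pcomb (fun i => f i x : R^o) p.
Proof. by rewrite dual_sumE; apply: eq_bigr => i _; rewrite dual_scaleE. Qed.

Lemma dual_pcomb (V : normedModType R) (f : dual V) (x : nat -> V) p :
  f (pcomb x p) = pcomb (fun i => f (x i) : R^o) p.
Proof. by rewrite dual_sum; apply: eq_bigr => i _; rewrite dualZ. Qed.

Definition convex_block k p := [/\ forall i, 0 <= p`_i,
  forall i, (i < k)%N -> p`_i = 0 & pcomb (fun=> 1 : R^o) p = 1].

Lemma convex_blockXn k : convex_block k 'X^k.
Proof.
split=> [i|i ik|]; last exact: pcombXn.
  by rewrite coefXn; case: eqP => _; rewrite ?ler01.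
by rewrite coefXn ltn_eqF.
Qed.

Lemma convex_blockS j k p : (j <= k)%N -> convex_block k p -> convex_block j p.
Proof. by move=> jk [p0 pk p1]; split => // i ij; apply: pk; exact: leq_trans jk. Qed.

Lemma convex_block_mid k p q : convex_block k p -> convex_block k q ->
  convex_block k (2^-1 *: (p + q)).
Proof.
move=> [p0 pk p1] [q0 qk q1]; split=> [i|i ik|].
- by rewrite coefZ coefD mulr_ge0 ?invr_ge0 ?addr_ge0.
- by rewrite coefZ coefD pk// qk// addr0 mulr0.
- rewrite pcombZ pcombD p1 q1 /GRing.scale/=; lra.
Qed.

Lemma pcomb_convex (z w : nat -> R^o) k p : convex_block k p ->
  (forall i, (k <= i)%N -> z i <= w i) -> pcomb z p <= pcomb w p.
Proof.
move=> [p0 pk _] zw; apply: ler_sum => i _.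
have [ki|ik] := leqP k i; first exact: ler_wpM2l (zw _ ki).
by rewrite pk// !scale0r.
Qed.

Lemma pcomb_ge (c : R) (z : nat -> R^o) k p : convex_block k p ->
  (forall i, (k <= i)%N -> c <= z i) -> c <= pcomb z p.
Proof.
move=> kp cz; have [_ _ p1] := kp.
have <- : pcomb (fun=> c : R^o) p = c.
  rewrite -[RHS]mulr1 -[in RHS]p1 /pcomb mulr_sumr.
  by apply: eq_bigr => i _; rewrite [RHS]mulrC /GRing.scale/= mulr1.
exact: pcomb_convex kp cz.
Qed.

Lemma pcombN (W : lmodType R) (z : nat -> W) p : pcomb (fun i => - z i) p = - pcomb z p.
Proof. by rewrite /pcomb -sumrN; apply: eq_bigr => i _; rewrite scalerN. Qed.

Lemma pcomb_le (c : R) (z : nat -> R^o) k p : convex_block k p ->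
  (forall i, (k <= i)%N -> z i <= c) -> pcomb z p <= c.
Proof.
move=> kp cz; rewrite -lerN2 -pcombN; apply: pcomb_ge kp _ => i ki.
by rewrite lerN2 cz.
Qed.

Lemma pcomb_norm_le (c : R) (z : nat -> R^o) k p : convex_block k p ->
  (forall i, (k <= i)%N -> `|z i| <= c) -> `|pcomb z p| <= c.
Proof.
move=> kp cz; rewrite ler_norml (pcomb_ge kp) ?(pcomb_le kp)// => i /cz.
  by rewrite ler_norml => /andP[].
by rewrite ler_norml => /andP[].
Qed.

(* A minimising sequence of a quadratic functional along decreasing midpoint
   convex sets is Cauchy, by the parallelogram law. *)
Lemma minimizing_blocks (V : lmodType R) (D : nat -> set V) (Q : V -> R) (C : R)
    (e : nat -> R) :
    (forall k, D k.+1 `<=` D k) ->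
    (forall k u v, D k u -> D k v -> D k (2^-1 *: (u + v))) ->
    (forall u, 0 <= Q u) ->
    (forall u v, Q (u + v) + Q (u - v) = 2 * Q u + 2 * Q v) ->
    (forall k, exists2 u, D k u & Q u <= C) ->
    (forall k, 0 < e k) -> (forall k, e k.+1 <= e k) ->
  exists v : nat -> V, (forall k, D k (v k)) /\ forall k, Q (v k.+1 - v k) <= e k.
Proof.
move=> dD mD Q0 Qpar DC e0 de.
have DS j k : (j <= k)%N -> D k `<=` D j.
  by move=> /subnK <-; elim: (k - j)%N => // n IH u; rewrite addSn => /dD; exact: IH.
have Qz : Q 0 = 0 by have := Qpar 0 0; rewrite addr0 subr0; lra.
have Q2 u : Q (2 *: u) = 4 * Q u.
  have -> : 2 *: u = u + u by rewrite scaler_nat mulr2n.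
  by have := Qpar u u; rewrite subrr Qz; lra.
pose m k := inf [set Q u | u in D k].
have lb k : has_lbound [set Q u | u in D k] by exists 0 => _ [u _ <-].
have ne k : [set Q u | u in D k] !=set0.
  by have [u Du _] := DC k; exists (Q u), u.
have mQ k u : D k u -> m k <= Q u by move=> Du; apply: ge_inf => //; exists u.
have mono : nondecreasing_seq m.
  apply/nondecreasing_seqP => k; apply: lb_le_inf => // _ [u Du <-].
  exact/mQ/dD.
have mC : has_ubound (range m).
  by exists C => _ [k _ <-]; have [u Du uC] := DC k; exact: le_trans (mQ _ _ Du) uC.
have cm := nondecreasing_cvgn mono mC; set l := sup _ in cm.
have ml k : m k <= l by apply: ub_le_sup => //; exists k.
have /choice[K KP] : forall k, exists n, (k <= n)%N /\ forall j, (n <= j)%N -> l - e k / 16 <= m j.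
  move=> k; have /cvgr_ge/(_ (l - e k / 16))[] := cm.
    by rewrite ltrBlDr ltrDl divr_gt0.
  move=> n _ nP; exists (maxn k n); split; first exact: leq_maxl.
  by move=> j nj; apply: nP => /=; apply: leq_trans nj; exact: leq_maxr.
have /choice[v vP] : forall k, exists u, D (K k) u /\ Q u <= l + e k / 16.
  move=> k; have [_ [u Du <-] uQ] := inf_adherent (divr_gt0 (e0 k) (ltr0n R 16)) (conj (ne (K k)) (lb _)).
  by exists u; split => //; apply: le_trans (ltW uQ) _; rewrite lerD2r; exact: ml.
exists v; split=> k; first exact: DS (KP k).1 _ (vP k).1.
(* [K] need not be monotone, so the midpoint is placed in the larger of the two sets; its infimum is
   still at least [l - e k / 16]. *)
pose n := minn (K k) (K k.+1).
have Dn : D n (2^-1 *: (v k + v k.+1)).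
  apply: mD; first exact: DS (geq_minl _ _) _ (vP k).1.
  exact: DS (geq_minr _ _) _ (vP k.+1).1.
have mn : l - e k / 16 <= m n.
  rewrite /n; have [_|_] := leqP (K k) (K k.+1); first exact: (KP k).2.
  by apply: le_trans ((KP k.+1).2 _ (leqnn _)); have := de k; lra.
have := mQ _ _ Dn; have := Q2 (2^-1 *: (v k + v k.+1)).
rewrite scalerA mulfV ?scale1r; last by lra.
have := Qpar (v k.+1) (v k); rewrite [v k.+1 + v k]addrC.
have := (vP k).2; have := (vP k.+1).2; have := de k; have := e0 k.
by lra.
Qed.

End convex_blocks.

(** * Convex blocks converging almost everywhere, for countably many sequences at once *)

Section convex_blocks_ae.
Context d (T : measurableType d) (R : realType) (mu : {measure set T -> \bar R}).

Local Notation intg f := (mu.-integrable [set: T] (EFin \o f)).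

Lemma sum_half_le (n : nat) : \sum_(k < n) (2^-1 : R) ^+ k <= 2.
Proof.
suff -> : \sum_(k < n) (2^-1 : R) ^+ k = 2 - 2 * 2^-1 ^+ n.
  by rewrite gerBl mulr_ge0// exprn_ge0.
elim: n => [|n IH]; first by rewrite big_ord0 expr0 mulr1 subrr.
by rewrite big_ord_recr/= IH exprS; lra.
Qed.

(** A weighted sum over [n] of squared weighted [L^2] norms is one quadratic functional for all
    sequences. [minimizing_blocks] makes its increments decay geometrically, and Beppo Levi turns
    this into absolute summability at almost every point. *)
Lemma convex_blocks_cvg (a : nat -> nat -> T -> R) :
    (forall k n, intg (a k n)) ->
    (forall n x, exists M, forall k, `|a k n x| <= M) ->
  exists p : nat -> {poly R}, (forall k, convex_block k (p k)) /\
    {ae mu, forall x n, cvgn (fun k => pcomb (fun i => a i n x : R^o) (p k))}.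
Proof.
move=> Ia aM.
have /choice[w wP] := fun n => integrable_weight (fun k => Ia k n).
have Iw n : intg (w n) by case: (wP n).
have w0 n x : 0 <= w n x by case: (wP n).
pose r n x := sups (fun k => `|a k n x|) 0.
have ub n x : has_ubound (range (fun k => `|a k n x|)).
  by have [M aMx] := aM n x; exists M => _ [k _ <-].
have ar k n x : `|a k n x| <= r n x.
  apply: ub_le_sup; last by exists k.
  by have [M Mub] := ub n x; exists M => _ [j _ <-]; apply: Mub; exists j.
have r0 n x : 0 <= r n x by exact: le_trans (ar 0%N n x).
have mr n : measurable_fun [set: T] (r n).
  apply: measurable_fun_sups => [x _|k]; first exact: ub.
  exact: intg_measurable (intg_norm (Ia k n)).
(* Since [r n] bounds all [a k n], this density keeps the square of each fixed combination below a
   multiple of the integrable [w n]. *)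
pose h n x := w n x * (1 + r n x)^-1 ^+ 2.
have r1 n x : 0 < 1 + r n x by rewrite ltr_pwDl.
have h0 n x : 0 <= h n x by rewrite mulr_ge0// exprn_ge0// invr_ge0 ltW.
have mh n : measurable_fun [set: T] (h n).
  apply: measurable_funM; first exact: intg_measurable (Iw n).
  apply: measurable_funX; have -> : (fun x => (1 + r n x)^-1) =
      (fun t : R => (1 + `|t|)^-1) \o r n.
    by apply: funext => x /=; rewrite ger0_norm.
  apply: measurableT_comp => //; apply: continuous_measurable_fun => t.
  apply: cvgV; first by rewrite gt_eqF// ltr_pwDl.
  by apply: cvgD; [exact: cvg_cst|exact: norm_continuous].
pose ev n (p : {poly R}) x := pcomb (fun i => a i n x : R^o) p.
have mev n p : measurable_fun [set: T] (ev n p).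
  apply: measurable_sum => i; apply: measurable_funM => //.
  exact: intg_measurable (Ia i n).
pose S (p : {poly R}) := \sum_(i < size p) `|p`_i|.
have S0 p : 0 <= S p by exact: sumr_ge0.
have evS n p x : `|ev n p x| <= S p * r n x.
  rewrite /ev /pcomb (le_trans (ler_norm_sum _ _ _))// /S mulr_suml.
  by apply: ler_sum => i _; rewrite normrM ler_wpM2l.
have evC n k p x : convex_block k p -> `|ev n p x| <= r n x.
  by move=> kp; apply: pcomb_norm_le kp _ => i _.
have hev n p x (c : R) : 0 <= c -> `|ev n p x| <= c * r n x ->
    h n x * ev n p x ^+ 2 <= c ^+ 2 * w n x.
  move=> c0 evc; rewrite /h mulrAC -mulrA -exprMn mulrC ler_wpM2r//.
  rewrite -ler_sqrt ?exprn_ge0// !sqrtr_sqr normrM normfV.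
  rewrite (ger0_norm (ltW (r1 n x))) (ger0_norm c0) ler_pdivrMr//.
  by rewrite (le_trans evc)// mulrDr mulr1 lerDr.
pose f n p x := h n x * ev n p x ^+ 2.
have f0 n p x : 0 <= f n p x by rewrite mulr_ge0// sqr_ge0.
have If n p : intg (f n p).
  apply: (intg_le (g := fun x => S p ^+ 2 * w n x)); last exact: intgZ.
    by apply: measurable_funM => //; exact: measurable_funX.
  move=> x; rewrite ger0_norm// ger0_norm ?mulr_ge0// ?sqr_ge0//.
  exact: hev.
pose q n p := \int[mu]_x f n p x.
have q0 n p : 0 <= q n p by exact: Rintegral_ge0.
have qpar n p p' : q n (p + p') + q n (p - p') = (q n p + q n p) + (q n p' + q n p').
  rewrite -!RintD//; [|exact: intgD|exact: intgD].
  apply: eq_Rintegral => x _; rewrite /f /ev pcombD pcombB.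
  by move: (pcomb _ p) (pcomb _ p') => u v; rewrite sqrrD sqrrB; lra.
have Iw0 n : 0 <= \int[mu]_x w n x by exact: Rintegral_ge0.
(* The factors make the series over [n] converge for every polynomial and bound it by [1] on single
   terms. *)
pose c n := 2^-1 ^+ n.+1 / (1 + \int[mu]_x w n x).
have c0 n : 0 < c n by rewrite divr_gt0 ?exprn_gt0 ?invr_gt0// ltr_pwDl.
have cq n p (s : R) : 0 <= s -> (forall x, `|ev n p x| <= s * r n x) ->
    c n * q n p <= s ^+ 2 * 2^-1 ^+ n.+1.
  move=> s0 evs; have : q n p <= s ^+ 2 * \int[mu]_x w n x.
    by rewrite -RintZ//; apply: Rint_le => //; [exact: intgZ|move=> x _; exact: hev].
  move=> qs; rewrite /c mulrAC ler_pdivrMr ?ltr_pwDl// [leRHS]mulrAC [leLHS]mulrC.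
  rewrite ler_wpM2r ?exprn_ge0 ?invr_ge0//; apply: le_trans qs _.
  by rewrite ler_wpM2l ?sqr_ge0// lerDr.
pose u p n := c n * q n p.
have u0 p n : 0 <= u p n by rewrite mulr_ge0// ltW.
have cu p : cvgn (series (u p)).
  apply: (@series_le_cvg _ _ (geometric (S p ^+ 2 / 2) 2^-1)) => // [n|n|].
  - by rewrite geometric_ge0// divr_ge0// sqr_ge0.
  - by rewrite /= -mulrA -exprS; exact: cq.
  - by apply: is_cvg_geometric_series; rewrite ger0_norm// invf_lt1// ltr1n.
have nd p : nondecreasing_seq (series (u p)).
  by apply/nondecreasing_seqP => n; rewrite /series/= big_nat_recr//= lerDl.
pose Q p := limn (series (u p)).
have uQ p n : u p n <= Q p.
  apply: le_trans (nondecreasing_cvgn_le (nd p) (cu p) n.+1).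
  by rewrite /series/= big_nat_recr//= lerDr sumr_ge0.
have Q0 p : 0 <= Q p by exact: le_trans (uQ p 0%N).
have Qpar p p' : Q (p + p') + Q (p - p') = 2 * Q p + 2 * Q p'.
  have H1 : series (u (p + p')) + series (u (p - p')) @ \oo --> Q (p + p') + Q (p - p').
    by apply: cvgD; exact: cu.
  have H2 : (series (u p) + series (u p)) + (series (u p') + series (u p')) @ \oo -->
      (Q p + Q p) + (Q p' + Q p').
    by apply: cvgD; apply: cvgD; exact: cu.
  have : Q (p + p') + Q (p - p') = (Q p + Q p) + (Q p' + Q p').
    have E : series (u (p + p')) + series (u (p - p')) =
      (series (u p) + series (u p)) + (series (u p') + series (u p')).
      apply: funext => n; rewrite -[LHS]/(series _ n + series _ n).
      rewrite -[RHS]/((series _ n + series _ n) + (series _ n + series _ n)).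
      rewrite /series/= -!big_split/=; apply: eq_bigr => i _.
      by rewrite /u -!mulrDr qpar.
    have := cvg_lim (@Rhausdorff R) H1.
    by rewrite E (cvg_lim (@Rhausdorff R) H2) => ->.
  by lra.
have QX k : Q 'X^k <= 1.
  apply: limr_le; first exact: cu.
  apply: nearW => n; rewrite /series/= big_mkord.
  apply: (@le_trans _ _ (2^-1 * \sum_(i < n) 2^-1 ^+ i)); last by have := sum_half_le n; lra.
  rewrite mulr_sumr; apply: ler_sum => i _; rewrite -exprS.
  have := cq i 'X^k 1 ler01; rewrite expr1n mul1r; apply => x; rewrite mul1r.
  exact: evC (convex_blockXn R k).
have [||k|k|k|v [vD vQ]] := @minimizing_blocks R {poly R}
    (fun k => [set p | convex_block k p]) Q 1 (fun k => 16^-1 ^+ k) _ _ Q0 Qpar.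
- by move=> k p; exact: convex_blockS.
- by move=> k p p'; exact: convex_block_mid.
- by exists 'X^k => //=; exact: convex_blockXn.
- by rewrite exprn_gt0// invr_gt0.
- by rewrite exprS ler_piMl ?exprn_ge0 ?invr_ge0// invf_le1// ler1n.
exists v; split=> //; apply: ae_foralln => n.
have [W [IW W0 WP]] : exists W : T -> R, [/\ intg W, forall x, 0 <= W x &
    {ae mu, forall x m, \sum_(k < m) 2 ^+ k * f n (v k.+1 - v k) x <= W x}].
  (* The increments [16^-1 ^+ k] leave room for the factor [2 ^+ k], which is needed to pass from
     squares to absolute values. *)
  apply: (@beppo_levi _ _ _ mu (fun k x => 2 ^+ k * f n (v k.+1 - v k) x) (2 / c n)).
  - by move=> k; exact: intgZ.
  - by move=> k x; rewrite mulr_ge0// exprn_ge0.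
  - move=> m; rewrite mulrC; apply: (@le_trans _ _ ((c n)^-1 * \sum_(k < m) 2^-1 ^+ k)).
      rewrite mulr_sumr; apply: ler_sum => k _; rewrite RintZ//.
      rewrite ler_pdivlMl// mulrCA.
      apply: (@le_trans _ _ (2 ^+ k * 16^-1 ^+ k)).
        by rewrite ler_wpM2l ?exprn_ge0//; exact: le_trans (uQ _ n) (vQ k).
      rewrite -exprMn lerXn2r ?nnegrE//; lra.
    by rewrite ler_wpM2l ?invr_ge0 ?(ltW (c0 n))// sum_half_le.
have [_ _ wn] := wP n.
apply: filterS2 WP wn => x Wx wx.
have [wx0|wx0] := eqVneq (w n x) 0.
  have -> : (fun k => pcomb (fun i => a i n x : R^o) (v k)) = fun=> 0.
    by apply: funext => k; rewrite /pcomb big1// => i _; rewrite wx// scaler0.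
  exact: is_cvg_cst.
have hx : 0 < h n x.
  by rewrite mulr_gt0 ?exprn_gt0 ?invr_gt0// lt_neqAle eq_sym wx0 w0.
pose D k := ev n (v k.+1) x - ev n (v k) x.
have DE k : D k = ev n (v k.+1 - v k) x by rewrite /ev pcombB.
have Dle k : `|D k| <= 2^-1 ^+ k + (h n x)^-1 * (2 ^+ k * f n (v k.+1 - v k) x).
  have -> : (h n x)^-1 * (2 ^+ k * f n (v k.+1 - v k) x) = 2 ^+ k * D k ^+ 2.
    by rewrite /f -DE mulrCA mulKf// gt_eqF.
  (* Either the increment is below [2^-1 ^+ k], or it is at most [2 ^+ k] times its square. *)
  have [le|lt] := leP `|D k| (2^-1 ^+ k).
    by rewrite (le_trans le)// lerDl mulr_ge0 ?sqr_ge0 ?exprn_ge0//.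
  apply: (@le_trans _ _ (2 ^+ k * D k ^+ 2)); last by rewrite lerDr exprn_ge0 ?invr_ge0//.
  rewrite -[D k ^+ 2]real_normK ?num_real// expr2 mulrA ler_peMl//.
  by rewrite -ler_pdivrMl ?exprn_gt0// mulr1 -exprVn ltW.
have cD : cvgn (series D).
  suff cnD : cvgn (series (fun k => `|D k|)) by exact: normed_cvg.
  apply: nondecreasing_is_cvgn.
    by apply/nondecreasing_seqP => m; rewrite /series/= big_nat_recr//= lerDl.
  exists (2 + (h n x)^-1 * W x) => _ [m _ <-].
  rewrite /series/= big_mkord.
  apply: le_trans (ler_sum _ (fun (k : 'I_m) _ => Dle k)) _; rewrite big_split/=.
  apply: lerD; first exact: sum_half_le.
  by rewrite -mulr_sumr ler_wpM2l ?invr_ge0 ?(ltW hx)//; exact: Wx.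
have -> : (fun k => pcomb (fun i => a i n x : R^o) (v k)) =
    (fun k => ev n (v 0%N) x + series D k).
  by apply: funext => k; exact: (eq_sum_telescope (fun k => ev n (v k) x) k).
by apply: is_cvgD => //; exact: is_cvg_cst.
Qed.

End convex_blocks_ae.

(** * Weak compactness of the integral *)

Section bidual.
Context (R : realType) (X : completeNormedModType R).
Implicit Types (f g : dual X) (x y : X).

(** Weak-star compactness of balls of the dual: pointwise limits stay linear and bounded by [M]. *)
Lemma dual_ultralimit (U : set_system nat) (F : nat -> dual X) (M : R) :
    UltraFilter U -> 0 <= M -> (forall k, bounded_by M (F k)) ->
  exists2 g : dual X, bounded_by M g & forall x, F k x @[k --> U] --> g x.
Proof.
move=> UU M0 FM.
have /choice[l lP] : forall x, exists l : R, F k x @[k --> U] --> l.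
  move=> x; apply: (ultra_bounded_cvg (M := M * `|x|)).
  by apply: (filterS _ filterT) => k _; exact: FM.
have lin : linear l.
  move=> a x y; apply: (cvg_unique _ (lP (a *: x + y))) => //.
  have -> : (fun k => F k (a *: x + y)) = (fun k => a *: (F k x : R^o) + F k y).
    by apply: funext => k; rewrite dualD dualZ.
  by apply: cvgD => //; apply: cvgZl_tmp.
have bl : bounded_by M l.
  move=> x; have ln : `|F k x| @[k --> U] --> `|l x| by apply: cvg_norm.
  apply: (cvgr_to_le ln).
  by apply: (filterS _ filterT) => k _; exact: FM.
have [g gE] := dual_of lin bl; exists g => x; first by rewrite gE.
by rewrite gE.
Qed.

(** Convexity only speaks of two points, so the induction runs over the normalised partial sums,
    starting when their total first becomes positive. *)
Lemma convex_pcomb (A : set X) (z : nat -> X) k p : convex_set (A : set (convex_lmodType X)) ->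
  (forall i, A (z i)) -> convex_block k p -> A (pcomb z p).
Proof.
move=> /convex_setE cA Az [p0 _ p1].
have H n : 0 < \sum_(i < n) p`_i ->
    A ((\sum_(i < n) p`_i)^-1 *: \sum_(i < n) p`_i *: z i).
  elim: n => [|n IH]; first by rewrite big_ord0 ltxx.
  rewrite !big_ord_recr/=; set s := \sum_(i < n) p`_i; set v := \sum_(i < n) _.
  move=> sp; have s0 : 0 <= s by exact: sumr_ge0.
  move: (s0); rewrite le_eqVlt => /predU1P[s_eq0|s_gt0].
    have p_eq0 i : (i < n)%N -> p`_i = 0.
      move=> i_n; have /eqP := esym s_eq0; rewrite psumr_eq0//= => /allP.
      by move=> /(_ (Ordinal i_n) (mem_index_enum _))/eqP.
    have -> : v = 0 by rewrite /v big1// => i _; rewrite p_eq0// scale0r.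
    rewrite -s_eq0 !add0r scalerA mulVf ?scale1r//.
    by move: sp; rewrite -s_eq0 add0r => sp; rewrite gt_eqF.
  have := cA _ (z n) (s / (s + p`_n)) (IH s_gt0) (Az n).
  have sp0 : s + p`_n != 0 by rewrite gt_eqF.
  rewrite divr_ge0 ?(ltW sp)//= ler_pdivrMr// mul1r lerDl => /(_ (p0 n)).
  rewrite scalerA mulrAC mulfV ?gt_eqF// mul1r => AA.
  rewrite scalerDr scalerA; suff -> : (s + p`_n)^-1 * p`_n = 1 - s / (s + p`_n) by [].
  by field.
have := H (size p); rewrite (_ : \sum_(i < _) _ = 1) ?ltr01 ?invr1 ?scale1r; first exact.
by rewrite -[RHS]p1; apply: eq_bigr => i _; rewrite [RHS]mulr1.
Qed.

Definition dual_linear (xi : dual X -> R) :=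
  forall (a : R) f g, xi (a *: f + g) = a * xi f + xi g.

Lemma dual_linear0 xi : dual_linear xi -> xi 0 = 0.
Proof. by move=> lxi; have := lxi 1 0 0; rewrite scale1r addr0; lra. Qed.

Lemma dual_linearZ xi a f : dual_linear xi -> xi (a *: f) = a * xi f.
Proof. by move=> lxi; have := lxi a f 0; rewrite dual_linear0// !addr0. Qed.

(* Helly's theorem, by Hahn-Banach extension one point at a time. *)
Lemma helly (l : seq X) xi (c : R) : dual_linear xi -> 0 <= c ->
    (forall f, (forall x, x \in l -> f x = 0) -> `|xi f| <= c * dual_norm f) ->
  exists x, forall f, `|xi f - f x| <= c * dual_norm f.
Proof.
elim: l xi => [|y l IH] xi lxi c0 H.
  by exists 0 => f; rewrite dual0 subr0; exact: H.
pose N f := forall x, x \in l -> f x = 0.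
(* [t] is the coefficient of [y] in the point sought; after subtracting [t * f y] the estimate holds
   on functionals vanishing on [l] alone. *)
have [t tP] : exists t, forall f, N f -> `|xi f - t * f y| <= c * dual_norm f.
  have [[f0 Nf0 f0y]|N0] := pselect (exists2 f0 : dual X, N f0 & f0 y = 1); last first.
    exists 0 => f Nf; rewrite mul0r subr0; apply: H => x; rewrite inE => /predU1P[->|]; last exact: Nf.
    apply: contrapT => fy; apply: N0; exists ((f y)^-1 *: f).
      by move=> z zl; rewrite dual_scaleE (Nf z zl) mulr0.
    by rewrite dual_scaleE mulVf//; exact/eqP.
  (* Each such [f] confines [t] to an interval. Differences of two of them vanish at [y], so any two
     intervals meet and [sup A] lies in all of them. *)
  pose A := [set xi f - c * dual_norm f | f in [set f | N f /\ f y = 1]].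
  have ubA f : N f -> f y = 1 -> ubound A (xi f + c * dual_norm f).
    move=> Nf fy _ [g [Ng gy] <-].
    have : `|xi (-1 *: f + g)| <= c * dual_norm (-1 *: f + g).
      apply: H => x; rewrite inE !dualE => /predU1P[->|xl].
        by rewrite fy gy mulN1r addNr.
      by rewrite (Nf x xl) (Ng x xl) mulr0 addr0.
    rewrite lxi => /(le_trans (ler_norm _)).
    have := ler_wpM2l c0 (dual_normD (-1 *: f) g); rewrite dual_normZ normrN1 mul1r mulrDr.
    by lra.
  have hsA : has_sup A.
    split; first by exists (xi f0 - c * dual_norm f0), f0.
    by exists (xi f0 + c * dual_norm f0); exact: ubA.
  exists (sup A).
  have key f : N f -> f y = 1 -> `|xi f - sup A| <= c * dual_norm f.
    move=> Nf fy; have : sup A <= xi f + c * dual_norm f by apply: ge_sup; [exact: hsA.1|exact: ubA].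
    have : xi f - c * dual_norm f <= sup A by apply: ub_le_sup; [exact: hsA.2|exists f].
    by rewrite ler_norml => *; apply/andP; split; lra.
  move=> f Nf; have [fy|fy] := eqVneq (f y) 0.
    rewrite fy mulr0 subr0; apply: H => x; rewrite inE => /predU1P[->//|]; exact: Nf.
  pose g := (f y)^-1 *: f.
  have fE : f = f y *: g by rewrite /g scalerA mulfV// scale1r.
  have gy : g y = 1 by rewrite /g dual_scaleE mulVf.
  have Ng : N g by move=> x xl; rewrite /g dual_scaleE (Nf x xl) mulr0.
  rewrite [in X in dual_norm X]fE [in X in xi X]fE dual_normZ dual_linearZ//.
  rewrite [sup A * _]mulrC -mulrBr normrM mulrCA ler_wpM2l//.
  exact: key.
have lxi' : dual_linear (fun f => xi f - t * f y).
  by move=> a f g; rewrite lxi dual_addE dual_scaleE; ring.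
have [x xP] := IH _ lxi' c0 tP.
exists (t *: y + x) => f; have := xP f.
by rewrite dualD dualZ opprD addrA.
Qed.

(** If the second alternative fails for every bound [n.+1], [helly] gives points [x n] approximating
    [xi] within [n.+1%:R^-1] on the unit ball. They are Cauchy, and [xi] is evaluation at their
    limit. *)
Lemma eval_or_unbounded xi : dual_linear xi -> (exists x, forall f, xi f = f x) \/
  exists2 M : R, 0 <= M & forall l : seq X,
    exists f, [/\ bounded_by M f, forall x, x \in l -> f x = 0 & xi f = 1].
Proof.
move=> lxi; apply: contrapT => /not_orP[neval nunb].
have : forall n, exists x, forall f, `|xi f - f x| <= n.+1%:R^-1 * dual_norm f.
  move=> n; have [l lP] : exists l : seq X, forall f, (forall x, x \in l -> f x = 0) ->
      `|xi f| <= n.+1%:R^-1 * dual_norm f.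
    apply: contrapT => nl; apply: nunb; exists n.+1%:R => // l.
    apply: contrapT => nf; apply: nl; exists l => f fl.
    rewrite leNgt; apply/negP => xif; apply: nf.
    have xif0 : xi f != 0.
      rewrite -normr_gt0; apply: le_lt_trans xif.
      by rewrite mulr_ge0 ?invr_ge0// dual_norm_ge0.
    exists ((xi f)^-1 *: f); split.
    - apply: (@bounded_byS _ _ (`|(xi f)^-1| * dual_norm f)).
        rewrite normfV ler_pdivrMl ?normr_gt0// mulrC -ler_pdivrMl ?ltr0n//.
        exact: ltW.
      exact/bounded_byZ/bounded_by_dual_norm.
    - by move=> x xl; rewrite dual_scaleE fl// mulr0.
    - by rewrite dual_linearZ// mulVf.
  exact: (helly lxi _ lP).
move=> /choice[x xP].
have xd n m : `|x n - x m| <= n.+1%:R^-1 + m.+1%:R^-1.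
  have [f f1 <-] := norming_dual (x n - x m); rewrite dualB.
  have fn : dual_norm f <= 1 by exact: dual_norm_le.
  have xf k : `|xi f - f (x k)| <= k.+1%:R^-1.
    by apply: le_trans (xP k f) _; rewrite ler_piMr// invr_ge0.
  have := xf n; have := xf m; rewrite !ler_norml => /andP[_ xm] /andP[xn _].
  have -> : f (x n) - f (x m) = - (xi f - f (x n)) + (xi f - f (x m)) by ring.
  by apply: lerD => //; rewrite lerNl.
have harm (e : R) : 0 < e -> \forall n \near \oo, n.+1%:R^-1 <= e.
  move=> e0; exists (Num.trunc e^-1).+1 => // n /= en.
  rewrite -[leRHS]invrK lef_pV2 ?posrE ?invr_gt0//.
  by apply: le_trans (ltW (truncnS_gt _)) _; rewrite ler_nat ltnW.
have cx : cvgn x.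
  apply/cauchy_cvgP/cauchy_exP => e e0; have e2 : 0 < e / 3 by rewrite divr_gt0.
  have [N _ NP] := harm _ e2; exists (x N); exists N => // n /= Nn.
  rewrite -ball_normE /=; apply: le_lt_trans (xd N n) _.
  by apply: le_lt_trans (lerD (NP N (leqnn N)) (NP n Nn)) _; lra.
apply: neval; exists (limn x) => f; apply/eqP.
have cf : f (x n) @[n --> \oo] --> f (limn x).
  by apply: continuous_cvg => //; exact: dual_continuous.
rewrite -subr_eq0 -normr_le0; apply/ler_addgt0Pr => e e0; rewrite add0r.
have : `|xi f - f (x n)| @[n --> \oo] --> `|xi f - f (limn x)|.
  by apply: cvg_norm; apply: cvgB => //; exact: cvg_cst.
move=> cn; apply: (cvgr_to_le cn).
have e1 : 0 < e / (1 + dual_norm f) by rewrite divr_gt0 ?ltr_pwDl ?dual_norm_ge0.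
apply: filterS (harm _ e1) => n ne; apply: le_trans (xP n f) _.
apply: (@le_trans _ _ (n.+1%:R^-1 * (1 + dual_norm f))).
  by rewrite ler_wpM2l ?invr_ge0// lerDr.
by rewrite -ler_pdivlMr// ltr_pwDl ?dual_norm_ge0.
Qed.

End bidual.

(** * Iterated limits of integrals of selections *)

Section double_limits.
Context d (T : measurableType d) (R : realType) (X : completeNormedModType R).
Variables (mu : {measure set T -> \bar R}) (G : T -> set X).
Hypothesis cmu : measure_is_complete mu.
Hypothesis cwkG : forall x, cwk (G x).
Hypothesis iG : scalarly_integrable mu G.
Hypothesis wcG : weakly_compact_op (supp_op iG).
Implicit Types (f h : dual X).

Local Notation intg f := (mu.-integrable [set: T] (EFin \o f)).

(** The upper limit is measurable and equals [v] almost everywhere; completeness of [mu] does the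
    rest. *)
Lemma ae_limit_measurable (u : nat -> T -> R) (v : T -> R) :
    (forall n, measurable_fun [set: T] (u n)) ->
    {ae mu, forall t, u n t @[n --> \oo] --> v t} ->
  measurable_fun [set: T] v.
Proof.
move=> mu_ uv; apply/measurable_EFinP.
apply: (@ae_measurable_fun _ _ _ mu cmu _ (fun t => limn_esup (fun n => (u n t)%:E))).
  apply: filterS uv => t ut _ /=.
  apply: (cvg_limn_einf_sup _).2.
  by apply: cvg_EFin => //; exact: nearW.
apply: measurable_fun_limn_esup => n.
exact/measurable_EFinP.
Qed.

Lemma selection_intg (g : T -> X) f : selection G g -> scalarly_measurable g ->
  intg (fun t => f (g t)).
Proof.
move=> sg mg; apply: (intg_le (g := fun t => `|supp f (G t)| + `|supp (- f) (G t)|)).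
- exact: mg.
- move=> t; rewrite [X in _ <= X]ger0_norm ?addr_ge0//.
  exact: norm_dual_le_supp.
- by apply: intgD; apply: intg_norm; exact: iG.
Qed.

(* Iterated limits of [f k (x n)] cannot differ: after convexifying in both
   indices, the pointwise iterated limits exist and agree by weak compactness of
   the values of [G], and the integrals follow by [integral_vanishing]. *)
Lemma no_double_limit_gap (A : set T) (M : R) (f : nat -> dual X)
    (g : nat -> T -> X) (x : nat -> X) :
    measurable A -> 0 <= M -> (forall k, bounded_by M (f k)) ->
    (forall n, selection G (g n)) -> (forall n, scalarly_measurable (g n)) ->
    (forall n h, h (x n) = \int[mu]_(t in A) h (g n t)) ->
    (forall k n, (n < k)%N -> f k (x n) = 0) ->
    (forall k n, (k <= n)%N -> 2^-1 <= f k (x n)) ->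
  False.
Proof.
move=> mA M0 fM sg mg xE f_gt f_le.
have [U UU ooU] := ultra_nat.
have sgt n t : G t (g n t) by exact: sg.
have Ig n h : intg (fun t => h (g n t)) by exact: selection_intg.
have Mle h t : bounded_by M h -> `|h t| <= M * `|t| by exact.
have [||p [pC pcvg]] := @convex_blocks_cvg _ _ _ mu (fun k n t => f k (g n t)).
- by move=> k n; exact: Ig.
- by move=> n t; exists (M * `|g n t|) => k; exact: fM.
pose F k := pcomb f (p k).
have FM k : bounded_by M (F k).
  by move=> v; rewrite pcomb_dual; apply: pcomb_norm_le (pC k) _ => i _; exact: fM.
have Fx k n : (n < k)%N -> F k (x n) = 0.
  move=> nk; have [_ pk _] := pC k; rewrite pcomb_dual /pcomb big1// => i _.
  have [ki|ik] := leqP k i; last by rewrite pk// scale0r.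
  by rewrite f_gt ?scaler0//; exact: leq_trans ki.
have [Finf FinfM FinfU] := dual_ultralimit UU M0 FM.
(* Centring at the ultrafilter limit: along every [g n t] the convexified functionals converge,
   necessarily to [Finf], so [H k] tends to zero there. *)
pose H k := F k - Finf.
have HM k : bounded_by (M + M) (H k) by apply: bounded_byD => //; exact: bounded_byN.
have HE k v : H k v = F k v - Finf v by rewrite dual_addE dual_oppE.
have Hg : {ae mu, forall t n, H k (g n t) @[k --> \oo] --> 0}.
  apply: filterS pcvg => t ct n.
  have cF : cvgn (fun k => F k (g n t)).
    by have := ct n; under eq_fun do rewrite -pcomb_dual.
  have FU : F k (g n t) @[k --> U] --> limn (fun k => F k (g n t)).
    exact: cvg_trans (cvg_app _ ooU) cF.
  have -> : (fun k => H k (g n t)) = (fun k => F k (g n t) - Finf (g n t)).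
    by apply: funext => k; rewrite HE.
  rewrite -[X in _ --> X](subrr (Finf (g n t))); apply: cvgB; last exact: cvg_cst.
  by rewrite (cvg_unique _ (FinfU (g n t)) FU).
have Hx n : \int[mu]_(t in A) H k (g n t) @[k --> \oo] --> 0.
  apply: (integral_vanishing wcG mA HM) => [k|k t|].
  - exact: Ig.
  - exact: norm_dual_le_supp.
  - by apply: filterS Hg => t Ht _; exact: Ht.
(* For [k > n] the integral of [H k (g n t)] is constantly [- Finf (x n)], and it tends to zero. *)
have Finfx n : Finf (x n) = 0.
  apply/eqP; rewrite -oppr_eq0; apply/eqP.
  apply: (cvg_unique _ _ (Hx n)) => //.
  apply: cvg_near_cst; exists n.+1 => // k /= nk.
  by rewrite -xE HE Fx// sub0r.
(* The second convexification, in the index of the selections and simultaneously for all [H k]. *)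
have [||r [rC rcvg]] := @convex_blocks_cvg _ _ _ mu (fun n k t => H k (g n t)).
- by move=> n k; exact: Ig.
- move=> k t; exists (`|supp (H k) (G t)| + `|supp (- H k) (G t)|) => n.
  exact: norm_dual_le_supp.
pose g' n t := pcomb (fun i => g i t) (r n).
have Gg' n t : G t (g' n t).
  have [_ cG _] := cwkG t.
  by apply: (convex_pcomb cG _ (rC n)) => i; exact: sg.
have hg' n h t : h (g' n t) = pcomb (fun i => h (g i t) : R^o) (r n).
  exact: dual_pcomb.
have Ig' n h : intg (fun t => h (g' n t)).
  have -> : (fun t => h (g' n t)) = (fun t => \sum_(i < size (r n)) (r n)`_i * h (g i t)).
    by apply: funext => t; rewrite hg'.
  by apply: intg_sum => i; exact: intgZ.
have /choice[y yP] : forall t, exists y, G t y /\ forall h, h (g' n t) @[n --> U] --> h y.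
  move=> t; have [_ _ wG] := cwkG t.
  have [y Gy yP] := weakly_compact_seq (u := fun n => g' n t) UU wG (filterS (fun n _ => Gg' n t) filterT).
  by exists y.
pose v k t := H k (y t).
have Hv : {ae mu, forall t k, H k (g' n t) @[n --> \oo] --> v k t}.
  apply: filterS rcvg => t ct k.
  have cF : cvgn (fun n => H k (g' n t)).
    by have := ct k; under eq_fun do rewrite -hg'.
  have FU : H k (g' n t) @[n --> U] --> limn (fun n => H k (g' n t)).
    exact: cvg_trans (cvg_app _ ooU) cF.
  by rewrite /v (cvg_unique _ ((yP t).2 (H k)) FU).
have vb k t : `|v k t| <= `|supp (H k) (G t)| + `|supp (- H k) (G t)|.
  by apply: norm_dual_le_supp => //; exact: (yP t).1.
have Isupp k : intg (fun t => `|supp (H k) (G t)| + `|supp (- H k) (G t)|).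
  by apply: intgD; apply: intg_norm; exact: iG.
have mv k : measurable_fun [set: T] (v k).
  apply: (@ae_limit_measurable (fun n t => H k (g' n t))).
    by move=> n; exact: intg_measurable (Ig' n (H k)).
  by apply: filterS Hv => t; exact.
have Iv k : intg (v k).
  apply: intg_le (Isupp k) => // t.
  by rewrite [X in _ <= X]ger0_norm ?addr_ge0.
(* Once [n] exceeds the degree of [p k], the block [r n] only involves indices above those in [p k],
   where the values are at least [2^-1]. *)
have half k : 2^-1 <= \int[mu]_(t in A) v k t.
  have cI : \int[mu]_(t in A) H k (g' n t) @[n --> \oo] --> \int[mu]_(t in A) v k t.
    apply: (Rint_dominated mA (fun n => Ig' n (H k)) (mv k) (Isupp k)).
      by move=> n t _; exact: norm_dual_le_supp.
    by apply: filterS Hv => t Ht _; exact: Ht.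
  apply: (cvgr_to_ge cI); exists (size (p k)) => // n /= pn.
  have -> : \int[mu]_(t in A) H k (g' n t) = pcomb (fun i => H k (x i) : R^o) (r n).
    rewrite /pcomb; under [RHS]eq_bigr do rewrite xE.
    have -> : \sum_(i < size (r n)) (r n)`_i *: (\int[mu]_(t in A) H k (g i t) : R^o) =
        \sum_(i < size (r n)) \int[mu]_(t in A) ((r n)`_i * H k (g i t)).
      by apply: eq_bigr => i _; rewrite RintZ.
    rewrite -Rint_sum//; last by move=> i; exact: intgZ.
    by apply: eq_Rintegral => t _; rewrite hg'.
  apply: pcomb_ge (rC n) _ => i ni; rewrite HE Finfx subr0 pcomb_dual.
  have [p0 _ p1] := pC k; rewrite -[2^-1]mulr1 -[X in _ * X]p1 /pcomb mulr_sumr.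
  apply: ler_sum => j _; rewrite [leLHS]mulrC /GRing.scale/= mulr1.
  rewrite ler_wpM2l//; apply: f_le.
  by apply: ltnW; apply: leq_trans (ltn_ord j) _; exact: leq_trans ni.
(* [y t] lies in the closed span of the [g i t], on which the uniformly bounded [H k] tend to
   zero. *)
have v0 : {ae mu, forall t, A t -> v k t @[k --> \oo] --> 0}.
  apply: filterS Hg => t Ht _.
  have yspan : closed_span (fun i => g i t) (y t).
    apply: closed_spanP => h hg; apply: (cvg_unique _ ((yP t).2 h)) => //.
    apply: cvg_near_cst; apply: (filterS _ filterT) => n _.
    by rewrite hg' /pcomb big1// => i _; rewrite hg scaler0.
  apply/cvgrPdist_le => e e0.
  have M1 : 0 < M + M + 1 by rewrite ltr_wpDl// addr_ge0.
  have [|l yl] := yspan (e / 2 / (M + M + 1)); first by rewrite !divr_gt0.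
  have cl : H k (rat_comb (fun i => g i t) l) @[k --> \oo] --> 0.
    rewrite /rat_comb; elim: l {yl} => [|[a i] l IH].
      by under eq_fun do rewrite big_nil dual0; exact: cvg_cst.
    under eq_fun do rewrite big_cons dualD dualZ /=.
    suff Hl : ratr a * H k (g i t) + H k (\sum_(q <- l) ratr q.1 *: g q.2 t) @[k --> \oo]
        --> (ratr a * 0 + 0 : R) by move: Hl; rewrite mulr0 addr0.
    by apply: cvgD => //; apply: cvgMl_tmp; exact: Ht.
  have e2 : 0 < e / 2 by rewrite divr_gt0.
  have /cvgr0Pnorm_le/(_ _ e2) := cl; apply: filterS => k kle.
  rewrite sub0r normrN /v -(subrK (rat_comb (fun i => g i t) l) (y t)) dualD.
  rewrite (le_trans (ler_normD _ _))// [leRHS]splitr lerD//.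
  apply: le_trans (HM k _) _; apply: (@le_trans _ _ ((M + M + 1) * `|y t - rat_comb (fun i => g i t) l|)).
    by rewrite ler_wpM2r// lerDl.
  by rewrite -ler_pdivlMl// mulrC ltW.
have := cvgr_to_ge (integral_vanishing wcG mA HM Iv vb v0) (nearW _ half).
by move=> h; have : (0 : R) < 2^-1 by []; rewrite ltNge h.
Qed.

End double_limits.

(** * The Pettis integral of one level multifunction *)

Section pettis_level.
Context d (T : measurableType d) (R : realType) (X : completeNormedModType R).
Variable mu : {measure set T -> \bar R}.
Implicit Types (f h : dual X) (G : T -> set X) (A : set T).

Definition selection_integrals G A : set X := [set x | exists g : T -> X,
  [/\ selection G g, scalarly_measurable g &
      forall f, f x = \int[mu]_(t in A) f (g t)]].

(** Written with basic weak neighbourhoods, so that finitely many functionals can be handled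
    directly. *)
Definition weak_closure (S : set X) : set X :=
  [set x | forall (l : seq (dual X)) (e : R), 0 < e ->
     exists2 y, S y & forall f, f \in l -> `|f x - f y| < e].

Lemma sub_weak_closure S : S `<=` weak_closure S.
Proof. by move=> x Sx l e e0; exists x => // f _; rewrite subrr normr0. Qed.

Lemma weak_closureS S S' : S `<=` S' -> weak_closure S `<=` weak_closure S'.
Proof. by move=> SS x Sx l e e0; have [y Sy yl] := Sx l e e0; exists y => //; exact: SS. Qed.

Lemma weak_closure_le S f (c : R) : (forall x, S x -> f x <= c) ->
  forall x, weak_closure S x -> f x <= c.
Proof.
move=> Sc x Sx; apply/ler_addgt0Pr => e e0.
have [y Sy yf] := Sx [:: f] e e0; have := yf f (mem_head _ _); have := Sc y Sy.
by have := ler_norm (f x - f y); lra.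
Qed.

Lemma selection_integralsS G G' A : (forall t, G t `<=` G' t) ->
  selection_integrals G A `<=` selection_integrals G' A.
Proof.
move=> GG x [g [sg mg xg]]; exists g; split => // t.
by apply: GG; exact: sg.
Qed.

Section level.
Variables (G : T -> set X) (A : set T).
Hypothesis cmu : measure_is_complete mu.
Hypothesis cwkG : forall x, cwk (G x).
Hypothesis iG : scalarly_integrable mu G.
Hypothesis wcG : weakly_compact_op (supp_op iG).
Hypothesis selG : forall g, selection G g -> scalarly_measurable g ->
  pettis_integrable mu g.
Hypothesis mA : measurable A.

Local Notation intg f := (mu.-integrable [set: T] (EFin \o f)).
Let I := selection_integrals G A.
Let W := weak_closure I.

Let smG : scalarly_measurable_mf G.
Proof. by split => // f; exact: intg_measurable (iG f). Qed.

Let Isel g f : selection G g -> scalarly_measurable g -> intg (fun t => f (g t)).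
Proof. exact: selection_intg. Qed.

Let I_of g : selection G g -> scalarly_measurable g ->
  exists x, forall f, f x = \int[mu]_(t in A) f (g t).
Proof.
move=> sg mg; have [_ /(_ A mA)[x xP]] := selG sg mg; exists x => f.
have := xP f; rewrite Rint_EFin//; [by case|exact: Isel].
Qed.

(** A measurable selection of the face exposed by [f] attains the support function pointwise; the
    weight from [supp_weight] also controls this face, which is contained in [G t]. *)
Let I_face f : exists2 x, I x & f x = \int[mu]_(t in A) supp f (G t).
Proof.
have [w [Iw w0 wP]] := supp_weight cwkG wcG.
have sF := scalarly_measurable_face f smG.
have [h|g sg mg] := scalarly_measurable_selection Iw w0 cmu sF.
  apply: filterS (wP h) => t wt /wt Gt0; apply/eqP; rewrite eq_le.
  rewrite width_ge0 ?andbT; last exact: face_cwk.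
  rewrite -Gt0; apply: width_sub => //; [exact: face_cwk|exact: face_sub].
have sg' : selection G g by move=> t; exact: (sg t).1.
have [x xP] := I_of sg' mg; exists x; first by exists g.
by rewrite xP; apply: eq_Rintegral => t _; exact: (sg t).2.
Qed.

Let I_le f x : I x -> f x <= \int[mu]_(t in A) supp f (G t).
Proof.
move=> [g [sg mg ->]]; apply: (Rint_le mA (Isel f sg mg) (iG f)).
by move=> t _; apply: le_supp => //; exact: sg.
Qed.

Let W_le f x : W x -> f x <= \int[mu]_(t in A) supp f (G t).
Proof. by apply: weak_closure_le => y; exact: I_le. Qed.

Let I_convex x y (t : R) : 0 <= t <= 1 -> I x -> I y -> I (t *: x + (1 - t) *: y).
Proof.
move=> t01 [g [sg mg xg]] [h [sh mh yh]].
exists (fun w => t *: g w + (1 - t) *: h w); split.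
- move=> w; have [_ /convex_setE cG _] := cwkG w.
  by apply: cG; [exact: sg|exact: sh|].
- move=> f.
  have -> : (fun w => f (t *: g w + (1 - t) *: h w)) =
      (fun w => t * f (g w) + (1 - t) * f (h w)).
    by apply: funext => w; rewrite dualD !dualZ.
  by apply: measurable_funD; apply: measurable_funM.
- move=> f; rewrite dualD !dualZ xg yh -!RintZ ?Isel//.
  rewrite -RintD ?intgZ ?Isel//.
  by apply: eq_Rintegral => w _; rewrite dualD !dualZ.
Qed.

Let W_convex x y (t : R) : W x -> W y -> 0 <= t <= 1 -> W (t *: x + (1 - t) *: y).
Proof.
move=> Wx Wy /[dup] t01 /andP[t0 t1] l e e0.
have e2 : 0 < e / 2 by rewrite divr_gt0.
have [x' Ix xl] := Wx l _ e2; have [y' Iy yl] := Wy l _ e2.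
exists (t *: x' + (1 - t) *: y'); first exact: I_convex.
move=> f fl; have := ltW (xl f fl); have := ltW (yl f fl); rewrite !dualD !dualZ.
move: (f x) (f x') (f y) (f y') => a a' b b' bb aa.
have -> : t * a + (1 - t) * b - (t * a' + (1 - t) * b') =
    t * (a - a') + (1 - t) * (b - b') by ring.
have t1' : 0 <= 1 - t by rewrite subr_ge0.
rewrite (le_lt_trans (ler_normD _ _))// !normrM (ger0_norm t0) (ger0_norm t1').
have := ler_wpM2l t0 aa; have := ler_wpM2l t1' bb.
by move: (`|a - a'|) (`|b - b'|) => p q; lra.
Qed.

(* If an ultrafilter limit [xi] on [W] were not an evaluation, [helly] would
   yield functionals [f k] and integrals [x n] of selections with a double
   limit gap. *)
Let W_compact : weakly_compact W.
Proof.
apply/weakly_compactP => U UU UW.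
have /choice[xi xiP] : forall f, exists l : R, f x @[x --> U] --> l.
  move=> f; pose B := `|\int[mu]_(t in A) supp f (G t)| + `|\int[mu]_(t in A) supp (- f) (G t)|.
  apply: (ultra_bounded_cvg (M := B)); apply: filterS UW => x Wx.
  have := W_le f Wx; have := W_le (- f) Wx; rewrite dual_oppE /B.
  set a := \int[mu]_(t in A) _; set b := \int[mu]_(t in A) _.
  have := ler_norm a; have := ler_norm b; have := normr_ge0 a; have := normr_ge0 b.
  by rewrite /= ler_norml => *; apply/andP; split; lra.
have lxi : dual_linear xi.
  move=> a f g; apply: (cvg_unique _ (xiP (a *: f + g))) => //.
  have -> : (fun x => (a *: f + g) x) = (fun x => a * f x + g x).
    by apply: funext => x; rewrite dual_addE dual_scaleE.
  by apply: cvgD => //; apply: cvgMl_tmp.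
(* [xi] is approximated by genuine integrals of selections and not just by points of their
   closure. *)
have near_xi (l : seq (dual X)) (e : R) : 0 < e ->
    exists2 y, I y & forall f, f \in l -> `|xi f - f y| < e.
  move=> e0; have e2 : 0 < e / 2 by rewrite divr_gt0.
  have Ul : U [set x | forall f, f \in l -> `|xi f - f x| < e / 2].
    elim: l => [|f l IH]; first by apply: (filterS _ filterT).
    have := xiP f => /cvgrPdist_lt /(_ _ e2) Uf.
    by apply: filterS2 IH Uf => x xl xf h; rewrite inE => /predU1P[->|/xl].
  have [x [xl Wx]] := filter_ex (filterI Ul UW).
  have [y Iy yl] := Wx l _ e2; exists y => // f fl.
  rewrite [ltRHS]splitr -(subrKA (f x)) (le_lt_trans (ler_normD _ _))//.
  by rewrite ltrD// ?xl ?yl.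
have [[x xE]|[M M0 unb]] := eval_or_unbounded lxi.
  exists x; last by move=> f; rewrite -xE.
  by move=> l e e0; have [y Iy yl] := near_xi l e e0; exists y => // f /yl; rewrite xE.
exfalso.
pose E := (dual X * (X * (T -> X)))%type.
(* Given the triples in [s], the next functional kills all earlier points, and the next point is
   taken close to [xi] on all functionals so far; since [xi] is [1] on them, an error below [2^-1]
   suffices. *)
have /choice[nx nxP] : forall s : seq E, exists e : E,
    (forall e', e' \in [seq q.1 | q <- s] -> xi e' = 1) ->
    [/\ bounded_by M e.1, forall x, x \in [seq q.2.1 | q <- s] -> e.1 x = 0,
        xi e.1 = 1, [/\ selection G e.2.2, scalarly_measurable e.2.2 &
          forall h, h e.2.1 = \int[mu]_(t in A) h (e.2.2 t)] &
        forall f, f \in e.1 :: [seq q.1 | q <- s] -> 2^-1 <= f e.2.1].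
  move=> s; have [f [fM fs xif]] := unb [seq q.2.1 | q <- s].
  have [y [g [sg mg yg]] yl] := near_xi (f :: [seq q.1 | q <- s]) 2^-1 ltac:(by rewrite invr_gt0).
  exists (f, (y, g)) => sxi; split => // h hl.
  have xih : xi h = 1 by move: hl; rewrite inE => /predU1P[->//|/sxi].
  by have := yl h hl; rewrite xih ltr_norml => /andP[_]; lra.
pose st := fix st n : seq E := if n is m.+1 then nx (st m) :: st m else [::].
have st_xi n : forall e', e' \in [seq q.1 | q <- st n] -> xi e' = 1.
  elim: n => [//|n IH] e' /=; rewrite inE => /predU1P[->|/IH//].
  by have [] := nxP _ IH.
pose e n := nx (st n).
have eP n := nxP _ (st_xi n).
have st1 m n : (m < n)%N -> (e m).1 \in [seq q.1 | q <- st n].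
  elim: n => // n IH; rewrite ltnS leq_eqVlt => /predU1P[->|/IH mn] /=.
    exact: mem_head.
  by rewrite inE mn orbT.
have st2 m n : (m < n)%N -> (e m).2.1 \in [seq q.2.1 | q <- st n].
  elim: n => // n IH; rewrite ltnS leq_eqVlt => /predU1P[->|/IH mn] /=.
    exact: mem_head.
  by rewrite inE mn orbT.
apply: (@no_double_limit_gap _ _ _ _ _ _ cmu cwkG iG wcG A M (fun k => (e k).1)
  (fun n => (e n).2.2) (fun n => (e n).2.1)) => //.
- by move=> k; case: (eP k).
- by move=> n; case: (eP n) => _ _ _ [].
- by move=> n; case: (eP n) => _ _ _ [].
- by move=> n; case: (eP n) => _ _ _ [].
- by move=> k n nk; case: (eP k) => _ H _ _ _; apply: H; exact: st2.
- move=> k n; rewrite leq_eqVlt => /predU1P[->|kn].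
    by case: (eP n) => _ _ _ _ H; apply: H; exact: mem_head.
  by case: (eP n) => _ _ _ _ H; apply: H; rewrite inE st1 ?orbT.
Qed.

Lemma weak_closure_selection_integrals :
  cwk (weak_closure (selection_integrals G A)) /\
  forall f, supp f (weak_closure (selection_integrals G A)) =
            \int[mu]_(t in A) supp f (G t).
Proof.
have cW : cwk W.
  split; [|by apply/convex_setE => x y t; exact: W_convex|exact: W_compact].
  by have [x Ix _] := I_face 0; exists x; exact: sub_weak_closure.
split=> // f; apply/eqP; rewrite eq_le; apply/andP; split.
  by apply: supp_le => // x; exact: W_le.
have [x Ix <-] := I_face f; apply: le_supp => //.
exact: sub_weak_closure.
Qed.

End level.
End pettis_level.

(** * Fuzzy numbers from their levels *)

Section fuzzy_levels.
Context (R : realType) (X : completeNormedModType R).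

(** Levels increasing to [r] and strictly below it; [n.+2] keeps the first one positive. *)
Definition level_approx (r : R) (n : nat) : R := r * (1 - n.+2%:R^-1).

Lemma level_approx01 r n : 0 < r <= 1 -> 0 < level_approx r n <= 1.
Proof.
move=> /andP[r0 r1]; have n1 : n.+2%:R^-1 < 1 :> R by rewrite invf_lt1// ltr1n.
have n0 : 0 <= n.+2%:R^-1 :> R by rewrite invr_ge0.
by rewrite /level_approx mulr_gt0 ?subr_gt0//= mulr_ile1 ?(ltW r0) ?subr_ge0 ?(ltW n1)// gerBl.
Qed.

Lemma level_approx_le r n : 0 < r -> level_approx r n <= r.
Proof. by move=> r0; rewrite /level_approx ler_piMr ?(ltW r0)// gerBl invr_ge0. Qed.

Lemma level_approxS r n : 0 < r -> level_approx r n <= level_approx r n.+1.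
Proof.
move=> r0; rewrite /level_approx ler_wpM2l ?(ltW r0)// lerB// lef_pV2 ?posrE//.
by rewrite ler_nat.
Qed.

Lemma level_approx_sup r s : 0 < r -> (forall n, level_approx r n <= s) -> r <= s.
Proof.
move=> r0 rs; apply/ler_addgt0Pr => e e0.
have := rs (Num.trunc (r / e)); set n := Num.trunc _; rewrite /level_approx.
suff re : r * n.+2%:R^-1 <= e.
  by rewrite mulrBr mulr1 lerBlDr => /le_trans; apply; rewrite lerD2l.
rewrite ler_pdivrMr ?ltr0n// -ler_pdivrMl// mulrC.
apply: le_trans (ltW (truncnS_gt _)) _; by rewrite ler_nat.
Qed.

Lemma fuzzy_level_bigcap (u : X -> R) r : 0 < r ->
  fuzzy_level u r = \bigcap_n fuzzy_level u (level_approx r n).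
Proof.
move=> r0; apply/seteqP; split=> [x rx n _|x rx].
  by apply: le_trans rx; exact: level_approx_le.
by apply: level_approx_sup => // n; exact: rx.
Qed.

(** The membership degree is the supremum of the levels containing the point. As [W] need not be
    left continuous, the level sets are the intersections over smaller levels. *)
Lemma fuzzy_number_of_levels (W : R -> set X) :
    (forall r, 0 < r <= 1 -> cwk (W r)) ->
    (forall q r, 0 < q -> q <= r -> r <= 1 -> W r `<=` W q) ->
  exists M : fuzzy_number X, forall r, 0 < r <= 1 ->
    fuzzy_level M r = \bigcap_n W (level_approx r n).
Proof.
move=> cW mW.
(* The extra element [0] gives degree zero to points that lie in no [W r]. *)
pose S x := [set r | r = 0 \/ (0 < r <= 1 /\ W r x)].
pose u x := sup (S x).
have hS x : has_sup (S x).
  split; first by exists 0; left.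
  by exists 1 => r [->|[/andP[]]].
have lev r : 0 < r <= 1 -> fuzzy_level u r = \bigcap_n W (level_approx r n).
  move=> r01; have /andP[r0 r1] := r01; apply/seteqP; split=> [x rx n _|x rx].
    have /andP[q0 q1] := level_approx01 n r01.
    have qu : level_approx r n < u x.
      by apply: lt_le_trans rx; rewrite /level_approx -[ltRHS]mulr1 ltr_pM2l// ?gtrBl ?invr_gt0.
    have [s Ss qs] := sup_adherent (eps := u x - level_approx r n) ltac:(by rewrite subr_gt0) (hS x).
    rewrite opprB addrC subrK in qs.
    case: Ss => [s0|[/andP[s0 s1] Ws]]; first by move: qs; rewrite s0 ltNge (ltW q0).
    by apply: mW Ws => //; exact: ltW.
  apply: level_approx_sup => // n; apply: ub_le_sup; first exact: (hS x).2.
  by right; split; [exact: level_approx01|exact: rx].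
have u01 x : 0 <= u x <= 1.
  apply/andP; split; first by apply: ub_le_sup; [exact: (hS x).2|left].
  by apply: ge_sup; [exact: (hS x).1|move=> r [->|[/andP[]]]].
have cu r : 0 < r <= 1 -> cwk (fuzzy_level u r).
  move=> r01; rewrite lev//; have /andP[r0 r1] := r01.
  apply: (cwk_bigcap _ _).1 => n; first by apply: cW; exact: level_approx01.
  have /andP[q0 _] := level_approx01 n r01.
  have /andP[_ q1] := level_approx01 n.+1 r01.
  by apply: mW => //; exact: level_approxS.
by exists (FuzzyNumber u01 cu).
Qed.

End fuzzy_levels.

(** * Pettis integrability of the fuzzy mapping *)

Theorem theorem4p2 (R : realType) (d : measure_display) (T : measurableType d)
    (mu : {measure set T -> \bar R}) (X : completeNormedModType R)
    (G : T -> fuzzy_number X)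
    (* the sigma-algebra consists of all mu-measurable sets *)
    (mu_complete : measure_is_complete mu)
    (intG : fuzzy_scalarly_integrable mu G)
    (wcG : forall (r : R) (r01 : 0 < r <= 1),
      weakly_compact_op (supp_op (intG r r01)))
    (selG : forall r : R, 0 < r <= 1 -> forall g : T -> X,
      selection (mf_level G r) g -> scalarly_measurable g ->
      pettis_integrable mu g) :
  fuzzy_pettis_integrable mu G.
Proof.
have iG r (r01 : 0 < r <= 1) f := intG r r01 f.
have cG r : 0 < r <= 1 -> forall t, cwk (mf_level G r t).
  by move=> r01 t; exact: fuzzy_level_cwk.
pose W A r := weak_closure (selection_integrals mu (mf_level G r) A).
have WP A r : measurable A -> 0 < r <= 1 -> cwk (W A r) /\ forall f,
    supp f (W A r) = \int[mu]_(t in A) supp f (mf_level G r t).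
  move=> mA r01.
  exact: (weak_closure_selection_integrals mu_complete (cG r r01) (wcG r r01)
    (selG r r01) mA).
split=> [r r01|A mA].
  split=> [|A mA]; first by move=> f; exact: iG.
  have [cW sW] := WP A r mA r01; exists (W A r) => // f.
  by rewrite sW Rint_EFin//; exact: iG.
have cWA r : 0 < r <= 1 -> cwk (W A r) by move=> /(WP A r mA)[].
have GS q r t : q <= r -> mf_level G r t `<=` mf_level G q t.
  by move=> qr x; exact: le_trans.
have mW q r : 0 < q -> q <= r -> r <= 1 -> W A r `<=` W A q.
  by move=> _ qr _; apply/weak_closureS/selection_integralsS => t; exact: GS.
have [M MW] := fuzzy_number_of_levels cWA mW.
exists M => r r01 f; have /andP[r0 r1] := r01.
rewrite Rint_EFin//; last exact: iG.
congr EFin; pose q := level_approx r.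
have q01 n : 0 < q n <= 1 by exact: level_approx01.
have qS n : q n <= q n.+1 by exact: level_approxS.
have q0le n : q 0%N <= q n by elim: n => // n IH; exact: le_trans IH (qS n).
have qW n : W A (q n.+1) `<=` W A (q n).
  by apply: mW; [have /andP[] := q01 n|exact: qS|have /andP[] := q01 n.+1].
have [_ /(_ f) cvW] := cwk_bigcap (fun n => cWA _ (q01 n)) qW.
rewrite MW//; apply/esym.
(* The support functions of [W A (q n)] converge to that of the intersection; as integrals they also
   converge to the integral at level [r], so the two limits agree. *)
apply: (cvg_unique _ _ cvW) => //.
have -> : (fun n => supp f (W A (q n))) =
    (fun n => \int[mu]_(t in A) supp f (mf_level G (q n) t)).
  by apply: funext => n; exact: (WP A _ mA (q01 n)).2.
(* Levels decrease, so the support function at level [q n] lies between those at levels [r] and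
   [q 0]. *)
apply: (Rint_dominated mA (g := fun t =>
  `|supp f (mf_level G (q 0%N) t)| + `|supp f (mf_level G r t)|)).
- by move=> n; exact: iG.
- exact: intg_measurable (intG r r01 f).
- by apply: intgD; apply: intg_norm; exact: iG.
- move=> n t _.
  have s1 : supp f (mf_level G (q n) t) <= supp f (mf_level G (q 0%N) t).
    by apply: supp_sub; [exact: cG|exact: cG|exact: GS].
  have s2 : supp f (mf_level G r t) <= supp f (mf_level G (q n) t).
    by apply: supp_sub; [exact: cG|exact: cG|exact/GS/level_approx_le].
  move: s1 s2; set a := supp _ _; set b := supp _ _; set c := supp _ _.
  have := ler_norm b; have := lerNnormlW (lexx `|c|); have := normr_ge0 b.
  have := normr_ge0 c.
  by rewrite ler_norml => *; apply/andP; split; lra.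
- apply: aeW => t _.
  have [_ /(_ f)] := cwk_bigcap (fun n => cG _ (q01 n) t) (fun n => GS _ _ t (qS n)).
  by rewrite -[X in _ --> supp f X](fuzzy_level_bigcap (G t) r0).
Qed.
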